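(* The Fano index of an $n$-dimensional well-formed weighted projective space with canonical singularities is at most $y_n(2y_n-1)$, where $y_n=s_n-1$ and $(s_i)_{i\ge 1}$ is the Sylvester sequence.
   Context: The Sylvester sequence is defined recursively by $s_1=2$ and $s_i=s_1\cdots s_{i-1}+1$; put $y_i=s_i-1$. For positive integers $a_1,\dots,a_{n+1}$, the weighted projective space $\mathbb P(a_1,\dots,a_{n+1})$ is the quotient variety $(\mathbb A^{n+1}\setminus 0)/\mathbb G_m$, where the multiplicative group $\mathbb G_m$ acts by $t\cdot(x_1,\dots,x_{n+1})=(t^{a_1}x_1,\dots,t^{a_{n+1}}x_{n+1})$. It is well-formed if $\gcd(a_1,\dots,\widehat{a_i},\dots,a_{n+1})=1$ for every $i$. A normal projective variety is called Fano if its anti-canonical divisor is ample. For a Fano variety $X$ with canonical singularities, its Fano index is $q(X)=\max\{q\in\mathbb Z_{>0}\mid -K_X\sim_{\mathbb Q} qA,\ A\in \mathrm{Cl}(X)\}$, where $\mathrm{Cl}(X)$ is the Weil divisor class group. For a well-formed weighted projective space $X=\mathbb P(a_1,\dots,a_{n+1})$ the Fano index is the sum of the weights, $q(X)=a_1+\cdots+a_{n+1}$.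
   Formalization: The dimension n is assumed to be at least 2: for n = 1 the only well-formed weighted projective space is P(1,1) = P^1, which is smooth of Fano index 2, while y_1(2y_1-1) = 1, so the claim as printed fails there. *)

(* Defs.v *)
From HB Require Import structures.
From mathcomp Require Import all_boot all_order all_algebra.
From mathcomp Require Import boolp classical_sets cardinality.
From mathcomp Require Import mpoly.

Set Implicit Arguments.
Unset Strict Implicit.
Unset Printing Implicit Defensive.

Import Order.TTheory GRing.Theory Num.Theory.

Local Open Scope ring_scope.

(* Sylvester's sequence, indexed from 1.                                      *)

Fixpoint sylvester_prod (m : nat) : nat :=
  if m is m'.+1 then sylvester_prod m' * (sylvester_prod m').+1 else 1.

Definition sylvester (i : nat) : nat := (sylvester_prod i.-1).+1.

Lemma sylvester1 : sylvester 1 = 2%N. Proof. by []. Qed.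

Lemma sylvesterE (i : nat) : (0 < i)%N ->
  sylvester i = (\prod_(1 <= j < i) sylvester j).+1%N.
Proof.
case: i => // i _; congr (_.+1); elim: i => [|i IHi]; first by rewrite big_nil.
by rewrite big_nat_recr //= -IHi.
Qed.

Definition sylvester_y (i : nat) : nat := (sylvester i).-1.

(* Varieties over k are described classically, as sets X of local subrings    *)
(* of a function field K: the local rings O_{X,x} of the closed points x of X *)
(* (viewed as subrings of K). The field inclusion k -> K is iota, and n is    *)
(* the dimension.                                                             *)

Section Models.
Variables (k K : fieldType) (iota : {rmorphism k -> K}).

(* Normalized discrete valuations of K, trivial on k. The value at 0, which   *)
(* should be +oo, is set to 0 so that v is determined by its valuation ring.  *)
Definition is_dval (v : K -> int) : Prop :=
  [/\ v 0 = 0,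
      forall x y, x != 0 -> y != 0 -> v (x * y) = v x + v y,
      forall x y, x != 0 -> y != 0 -> x + y != 0 ->
        Num.min (v x) (v y) <= v (x + y),
      exists x, v x = 1
    & forall c : k, v (iota c) = 0].

Definition val_ring (v : K -> int) : set K := [set x | x = 0 \/ 0 <= v x].

(* v is the valuation of a prime divisor of a variety birational to X (that   *)
(* is, a divisor "over" X, as soon as v has a centre on X) iff its residue    *)
(* field has transcendence degree n - 1 over k; for n = trdeg K this is the   *)
(* largest possible value.                                                    *)
Definition divisorial (n : nat) (v : K -> int) : Prop :=
  is_dval v /\
  exists u : 'I_n.-1 -> K, (forall i, val_ring v (u i)) /\
    forall P : {mpoly k[n.-1]}, P != 0 ->
      mmap iota u P != 0 /\ v (mmap iota u P) = 0.

(* The valuation ring of v is the localization of O at a prime ideal. When    *)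
(* O = O_{X,x} with X normal, these v are the prime divisors of X through x.  *)
Definition prime_divisor_at (O : set K) (v : K -> int) : Prop :=
  [/\ is_dval v, (O `<=` val_ring v)%classic
    & forall z, val_ring v z ->
        exists a b, [/\ O a, O b, b != 0, v b = 0 & z = a / b]].

Definition prime_divisor (X : set (set K)) (v : K -> int) : Prop :=
  exists2 O, X O & prime_divisor_at O v.

Definition integrally_closed (O : set K) : Prop :=
  forall (x : K) (p : {poly K}), p \is monic -> (forall i, O p`_i) ->
    root p x -> O x.

Definition normal_model (X : set (set K)) : Prop :=
  forall O, X O -> integrally_closed O.

Definition derivation (d : K -> K) : Prop :=
  [/\ forall x y, d (x + y) = d x + d y,
      forall x y, d (x * y) = d x * y + x * d y
    & forall c : k, d (iota c) = 0].

(* A K-basis D of Der_k(K). It stands for the rational top form omega such    *)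
(* that omega(D_1, ..., D_n) = 1; in characteristic 0 every nonzero rational  *)
(* top form arises in this way, and n is the transcendence degree of K.       *)
Definition frame (n : nat) (D : 'I_n -> K -> K) : Prop :=
  (forall j, derivation (D j)) /\
  forall d, derivation d ->
    exists! c : 'rV[K]_n, forall x, d x = \sum_j c 0 j * D j x.

(* du_1 /\ ... /\ du_n = jacobian D u * omega.                                *)
Definition jacobian (n : nat) (D : 'I_n -> K -> K) (u : 'I_n -> K) : K :=
  \det (\matrix_(i, j) D j (u i)).

(* Let R be the valuation ring of v, with uniformizer pi. The image of        *)
(* Omega^n_{R/k} in Omega^n_{K/k} is spanned over R by the du_1 /\ ... /\ du_n *)
(* with u_i in R. So it is R pi^{-c} omega, that is, omega is pi^c times a    *)
(* generator, iff - c is the least value of v on the nonzero Jacobians.       *)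
Definition has_form_order (n : nat) (D : 'I_n -> K -> K) (v : K -> int)
    (c : int) : Prop :=
  (forall u, (forall i, val_ring v (u i)) -> jacobian D u != 0 ->
     - c <= v (jacobian D u)) /\
  (exists u, [/\ forall i, val_ring v (u i), jacobian D u != 0
     & v (jacobian D u) = - c]).

(* The order of omega along v; restricted to the prime divisors of X, this is *)
(* the canonical divisor K_X = div(omega).                                    *)
Definition form_order (n : nat) (D : 'I_n -> K -> K) (v : K -> int) : int :=
  xget 0 [set c | has_form_order D v c].

(* f is an equation of the divisor m K_X near the point with local ring O.    *)
Definition local_equation (n : nat) (D : 'I_n -> K -> K) (m : nat)
    (O : set K) (f : K) : Prop :=
  f != 0 /\
  forall v, prime_divisor_at O v -> v f = m%:Z * form_order D v.

Definition exceptional_over (n : nat) (X : set (set K)) (v : K -> int) : Prop :=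
  divisorial n v /\ ~ prime_divisor X v.

(* Discrepancy along v, computed from an equation f of m K_X at a point of    *)
(* the centre of v.                                                           *)
Definition discrepancy (n : nat) (D : 'I_n -> K -> K) (m : nat) (f : K)
    (v : K -> int) : rat :=
  (form_order D v)%:~R - (v f)%:~R / m%:R.

(* The points of X with O `<=` val_ring v are those of the centre of v on X.  *)
(* The condition on D does not depend on the choice of the frame.             *)
Definition canonical_singularities (n : nat) (X : set (set K)) : Prop :=
  normal_model X /\
  forall D : 'I_n -> K -> K, frame D ->
    (exists2 m : nat, (0 < m)%N &
       forall O, X O -> exists f, local_equation D m O f) /\
    (forall (m : nat) O f v, (0 < m)%N -> X O -> local_equation D m O f ->
       exceptional_over n X v -> (O `<=` val_ring v)%classic ->
       0 <= discrepancy D m f v).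

(* Weil divisors are functions on prime divisors; their values at other       *)
(* valuations are irrelevant.                                                 *)
Definition weil_divisor (X : set (set K)) (A : (K -> int) -> int) : Prop :=
  finite_set [set v | prime_divisor X v /\ A v != 0].

Definition Qlin_equiv (X : set (set K)) (A B : (K -> int) -> int) : Prop :=
  exists2 m : nat, (0 < m)%N & exists2 f : K, f != 0 &
    forall v, prime_divisor X v -> m%:Z * (A v - B v) = v f.

(* - K_X ~_Q q A for some class A in Cl(X). Changing the frame replaces K_X by *)
(* a linearly equivalent divisor.                                             *)
Definition divides_anticanonical (n : nat) (X : set (set K)) (q : nat) : Prop :=
  forall D : 'I_n -> K -> K, frame D ->
    exists2 A, weil_divisor X A &
      Qlin_equiv X (fun v => - form_order D v) (fun v => q%:Z * A v).

Definition is_fano_index (n : nat) (X : set (set K)) (q : nat) : Prop :=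
  [/\ (0 < q)%N, divides_anticanonical n X q
    & forall q' : nat, (0 < q')%N -> divides_anticanonical n X q' ->
        (q' <= q)%N].

End Models.

Section Subfield.
Variables (F : fieldType) (S : divringClosed F).

Record subfield := Subfield { subfield_val : F; _ : subfield_val \in S }.

HB.instance Definition _ := [isSub for subfield_val].
HB.instance Definition _ := [Choice of subfield by <:].
HB.instance Definition _ := [SubChoice_isSubIntegralDomain of subfield by <:].
HB.instance Definition _ := [SubIntegralDomain_isSubField of subfield by <:].

End Subfield.

(* Weighted projective space P(a_0, ..., a_n) = (A^{n+1} \ 0) / G_m.          *)

Section WeightedProjectiveSpace.
Variables (k : fieldType) (n : nat) (a : 'I_n.+1 -> nat).

Local Notation S := {mpoly k[n.+1]}.
Local Notation L := {fraction S}.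
Local Notation "p %:F" := (@tofrac _ p).

(* p(x_0, ..., x_n) |-> p(t^a_0 x_0, ..., t^a_n x_n)                          *)
Definition gm_act (t : k) (p : S) : S :=
  p \mPo [tuple t ^+ a i *: 'X_i | i < n.+1].

Definition gm_invariant (f : L) : Prop :=
  exists p q : S, [/\ q != 0, f = p%:F / q%:F
    & forall t : k, t != 0 -> gm_act t p * q = p * gm_act t q].

Definition gm_inv : {pred L} := fun f => `[< gm_invariant f >].

Lemma gm_actD t : {morph gm_act t : p q / p + q}.
Proof. by move=> p q; rewrite /gm_act rmorphD. Qed.

Lemma gm_actN t : {morph gm_act t : p / - p}.
Proof. by move=> p; rewrite /gm_act rmorphN. Qed.

Lemma gm_actM t : {morph gm_act t : p q / p * q}.
Proof. by move=> p q; rewrite /gm_act rmorphM. Qed.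

Lemma gm_actC t c : gm_act t c%:MP = c%:MP.
Proof. by rewrite /gm_act comp_mpolyC. Qed.

Lemma gm_invariantC (c : k) : gm_invariant (c%:MP)%:F.
Proof.
exists c%:MP, 1%:MP; split; first by rewrite mpolyC_eq0 oner_eq0.
  by rewrite mpolyC1 rmorph1 divr1.
by move=> t _; rewrite !gm_actC.
Qed.

Lemma gm_inv_divring_closed : divring_closed gm_inv.
Proof.
have toF (p : S) : p != 0 -> p%:F != 0 by rewrite tofrac_eq0.
split=> [|f g|f g].
- apply/asboolP; rewrite -[1]/(1%:F) -mpolyC1; exact: gm_invariantC.
- move=> /asboolP[p [q [q0 -> pq]]] /asboolP[r [s [s0 -> rs]]].
  apply/asboolP; exists (p * s - r * q), (q * s); split.
  + by rewrite mulf_neq0.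
  + rewrite -mulNr addf_div ?toF // mulNr.
    by rewrite -!tofracM -tofracB.
  + move=> t t0; rewrite gm_actD gm_actN !gm_actM.
    rewrite !mulrBl; congr (_ - _).
      by rewrite mulrACA pq // [gm_act t s * s]mulrC mulrACA.
    by rewrite [q * s]mulrC mulrACA rs // [gm_act t q * q]mulrC mulrACA
      [gm_act t s * _]mulrC.
- move=> /asboolP[p [q [q0 -> pq]]] /asboolP[r [s [s0 -> rs]]].
  have [-> | r0] := eqVneq r 0.
    rewrite rmorph0 mul0r invr0 mulr0; apply/asboolP.
    by rewrite -(rmorph0 (@tofrac S)) -mpolyC0; apply: gm_invariantC.
  apply/asboolP; exists (p * s), (q * r); split.
  + by rewrite mulf_neq0.
  + by rewrite invf_div mulf_div -!tofracM.
  + move=> t t0; rewrite !gm_actM mulrACA pq // -[gm_act t s * r]mulrC -rs //.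
    by rewrite [gm_act t r * _]mulrC mulrACA.
Qed.

HB.instance Definition _ :=
  GRing.isDivringClosed.Build L gm_inv gm_inv_divring_closed.

(* The function field, made of the invariant rational functions on A^{n+1}.   *)
Definition wps_field : Type := subfield gm_inv.

HB.instance Definition _ := GRing.Field.on wps_field.

Lemma mpolyC_gm_inv (c : k) : (c%:MP)%:F \in gm_inv.
Proof. by apply/asboolP; exact: gm_invariantC. Qed.

Definition wps_const (c : k) : wps_field := Subfield (mpolyC_gm_inv c).

Lemma wps_const_is_zmod_morphism : zmod_morphism wps_const.
Proof. by move=> c d; apply: val_inj; rewrite /= mpolyCB rmorphB. Qed.

Lemma wps_const_is_monoid_morphism : monoid_morphism wps_const.
Proof.
split; first by apply: val_inj; rewrite /= mpolyC1 rmorph1.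
by move=> c d; apply: val_inj; rewrite /= mpolyCM rmorphM.
Qed.

HB.instance Definition _ :=
  GRing.isZmodMorphism.Build k wps_field wps_const wps_const_is_zmod_morphism.
HB.instance Definition _ :=
  GRing.isMonoidMorphism.Build k wps_field wps_const
    wps_const_is_monoid_morphism.

(* The local ring of the quotient at the orbit of the point x != 0: invariant *)
(* rational functions that are regular at x, hence along its orbit.           *)
Definition wps_local_ring (x : 'I_n.+1 -> k) : set wps_field :=
  [set f | exists p q : S, q.@[x] != 0 /\ subfield_val f = p%:F / q%:F].

Definition wps : set (set wps_field) :=
  [set O | exists2 x : 'I_n.+1 -> k,
             (exists i, x i != 0) & O = wps_local_ring x].

Definition well_formed : Prop :=
  forall i, \big[gcdn/0%N]_(j < n.+1 | j != i) a j = 1%N.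

End WeightedProjectiveSpace.

(* Main.v *)
Require Import Defs.
From mathcomp Require Import all_boot all_order all_algebra.
From mathcomp Require Import boolp classical_sets.
From mathcomp Require Import mpoly.
From mathcomp Require Import zify ring lra.

Set Implicit Arguments.
Unset Strict Implicit.
Unset Printing Implicit Defensive.

Import Order.TTheory GRing.Theory Num.Theory.

Local Open Scope ring_scope.

(** Canonicity makes the origin the only lattice point in the interior of the
    simplex of P(a): any other one gives a monomial valuation of negative
    discrepancy. The Fano index divides the sum h of the weights: the form
    dx_1/x_1 ... dx_n/x_n has simple poles along the coordinate hyperplanes and
    no other zero or pole, and as polynomial rings are factorial, a degree is
    determined modulo M by the orders modulo M along the homogeneous primes.

    Let b_0 >= ... >= b_n be the barycentric coordinates a_i / h of the origin.
    By the box principle, a multiple of (b_i) modulo 1 would be an interior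
    lattice point unless b_0 ... b_(i-1) <= b_i + ... + b_n for all i and
    b_0 ... b_(n-1) <= 1/h. By Abel summation and AM-GM, these constraints make
    b_0 ... b_(n-1), up to lower order terms, at least the product of
    1/s_1, ..., 1/s_(n-1), 1/(2 y_n), which bounds h. *)

(** Discrepancies require [K_X] along every prime divisor. A prime divisor either is a coordinate
    hyperplane or takes the value 0 on all Laurent monomials of weighted degree 0; in the second
    case the logarithmic derivations preserve its valuation ring, so the logarithmic form has order
    0. A monomial valuation has a vertex of the simplex in its centre, and there a multiple of [K_X]
    has a monomial equation.

    Two obstacles shape the numerical part. Bounding [b_(n-1)] below by the mean of [b_(n-1)] and
    [b_n] only leads to [h <= 2 y_n ^ 2]. The missing [- y_n] comes from integrality: if the last
    two weights differ, the mean may be raised by [1 / (2 h)]; if they agree, a pigeonhole argument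
    with a parity gives a stronger inequality. Moreover, the comparison with the Sylvester sequence
    needs the remaining mass to be at most the last coordinate used. It is applied up to the last
    index with this property; the coordinates from there to [b_(n-2)] are less than half of the mass
    that remains with them, which bounds the product of the tail directly. That bound is too weak
    for [n <= 3], hence the separate treatment of dimensions 2 and 3. *)

Local Notation "p %:F" := (@tofrac _ p).

(** * Weight orders *)

Section OrderFunctions.
Variable S : idomainType.
Implicit Types (p q : S) (o : S -> int).

Definition order_fun o : Prop :=
  (forall p q, p != 0 -> q != 0 -> o (p * q) = o p + o q) /\
  (forall p q, p != 0 -> q != 0 -> p + q != 0 ->
     Num.min (o p) (o q) <= o (p + q)).

(** The value 0 at 0 follows the convention of [is_dval]; by [frac_orderE] any other representative
    gives the same value. *)
Definition frac_order o (f : {fraction S}) : int :=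
  if f == 0 then 0 else o (frac (repr f)).1 - o (frac (repr f)).2.

Lemma frac_den_neq0 (f : {fraction S}) : (frac (repr f)).2 != 0.
Proof. exact: denom_ratioP. Qed.

Lemma frac_numden (f : {fraction S}) :
  f = (frac (repr f)).1%:F / (frac (repr f)).2%:F.
Proof.
have d0 := frac_den_neq0 f.
rewrite -[LHS](mulfK (x := (frac (repr f)).2%:F)) ?tofrac_eq0 //.
congr (_ / _); rewrite -{1}[f]reprK; set x := repr f.
unlock FracField.tofrac; rewrite -[LHS]FracField.pi_mul.
apply/eqmodP => /=; rewrite FracField.equivfE /FracField.mulf.
by rewrite !numden_Ratio ?mulr1 ?mulf_neq0 ?oner_neq0 // mulrC.
Qed.

Lemma frac_orderE o p q : order_fun o -> p != 0 -> q != 0 ->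
  frac_order o (p%:F / q%:F) = o p - o q.
Proof.
move=> [oM _] p0 q0; rewrite /frac_order.
have f0 : p%:F / q%:F != 0 by rewrite mulf_neq0 ?invr_eq0 ?tofrac_eq0.
rewrite (negbTE f0).
set f := p%:F / q%:F in f0 *.
have d0 := frac_den_neq0 f; have fE := frac_numden f.
have n0 : (frac (repr f)).1 != 0.
  by apply: contraNneq f0 => n0; rewrite fE n0 rmorph0 mul0r.
have : p%:F * (frac (repr f)).2%:F = (frac (repr f)).1%:F * q%:F.
  apply/eqP; rewrite -eqr_div ?tofrac_eq0 //; apply/eqP; exact: fE.
rewrite -!tofracM => /eqP; rewrite tofrac_eq => /eqP /(congr1 o).
rewrite !oM //; lia.
Qed.

Lemma frac_order0 o : frac_order o 0 = 0.
Proof. by rewrite /frac_order eqxx. Qed.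

Lemma fracP (f : {fraction S}) : f != 0 ->
  exists p q, [/\ p != 0, q != 0 & f = p%:F / q%:F].
Proof.
move=> f0; exists (frac (repr f)).1, (frac (repr f)).2.
split; [|exact: frac_den_neq0|exact: frac_numden].
by apply: contraNneq f0 => n0; rewrite (frac_numden f) n0 rmorph0 mul0r.
Qed.

Lemma frac_orderM o f g : order_fun o -> f != 0 -> g != 0 ->
  frac_order o (f * g) = frac_order o f + frac_order o g.
Proof.
move=> oo /fracP[p [q [p0 q0 ->]]] /fracP[r [s [r0 s0 ->]]].
rewrite mulf_div -!tofracM !frac_orderE ?mulf_neq0 // !oo.1 //; lia.
Qed.

Lemma frac_orderD o f g : order_fun o -> f != 0 -> g != 0 -> f + g != 0 ->
  Num.min (frac_order o f) (frac_order o g) <= frac_order o (f + g).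
Proof.
move=> oo /fracP[p [q [p0 q0 ->]]] /fracP[r [s [r0 s0 ->]]].
rewrite addf_div ?tofrac_eq0 // -!tofracM -tofracD => fg0.
have n0 : p * s + r * q != 0.
  by apply: contraNneq fg0 => ->; rewrite rmorph0 mul0r.
rewrite !frac_orderE ?mulf_neq0 //.
have := oo.2 _ _ (mulf_neq0 p0 s0) (mulf_neq0 r0 q0) n0.
rewrite !oo.1 //; lia.
Qed.

End OrderFunctions.

Section WeightOrders.
Variables (k : fieldType) (N : nat).
Implicit Types (p q : {mpoly k[N]}) (m : 'X_{1..N}) (w : 'I_N -> int).

Definition wdeg w m : int := \sum_i w i * (m i)%:Z.

Lemma wdegD w m1 m2 : wdeg w (m1 + m2)%MM = wdeg w m1 + wdeg w m2.
Proof.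
rewrite /wdeg -big_split /=; apply: eq_bigr => i _.
by rewrite mnmDE PoszD mulrDr.
Qed.

Lemma wdeg0 w : wdeg w 0%MM = 0.
Proof. by rewrite /wdeg big1 // => i _; rewrite mnm0E mulr0. Qed.

Lemma wdegU w i : wdeg w U_(i)%MM = w i.
Proof.
rewrite /wdeg (bigD1 i) //= big1 ?addr0 ?mnm1E ?eqxx ?mulr1 // => j ji.
by rewrite mnm1E eq_sym (negbTE ji) mulr0.
Qed.

Definition wge w (c : int) p : bool := all (fun m => c <= wdeg w m) (msupp p).

Lemma wgeP w c p :
  reflect (forall m, m \in msupp p -> c <= wdeg w m) (wge w c p).
Proof. exact: allP. Qed.

Definition wpart w (c : int) p : {mpoly k[N]} :=
  \sum_(m <- msupp p | wdeg w m == c) p@_m *: 'X_[m].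

Lemma mcoeff_wpart w c p m :
  (wpart w c p)@_m = if wdeg w m == c then p@_m else 0.
Proof.
rewrite /wpart raddf_sum /=.
under eq_bigr => m' _ do rewrite mcoeffZ mcoeffX.
have [mp|mp] := boolP (m \in msupp p); last first.
  rewrite big_seq_cond big1 => [|m' /andP[m'p _]].
    by rewrite (memN_msupp_eq0 mp) if_same.
  by case: eqP => [e|_]; [rewrite -e m'p in mp | rewrite mulr0].
rewrite big_mkcond /= (bigD1_seq m) ?msupp_uniq //= eqxx mulr1 big1 ?addr0 //.
by move=> m' /negbTE ->; rewrite mulr0 if_same.
Qed.

Lemma msupp_wpart w c p m :
  (m \in msupp (wpart w c p)) = (wdeg w m == c) && (m \in msupp p).
Proof.
rewrite !mcoeff_msupp mcoeff_wpart.
by case: ifP => //= _; rewrite eqxx.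
Qed.

Lemma wge_wpart w c p : wge w c (wpart w c p).
Proof. by apply/wgeP => m; rewrite msupp_wpart => /andP[/eqP-> _]. Qed.

Lemma wgeD w c p q : wge w c p -> wge w c q -> wge w c (p + q).
Proof.
move=> /wgeP hp /wgeP hq; apply/wgeP => m /msuppD_le.
by rewrite mem_cat => /orP[/hp|/hq].
Qed.

Lemma wgeN w c p : wge w c p -> wge w c (- p).
Proof. by rewrite /wge (perm_all _ (msuppN p)). Qed.

Lemma wgeM w c d p q : wge w c p -> wge w d q -> wge w (c + d) (p * q).
Proof.
move=> /wgeP hp /wgeP hq; apply/wgeP => m /msuppM_le /allpairsP[[m1 m2] /=].
by case=> /hp h1 /hq h2 ->; rewrite wdegD lerD.
Qed.

Lemma wge_le w c d p : d <= c -> wge w c p -> wge w d p.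
Proof.
by move=> dc /wgeP h; apply/wgeP => m /h; apply: le_trans.
Qed.

Lemma wge_sub_wpart w c p : wge w c p -> wge w (c + 1) (p - wpart w c p).
Proof.
move=> /wgeP h; apply/wgeP => m; rewrite mcoeff_msupp mcoeffB mcoeff_wpart.
case: (wdeg w m =P c) => [_|mc]; first by rewrite subrr eqxx.
by rewrite subr0 -mcoeff_msupp => /h; lia.
Qed.

(** For [p != 0] the default [wdeg w (mlead p)] is the weight of a monomial of [p], so it does not
    disturb the minimum. *)
Definition word w p : int :=
  \big[Num.min/wdeg w (mlead p)]_(m <- msupp p) wdeg w m.

Lemma word_le w p m : m \in msupp p -> word w p <= wdeg w m.
Proof.
rewrite /word; move: (wdeg w (mlead p)) => x.
elim: (msupp p) => [//|m' s IH]; rewrite inE big_cons => /orP[/eqP->|/IH h].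
  by rewrite ge_min lexx.
by rewrite ge_min h orbT.
Qed.

Lemma wge_word w p : wge w (word w p) p.
Proof. by apply/wgeP => m; exact: word_le. Qed.

Lemma word_attained w p : p != 0 ->
  exists2 m, m \in msupp p & word w p = wdeg w m.
Proof.
move=> p0; rewrite /word.
have: {subset msupp p <= msupp p} by [].
elim: {1 4}(msupp p) => [_|m' s IH ss]; first by
  rewrite big_nil; exists (mlead p) => //; exact: mlead_supp.
rewrite big_cons; have [|m mp e] := IH; first by
  move=> m ms; apply: ss; rewrite inE ms orbT.
rewrite e; have [le|lt] := leP (wdeg w m') (wdeg w m).
  by exists m' => //; apply: ss; rewrite mem_head.
by exists m.
Qed.

Lemma wge_ler w c p : p != 0 -> wge w c p = (c <= word w p).
Proof.
move=> p0; apply/idP/idP => [/wgeP h|h]; last exact: wge_le h (wge_word w p).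
by have [m /h mp ->] := word_attained w p0.
Qed.

Lemma wordE w c p : p != 0 -> wge w c p -> wpart w c p != 0 -> word w p = c.
Proof.
move=> p0 h pc; apply/eqP; rewrite eq_le -wge_ler // h andbT.
have [m] := word_attained w pc.
rewrite msupp_wpart => /andP[/eqP mc mp] _; rewrite -mc; exact: word_le.
Qed.

Lemma wpart_word_neq0 w p : p != 0 -> wpart w (word w p) p != 0.
Proof.
move=> p0; have [m mp e] := word_attained w p0.
suff: m \in msupp (wpart w (word w p) p).
  by apply: contraTneq => ->; rewrite msupp0.
by rewrite msupp_wpart e eqxx.
Qed.

Lemma wpart_homog w c p : (forall m, m \in msupp p -> wdeg w m = c) ->
  wpart w c p = p.
Proof.
move=> h; apply/mpolyP => m; rewrite mcoeff_wpart.
have [mp|mp] := boolP (m \in msupp p); first by rewrite h ?eqxx.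
by rewrite (memN_msupp_eq0 mp) if_same.
Qed.

Lemma wpartD w c p q : wpart w c (p + q) = wpart w c p + wpart w c q.
Proof.
apply/mpolyP => m; rewrite mcoeffD !mcoeff_wpart mcoeffD.
by case: (wdeg w m =P c) => //; rewrite addr0.
Qed.

Lemma wpart_eq0 w c d p : wge w d p -> c < d -> wpart w c p = 0.
Proof.
move=> /wgeP h cd; apply/mpolyP => m; rewrite mcoeff_wpart mcoeff0.
case: (wdeg w m =P c) => // mc; apply: memN_msupp_eq0; apply/negP => /h; lia.
Qed.

Lemma word_order w : order_fun (word w).
Proof.
split=> p q p0 q0; last first.
  move=> pq0; rewrite -wge_ler //.
  by apply: wgeD; [apply: wge_le (wge_word w p) | apply: wge_le (wge_word w q)];
     rewrite ge_min lexx ?orbT.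
set c := word w p; set d := word w q.
apply: wordE; rewrite ?mulf_neq0 ?wgeM ?wge_word //.
set p1 := wpart w c p; set q1 := wpart w d q.
have p10 : p1 != 0 by apply: wpart_word_neq0.
have q10 : q1 != 0 by apply: wpart_word_neq0.
(* The product of the leading forms is homogeneous of weight [c + d], and nonzero in a domain; the
   other terms have weight at least [c + d + 1]. *)
have -> : p * q = p1 * q1 + (p1 * (q - q1) + (p - p1) * q) by ring.
rewrite wpartD [X in _ + X](@wpart_eq0 _ _ (c + d + 1)) ?addr0; last 1 first.
- lia.
- rewrite wpart_homog ?mulf_neq0 // => m /msuppM_le /allpairsP[[m1 m2] /=].
  rewrite !msupp_wpart => -[/andP[/eqP<- _] /andP[/eqP<- _] ->].
  by rewrite wdegD.
- apply: wgeD; first by rewrite -addrA; apply: wgeM; rewrite ?wge_wpart //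
    wge_sub_wpart ?wge_word.
  by rewrite addrAC; apply: wgeM; rewrite ?wge_word // wge_sub_wpart ?wge_word.
Qed.

Lemma wordX w m : word w 'X_[m] = wdeg w m.
Proof.
have x0 : 'X_[k, m] != 0 by rewrite -msupp_eq0 msuppX.
by have [m'] := word_attained w x0; rewrite msuppX inE => /eqP -> ->.
Qed.

Lemma wordC w c : c != 0 -> word w c%:MP = 0.
Proof.
move=> c0; have x0 : c%:MP_[N] != 0 by rewrite mpolyC_eq0.
have [m] := word_attained w x0.
by rewrite msuppC (negbTE c0) inE => /eqP -> ->; rewrite wdeg0.
Qed.

Definition whomog w (c : int) p : bool :=
  all (fun m => wdeg w m == c) (msupp p).

Lemma whomogP w c p :
  reflect (forall m, m \in msupp p -> wdeg w m = c) (whomog w c p).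
Proof. by apply: (iffP allP) => h m /h /eqP. Qed.

Lemma whomog_wpart w c p : whomog w c (wpart w c p).
Proof. by apply/whomogP => m; rewrite msupp_wpart => /andP[/eqP]. Qed.

Lemma whomogM w c d p q : whomog w c p -> whomog w d q ->
  whomog w (c + d) (p * q).
Proof.
move=> /whomogP hp /whomogP hq; apply/whomogP => m.
by move=> /msuppM_le /allpairsP[[m1 m2] /= [/hp <- /hq <- ->]]; rewrite wdegD.
Qed.

Lemma whomogXn w c p e : whomog w c p -> whomog w (c * e%:Z) (p ^+ e).
Proof.
move=> hp; elim: e => [|e IH].
  apply/whomogP => m; rewrite expr0 mulr0 -mpolyC1 msuppC oner_eq0 inE.
  by move=> /eqP ->; rewrite wdeg0.
have -> : c * e.+1%:Z = c + c * e%:Z by lia.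
by rewrite exprS; apply: whomogM.
Qed.

Lemma whomogX w m : whomog w (wdeg w m) 'X_[m].
Proof. by apply/whomogP => m'; rewrite msuppX inE => /eqP ->. Qed.

Lemma whomogD w c p q : whomog w c p -> whomog w c q -> whomog w c (p + q).
Proof.
move=> /whomogP hp /whomogP hq; apply/whomogP => m /msuppD_le.
by rewrite mem_cat => /orP[/hp|/hq].
Qed.

Lemma whomogN w c p : whomog w c p -> whomog w c (- p).
Proof. by rewrite /whomog (perm_all _ (msuppN p)). Qed.

Lemma wdeg_oppw w m : wdeg (fun i => - w i) m = - wdeg w m.
Proof. by rewrite /wdeg -sumrN; apply: eq_bigr => i _; rewrite mulNr. Qed.

(* [- word (- w)] is the largest weight of a monomial of the polynomial. *)
Lemma whomog_word w p : p != 0 ->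
  (exists c, whomog w c p) <-> word w p + word (fun i => - w i) p = 0.
Proof.
move=> p0; split=> [[c /whomogP h]|e].
  have [m1 /h h1 ->] := word_attained w p0.
  have [m2 /h h2 ->] := word_attained (fun i => - w i) p0.
  by rewrite wdeg_oppw h1 h2 subrr.
exists (word w p); apply/whomogP => m mp.
have := word_le w mp; have := word_le (fun i => - w i) mp.
rewrite wdeg_oppw; lia.
Qed.

Lemma whomog_word_le0 w p : p != 0 ->
  word w p + word (fun i => - w i) p <= 0.
Proof.
move=> p0; have [m mp ->] := word_attained w p0.
have := word_le (fun i => - w i) mp; rewrite wdeg_oppw; lia.
Qed.

(** The sum of the orders for [w] and [- w] is additive on products, never positive, and 0 exactly
    on homogeneous polynomials. *)
Lemma whomog_factor w p q : p != 0 -> q != 0 ->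
  (exists c, whomog w c (p * q)) -> exists c, whomog w c p.
Proof.
move=> p0 q0 /(whomog_word _ (mulf_neq0 p0 q0)) e; apply/whomog_word => //.
have := whomog_word_le0 w p0; have := whomog_word_le0 w q0.
have := (word_order w).1 _ _ p0 q0.
have := (word_order (fun i => - w i)).1 _ _ p0 q0; lia.
Qed.

Lemma whomog_degM w c d p q : p != 0 -> q != 0 ->
  whomog w c (p * q) -> whomog w d p -> whomog w (c - d) q.
Proof.
move=> p0 q0 hpq hp.
have [e hq] : exists e, whomog w e q.
  by apply: (@whomog_factor _ q p) => //; exists c; rewrite mulrC.
have [m mpq] : exists m, m \in msupp (p * q).
  by have [m mpq _] := word_attained w (mulf_neq0 p0 q0); exists m.
have := whomogM hp hq; move/whomogP/(_ _ mpq).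
move/whomogP: hpq => /(_ _ mpq) -> ->.
by rewrite addrC addKr.
Qed.

End WeightOrders.

(** A root [t] of [1 + 'X * P] would satisfy [t * P.[t] = -1], although [t = 0] or [P.[t] = 0]; but
    only a constant polynomial can be without roots. *)
Lemma closed_poly_eq0 (k : closedFieldType) (P : {poly k}) :
  (forall t, t != 0 -> P.[t] = 0) -> P = 0.
Proof.
move=> h; apply/eqP; apply/negPn/negP => P0.
have [t /rootP] : exists t, root (1 + 'X * P) t.
  apply/closed_rootP; rewrite addrC mulrC size_polyDl size_mulX //.
    by rewrite eqSS size_poly_eq0.
  by rewrite size_poly1 ltnS size_poly_gt0.
rewrite hornerD hornerM hornerX -[1]/(1%:P) hornerC.
have [->|t0] := eqVneq t 0.
  by rewrite mul0r addr0 => /eqP; rewrite oner_eq0.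
by rewrite h // mulr0 addr0 => /eqP; rewrite oner_eq0.
Qed.

Definition dot (N : nat) (w u : 'I_N -> int) : int := \sum_i w i * u i.

Section Dot.
Variable N : nat.
Implicit Types w u : 'I_N -> int.

Lemma dotDr w u1 u2 : dot w (fun i => u1 i + u2 i) = dot w u1 + dot w u2.
Proof. by rewrite /dot -big_split; apply: eq_bigr => i _; rewrite mulrDr. Qed.

Lemma dotC w u : dot w u = dot u w.
Proof. by apply: eq_bigr => i _; rewrite mulrC. Qed.

Lemma dotZr w c u : dot w (fun i => c * u i) = c * dot w u.
Proof. by rewrite /dot mulr_sumr; apply: eq_bigr => i _; rewrite mulrCA. Qed.

Lemma dotBr w u1 u2 : dot w (fun i => u1 i - u2 i) = dot w u1 - dot w u2.
Proof.
by rewrite /dot -sumrB; apply: eq_bigr => i _; rewrite mulrBr.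
Qed.

Lemma dotBl w1 w2 u : dot (fun i => w1 i - w2 i) u = dot w1 u - dot w2 u.
Proof. by rewrite dotC dotBr !(dotC u). Qed.

Lemma dotZl c w u : dot (fun i => c * w i) u = c * dot w u.
Proof. by rewrite dotC dotZr dotC. Qed.

Lemma dot_delta w i : dot w (fun l => (l == i)%:R) = w i.
Proof.
rewrite /dot (bigD1 i) //= eqxx mulr1 big1 ?addr0 // => l /negbTE ->.
by rewrite mulr0.
Qed.

End Dot.

(** * Laurent monomials and invariant fractions *)

Section LaurentMonomials.
Variables (k : fieldType) (N : nat).
Implicit Types (u w : 'I_N -> int).
Local Notation S := {mpoly k[N]}.
Local Notation L := {fraction S}.

Definition xvar (i : 'I_N) : L := ('X_i : S)%:F.

Lemma mpolyXi_neq0 (i : 'I_N) : 'X_i != 0 :> S.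
Proof. by rewrite -msupp_eq0 msuppX. Qed.

Lemma mpolyX_neq0 (m : 'X_{1..N}) : 'X_[m] != 0 :> S.
Proof. by rewrite -msupp_eq0 msuppX. Qed.

Lemma xvar_neq0 i : xvar i != 0.
Proof. by rewrite tofrac_eq0 mpolyXi_neq0. Qed.

Definition lmono u : L := \prod_i xvar i ^ u i.

Lemma lmono_neq0 u : lmono u != 0.
Proof. by apply/prodf_neq0 => i _; rewrite expfz_neq0 ?xvar_neq0. Qed.

Lemma lmonoD u1 u2 : lmono (fun i => u1 i + u2 i) = lmono u1 * lmono u2.
Proof.
rewrite /lmono -big_split /=; apply: eq_bigr => i _.
by rewrite expfzDr ?xvar_neq0.
Qed.

Lemma lmonoZ c u : lmono (fun i => c * u i) = lmono u ^ c.
Proof.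
rewrite /lmono (big_morph (fun x => x ^ c) (id1 := 1) (op1 := *%R)).
- by apply: eq_bigr => i _; rewrite exprz_exp mulrC.
- by move=> x y; rewrite expfzMl.
- by rewrite exp1rz.
Qed.

Lemma eq_lmono u1 u2 : u1 =1 u2 -> lmono u1 = lmono u2.
Proof. by move=> e; apply: eq_bigr => i _; rewrite e. Qed.

Lemma lmono0 u : (forall i, u i = 0) -> lmono u = 1.
Proof. by move=> u0; rewrite /lmono big1 // => i _; rewrite u0 expr0z. Qed.

Lemma lmonoN u : lmono (fun i => - u i) = (lmono u)^-1.
Proof.
rewrite (@eq_lmono _ (fun i => -1 * u i)) => [|i]; last by rewrite mulN1r.
by rewrite lmonoZ.
Qed.

Lemma lmono_mnm (m : 'X_{1..N}) : lmono (fun i => (m i)%:Z) = ('X_[m] : S)%:F.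
Proof.
rewrite mpolyXE_id rmorph_prod; apply: eq_bigr => i _.
by rewrite rmorphXn.
Qed.

Definition posm u : 'X_{1..N} := [multinom `|Num.max (u i) 0|%N | i < N].

Lemma lmono_frac u :
  lmono u = ('X_[posm u] : S)%:F / ('X_[posm (fun i => - u i)] : S)%:F.
Proof.
rewrite -!lmono_mnm -lmonoN -lmonoD; apply: eq_lmono => i.
rewrite !mnmE; lia.
Qed.

Lemma wdeg_dot w (m : 'X_{1..N}) : wdeg w m = dot w (fun i => (m i)%:Z).
Proof. by []. Qed.

Lemma wdeg_posm w u :
  wdeg w (posm u) - wdeg w (posm (fun i => - u i)) = dot w u.
Proof.
rewrite !wdeg_dot -dotBr; apply: eq_bigr => i _; congr (_ * _).
rewrite !mnmE; lia.
Qed.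

Lemma frac_word_lmono w u : frac_order (word w) (lmono u) = dot w u.
Proof.
rewrite lmono_frac frac_orderE ?mpolyX_neq0 //; last exact: word_order.
by rewrite !wordX wdeg_posm.
Qed.

End LaurentMonomials.

Section Invariants.
Variables (k : closedFieldType) (n : nat) (a : 'I_n.+1 -> nat).
Hypothesis a_gt0 : forall i, (0 < a i)%N.
Local Notation S := {mpoly k[n.+1]}.
Local Notation L := {fraction S}.
Local Notation K := (@wps_field k n a).

Definition aw (i : 'I_n.+1) : int := (a i)%:Z.

Definition adeg (m : 'X_{1..n.+1}) : nat := \sum_i a i * m i.

Lemma adegE m : (adeg m)%:Z = wdeg aw m.
Proof.
rewrite /adeg /wdeg -natz natr_sum; apply: eq_bigr => i _.
by rewrite natz PoszM.
Qed.

Lemma gm_actX t m : gm_act a t ('X_[m] : S) = t ^+ adeg m *: 'X_[m].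
Proof.
rewrite /gm_act comp_mpolyX.
under eq_bigr => i _ do rewrite tnth_mktuple exprZn -exprM.
by rewrite scaler_prod -mpolyXE_id expr_sum.
Qed.

Lemma mcoeff_gm_act t (p : S) m : (gm_act a t p)@_m = t ^+ adeg m * p@_m.
Proof.
rewrite /gm_act comp_mpolyEX raddf_sum /=.
under eq_bigr => m' _ do rewrite -/(gm_act a t _) gm_actX
  scalerA mcoeffZ mcoeffX.
have [mp|mp] := boolP (m \in msupp p); last first.
  rewrite (memN_msupp_eq0 mp) mulr0 big_seq_cond big1 // => m' /andP[m'p _].
  by case: (m' =P m) => [e|_]; [rewrite -e m'p in mp | rewrite mulr0].
rewrite (bigD1_seq m mp (msupp_uniq p)) /= eqxx mulr1.
rewrite [X in _ + X]big1 => [|m' /negbTE ->]; last by rewrite mulr0.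
by rewrite addr0 mulrC.
Qed.

Lemma gm_act_homog t (d : nat) (p : S) : whomog aw d%:Z p ->
  gm_act a t p = t ^+ d *: p.
Proof.
move=> /whomogP h; apply/mpolyP => m; rewrite mcoeff_gm_act mcoeffZ.
have [mp|mp] := boolP (m \in msupp p); last first.
  by rewrite (memN_msupp_eq0 mp) !mulr0.
by have := h _ mp; rewrite -adegE => -[->].
Qed.

Lemma gm_inv_frac d (p q : S) : whomog aw d p -> whomog aw d q -> q != 0 ->
  p%:F / q%:F \in @gm_inv k n a.
Proof.
move=> hp hq q0; apply/asboolP; exists p, q; split=> // t _.
have [m mq e] := word_attained aw q0.
have dE : d = (adeg m)%:Z by rewrite adegE; move/whomogP: hq => /(_ _ mq).
rewrite dE in hp hq.
by rewrite !(@gm_act_homog _ (adeg m)) // -scalerAl -scalerAr.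
Qed.

(** Any large cutoff [C] is allowed, so that two polynomials can be expanded over the same range. *)
Lemma gm_actD_wpart (p : S) : exists B : nat, forall C t, (B <= C)%N ->
  gm_act a t p = \sum_(d < C) t ^+ d *: wpart aw d%:Z p.
Proof.
exists (\max_(m <- msupp p) (adeg m).+1)%N => C t BC; apply/mpolyP => m.
rewrite mcoeff_gm_act raddf_sum /=.
under eq_bigr => d _ do rewrite mcoeffZ mcoeff_wpart -adegE eqz_nat.
have [mp|mp] := boolP (m \in msupp p); last first.
  rewrite (memN_msupp_eq0 mp) mulr0 big1 // => d _.
  by rewrite if_same mulr0.
have mC : (adeg m < C)%N.
  by apply: leq_trans BC; apply: (leq_bigmax_seq (F := fun m => (adeg m).+1)).
rewrite (bigD1 (Ordinal mC)) //= eqxx big1 ?addr0 // => d dm.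
case: eqP; rewrite ?mulr0 // => e; case/negP: dm.
by apply/eqP/val_inj.
Qed.

(** Membership in [gm_inv] concerns one representative; cross-multiplication by its denominator and
    by the transform of the latter, nonzero for [t != 0], carries invariance to all others. *)
Lemma gm_inv_repr (f : K) (p q : S) : q != 0 -> val f = p%:F / q%:F ->
  forall t, t != 0 -> gm_act a t p * q = p * gm_act a t q.
Proof.
case: f => f fP /= q0 fE t t0; move: (fP) => /asboolP[r [s [s0 fE' rs]]].
have e : p * s = r * q.
  apply/eqP; rewrite -tofrac_eq !tofracM -eqr_div ?tofrac_eq0 //.
  by rewrite -fE -fE'.
have g0 : gm_act a t s != 0.
  apply: contra_neq s0 => gs; apply/mpolyP => m; rewrite mcoeff0.
  have := congr1 (mcoeff m) gs; rewrite mcoeff_gm_act mcoeff0 => /eqP.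
  by rewrite mulf_eq0 expf_eq0 (negbTE t0) andbF => /eqP.
apply: (mulIf s0); apply: (mulIf g0).
have e' : gm_act a t p * gm_act a t s = gm_act a t r * gm_act a t q.
  by rewrite -!gm_actM e.
move: (rs t t0) e e'.
move: (gm_act a t p) (gm_act a t q) (gm_act a t r) (gm_act a t s).
move=> P Q R U RU e e'; transitivity (P * U * q * s); first by ring.
rewrite e'; transitivity (R * s * Q * q); first by ring.
rewrite RU; transitivity (r * q * U * Q); first by ring.
by rewrite -e; ring.
Qed.

(** At each monomial, invariance says that a polynomial in [t] vanishes on all nonzero [t]; the
    claim is the vanishing of its coefficient of degree [d]. *)
Lemma wpart_repr (f : K) (p q : S) (d : nat) : q != 0 ->
  val f = p%:F / q%:F -> wpart aw d%:Z p * q = p * wpart aw d%:Z q.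
Proof.
move=> q0 fE; have inv := gm_inv_repr q0 fE.
have [B1 h1] := gm_actD_wpart p; have [B2 h2] := gm_actD_wpart q.
pose C := (maxn (maxn B1 B2) d.+1)%N.
have [c1 c2 c3] : [/\ (B1 <= C)%N, (B2 <= C)%N & (d < C)%N].
  by rewrite /C !leq_max !leqnn !orbT.
apply/mpolyP => m.
pose g (e : nat) := (wpart aw e%:Z p * q - p * wpart aw e%:Z q)@_m.
pose P : {poly k} := \poly_(e < C) g e.
suff P0 : P = 0.
  have : P`_d = 0 by rewrite P0 coef0.
  by rewrite coef_poly c3 /g mcoeffB => /eqP; rewrite subr_eq0 => /eqP.
apply: closed_poly_eq0 => t t0; rewrite horner_poly.
have := inv t t0; rewrite (h1 C) // (h2 C) // => /(congr1 (mcoeff m))/eqP.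
rewrite -subr_eq0 -mcoeffB mulr_suml mulr_sumr -sumrB raddf_sum /= => /eqP e.
rewrite -[RHS]e; apply: eq_bigr => i _.
by rewrite -scalerAl -scalerAr -scalerBr mcoeffZ mulrC.
Qed.

Lemma wps_repr (f : K) (p q : S) d : q != 0 -> val f = p%:F / q%:F ->
  wpart aw d q != 0 -> val f = (wpart aw d p)%:F / (wpart aw d q)%:F.
Proof.
move=> q0 fE qd0.
have [m mq _] := word_attained aw qd0.
have dE : d = (adeg m)%:Z.
  by rewrite adegE; move: mq; rewrite msupp_wpart => /andP[/eqP].
rewrite {}dE in qd0 *; rewrite fE; apply/eqP.
by rewrite eqr_div ?tofrac_eq0 // -!tofracM tofrac_eq (wpart_repr _ q0 fE).
Qed.

End Invariants.

(** * Euler derivations *)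

Section FracDerivation.
Variables (S : idomainType) (d : S -> S).
Hypothesis dD : forall p q, d (p + q) = d p + d q.
Hypothesis dM : forall p q, d (p * q) = d p * q + p * d q.

Definition frac_der (f : {fraction S}) : {fraction S} :=
  let p := (frac (repr f)).1 in let q := (frac (repr f)).2 in
  (d p * q - p * d q)%:F / (q ^+ 2)%:F.

Lemma frac_derE p q : q != 0 ->
  frac_der (p%:F / q%:F) = (d p * q - p * d q)%:F / (q ^+ 2)%:F.
Proof.
move=> q0; rewrite /frac_der; set f := p%:F / q%:F.
have s0 := frac_den_neq0 f; have fE := frac_numden f.
set r := (frac (repr f)).1 in fE *; set s := (frac (repr f)).2 in s0 fE *.
have e : p * s = r * q.
  by apply/eqP; rewrite -tofrac_eq !tofracM -eqr_div ?tofrac_eq0 // -fE.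
have e' : d p * s + p * d s = d r * q + r * d q by rewrite -!dM e.
apply/eqP; rewrite eqr_div ?tofrac_eq0 ?expf_neq0 // -!tofracM tofrac_eq.
rewrite -subr_eq0; apply/eqP.
have e1 : p * s - r * q = 0 by rewrite e subrr.
have e2 : d p * s + p * d s - (d r * q + r * d q) = 0 by rewrite e' subrr.
transitivity ((p * s - r * q) * (d s * q + d q * s)
  - (d p * s + p * d s - (d r * q + r * d q)) * (q * s)); first by ring.
by rewrite e1 e2 !mul0r subrr.
Qed.

Lemma der0 : d 0 = 0.
Proof. by have := dD 0 0; rewrite addr0 -[LHS]addr0 => /addrI <-. Qed.

Lemma der1 : d 1 = 0.
Proof.
by have := dM 1 1; rewrite !mulr1 mul1r -[LHS]addr0 => /addrI <-.
Qed.

Lemma fracP0 (f : {fraction S}) : exists p q, q != 0 /\ f = p%:F / q%:F.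
Proof.
exists (frac (repr f)).1, (frac (repr f)).2.
by split; [exact: frac_den_neq0|exact: frac_numden].
Qed.

Lemma frac_derD f g : frac_der (f + g) = frac_der f + frac_der g.
Proof.
have [p [q [q0 ->]]] := fracP0 f; have [r [s [s0 ->]]] := fracP0 g.
rewrite addf_div ?tofrac_eq0 // -!tofracM -tofracD !frac_derE ?mulf_neq0 //.
rewrite addf_div ?tofrac_eq0 ?expf_neq0 // -!tofracM -tofracD exprMn.
by rewrite dD !dM; congr (_%:F / _); ring.
Qed.

Lemma frac_derM f g : frac_der (f * g) = frac_der f * g + f * frac_der g.
Proof.
have [p [q [q0 ->]]] := fracP0 f; have [r [s [s0 ->]]] := fracP0 g.
rewrite mulf_div -!tofracM !frac_derE ?mulf_neq0 // !mulf_div -!tofracM.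
rewrite addf_div ?tofrac_eq0 ?mulf_neq0 ?expf_neq0 // -!tofracM -tofracD.
apply/eqP; rewrite eqr_div ?tofrac_eq0 ?mulf_neq0 ?expf_neq0 //.
by rewrite -!tofracM !dM tofrac_eq; apply/eqP; ring.
Qed.

End FracDerivation.

Section EulerDerivations.
Variables (k : fieldType) (N : nat).
Local Notation S := {mpoly k[N]}.
Local Notation L := {fraction S}.
Implicit Types (p q : S).

Definition euler (i : 'I_N) p : S := 'X_i * p^`M(i).

Lemma eulerD i p q : euler i (p + q) = euler i p + euler i q.
Proof. by rewrite /euler mderivD mulrDr. Qed.

Lemma eulerM i p q : euler i (p * q) = euler i p * q + p * euler i q.
Proof. by rewrite /euler mderivM; ring. Qed.

Lemma eulerC i c : euler i c%:MP = 0.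
Proof. by rewrite /euler mderivC mulr0. Qed.

Lemma eulerZ i c p : euler i (c *: p) = c *: euler i p.
Proof. by rewrite /euler mderivZ scalerAr. Qed.

Lemma eulerX i m : euler i 'X_[m] = (m i)%:R *: 'X_[m].
Proof.
rewrite /euler mderivX -scalerAr -mpolyXD.
have [->|mi] := posnP (m i); first by rewrite !scale0r.
congr (_ *: 'X_[_]); apply/mnmP => j; rewrite mnmDE mnmBE mnm1E.
by case: (i =P j) => [<-|_] /=; lia.
Qed.

Lemma mcoeff_euler i p m : (euler i p)@_m = (m i)%:R * p@_m.
Proof.
have eul_sum (s : seq 'X_{1..N}) (c : 'X_{1..N} -> k) :
    euler i (\sum_(m <- s) c m *: 'X_[m]) = \sum_(m <- s) euler i (c m *: 'X_[m]).
  elim: s => [|m' s IH]; last by rewrite !big_cons eulerD IH.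
  by rewrite !big_nil -mpolyC0 eulerC.
rewrite {1}(mpolyE p) eul_sum raddf_sum /=.
under eq_bigr => m' _ do rewrite eulerZ eulerX scalerA mcoeffZ mcoeffX.
have [mp|mp] := boolP (m \in msupp p); last first.
  rewrite (memN_msupp_eq0 mp) mulr0 big_seq_cond big1 // => m' /andP[m'p _].
  by case: (m' =P m) => [e|_]; [rewrite -e m'p in mp | rewrite mulr0].
rewrite (bigD1_seq m mp (msupp_uniq p)) /= eqxx mulr1.
rewrite [X in _ + X]big1 => [|m' /negbTE ->]; last by rewrite mulr0.
by rewrite addr0 mulrC.
Qed.

Lemma msupp_euler i p : {subset msupp (euler i p) <= msupp p}.
Proof.
move=> m; rewrite !mcoeff_msupp mcoeff_euler.
by apply: contra_neq => ->; rewrite mulr0.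
Qed.

Lemma wge_euler w c i p : wge w c p -> wge w c (euler i p).
Proof. by move=> /wgeP h; apply/wgeP => m /msupp_euler /h. Qed.

Lemma whomog_euler w c i p : whomog w c p -> whomog w c (euler i p).
Proof. by move=> /whomogP h; apply/whomogP => m /msupp_euler /h. Qed.

Definition frac_euler i : L -> L := frac_der (euler i).

Lemma frac_eulerE i p q : q != 0 -> frac_euler i (p%:F / q%:F) =
  (euler i p * q - p * euler i q)%:F / (q ^+ 2)%:F.
Proof. by apply: frac_derE; exact: eulerM. Qed.

Lemma frac_eulerD i f g :
  frac_euler i (f + g) = frac_euler i f + frac_euler i g.
Proof. by apply: frac_derD; [exact: eulerD | exact: eulerM]. Qed.

Lemma frac_eulerM i f g :
  frac_euler i (f * g) = frac_euler i f * g + f * frac_euler i g.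
Proof. by apply: frac_derM; exact: eulerM. Qed.

Lemma frac_euler_lmono i (u : 'I_N -> int) :
  frac_euler i (lmono k u) = (u i)%:~R * lmono k u.
Proof.
rewrite lmono_frac frac_eulerE ?mpolyX_neq0 // !eulerX.
set m1 := posm u; set m2 := posm _.
have -> : (m1 i)%:R *: 'X_[m1] * 'X_[m2] - 'X_[m1] * ((m2 i)%:R *: 'X_[m2])
    = (u i)%:~R * 'X_[m1] * 'X_[m2] :> S.
  rewrite -scalerAl -scalerAr -scalerBl -!mul_mpolyC -[RHS]mulrA.
  congr (_ * _); rewrite rmorphB /= !mpolyC_nat.
  have -> : u i = (m1 i)%:Z - (m2 i)%:Z by rewrite !mnmE; lia.
  by rewrite intrB -!pmulrn.
rewrite expr2 !tofracM -mulf_div divff ?tofrac_eq0 ?mpolyX_neq0 // mulr1.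
by rewrite rmorph_int mulrA.
Qed.

End EulerDerivations.

Lemma wpart_sum (k : fieldType) (n : nat) (a : 'I_n.+1 -> nat)
    (q : {mpoly k[n.+1]}) (s : seq int) : uniq s ->
  (forall m, m \in msupp q -> wdeg (aw a) m \in s) ->
  q = \sum_(d <- s) wpart (aw a) d q.
Proof.
move=> us h; apply/mpolyP => m; rewrite raddf_sum /=.
under eq_bigr => d _ do rewrite mcoeff_wpart.
have [mq|mq] := boolP (m \in msupp q); last first.
  by rewrite (memN_msupp_eq0 mq) big1 // => d _; rewrite if_same.
rewrite (bigD1_seq (wdeg (aw a) m)) ?h //= eqxx big1 ?addr0 // => d.
by rewrite eq_sym => /negbTE ->.
Qed.

(* [emb] identifies [K] with the field of quotients of homogeneous polynomials
   of the same weighted degree. *)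
Definition degree0_field (k : fieldType) (n : nat) (a : 'I_n.+1 -> nat)
    (K : fieldType) (iota : k -> K) (emb : K -> {fraction {mpoly k[n.+1]}}) :=
  [/\ forall c, emb (iota c) = (c%:MP)%:F,
      forall d (p q : {mpoly k[n.+1]}), q != 0 ->
        whomog (aw a) d p -> whomog (aw a) d q ->
        exists f, emb f = p%:F / q%:F
    & forall f (p q : {mpoly k[n.+1]}) d, q != 0 -> emb f = p%:F / q%:F ->
        wpart (aw a) d q != 0 ->
        emb f = (wpart (aw a) d p)%:F / (wpart (aw a) d q)%:F].

Section GradedField.
Variables (k : fieldType) (n : nat) (a : 'I_n.+1 -> nat).
Variables (K : fieldType) (iota : {rmorphism k -> K}).
Variable emb : {rmorphism K -> {fraction {mpoly k[n.+1]}}}.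
Hypothesis char0 : [pchar k] =i pred0.
Hypothesis hK : degree0_field a iota emb.
Local Notation S := {mpoly k[n.+1]}.
Local Notation aw := (aw a).

Definition local_ring_at (x : 'I_n.+1 -> k) : set K :=
  [set f | exists p q : S, q.@[x] != 0 /\ emb f = p%:F / q%:F].

Lemma emb_inj : injective emb.
Proof. exact: fmorph_inj. Qed.

Lemma deg0_homog (f : K) : exists p q d,
  [/\ q != 0, whomog aw d p, whomog aw d q & emb f = p%:F / q%:F].
Proof.
have [_ _ hr] := hK; have [p [q [q0 fE]]] := fracP0 (emb f).
exists (wpart aw (word aw q) p), (wpart aw (word aw q) q), (word aw q).
by split; rewrite ?whomog_wpart ?wpart_word_neq0 //; apply: hr;
   rewrite ?wpart_word_neq0.
Qed.

(** Some homogeneous component of [q] does not vanish at [x], because their values add up to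
    [q.@[x]]; the fraction can be rewritten with that component. *)
Lemma local_ring_homog x (f : K) : local_ring_at x f -> exists p q d,
  [/\ q.@[x] != 0, whomog aw d p, whomog aw d q & emb f = p%:F / q%:F].
Proof.
move=> [p [q [qx fE]]].
have q0 : q != 0 by apply: contra_neq qx => ->; rewrite meval0.
have [d qd] : exists d, (wpart aw d q).@[x] != 0.
  apply: contrapT => /forallNP h; case/negP: qx; apply/eqP.
  rewrite (@wpart_sum _ _ a q (undup [seq wdeg aw m | m <- msupp q])).
  - rewrite raddf_sum big1 //= => d _.
    by apply/eqP; apply/negPn/negP; apply: h.
  - exact: undup_uniq.
  - by move=> m mq; rewrite mem_undup map_f.
exists (wpart aw d p), (wpart aw d q), d; split; rewrite ?whomog_wpart //.
have [_ _ hr] := hK; apply: (hr _ _ _ _ q0 fE).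
by apply: contra_neq qd => ->; rewrite meval0.
Qed.

(** The default 0 of [xget] can only occur for exponents of nonzero weighted degree. *)
Definition kmono (u : 'I_n.+1 -> int) : K := xget 0 [set f | emb f = lmono k u].

Lemma emb_kmono u : dot aw u = 0 -> emb (kmono u) = lmono k u.
Proof.
rewrite -wdeg_posm => /eqP; rewrite subr_eq0 => /eqP e.
have [_ hl _] := hK.
have [|||f fE] := hl (wdeg aw (posm u)) 'X_[posm u] 'X_[posm (fun i => - u i)].
- exact: mpolyX_neq0.
- exact: whomogX.
- by rewrite e whomogX.
apply: (@xgetPex _ 0 [set f | emb f = lmono k u]); exists f.
by rewrite /= fE -lmono_frac.
Qed.

Lemma kmono_neq0 u : dot aw u = 0 -> kmono u != 0.
Proof.
move=> u0; apply/eqP => /(congr1 emb); rewrite emb_kmono // rmorph0.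
by apply/eqP; exact: lmono_neq0.
Qed.

(** Euler operators preserve weights, hence the field of degree-0 fractions, so the default of
    [xget] is never taken. *)
Definition keuler i (f : K) : K := xget 0 [set g | emb g = frac_euler i (emb f)].

Lemma emb_keuler i (f : K) : emb (keuler i f) = frac_euler i (emb f).
Proof.
apply: (@xgetPex _ 0 [set g | emb g = frac_euler i (emb f)]) => /=.
have [p [q [d [q0 hp hq ->]]]] := deg0_homog f.
rewrite frac_eulerE //; have [_ hl _] := hK; apply: (hl (d + d)).
- by rewrite expf_neq0.
- by apply: whomogD; [|apply: whomogN]; apply: whomogM => //;
    exact: whomog_euler.
- by rewrite expr2; apply: whomogM.
Qed.

Lemma emb_iota c : emb (iota c) = (c%:MP)%:F.
Proof. by have [-> _ _] := hK. Qed.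

Lemma keuler_derivation i : derivation iota (keuler i).
Proof.
split=> [x y|x y|c]; apply: emb_inj.
- by rewrite emb_keuler 2!(rmorphD emb) frac_eulerD !emb_keuler.
- rewrite emb_keuler (rmorphM emb) frac_eulerM (rmorphD emb) 2!(rmorphM emb).
  by rewrite !emb_keuler.
- rewrite emb_keuler emb_iota -[_%:F]divr1 -tofrac1 frac_eulerE ?oner_neq0 //.
  by rewrite -mpolyC1 !eulerC mul0r mulr0 subrr !rmorph0 mul0r.
Qed.

Lemma keuler_kmono i u : dot aw u = 0 ->
  keuler i (kmono u) = (u i)%:~R * kmono u.
Proof.
move=> u0; apply: emb_inj; rewrite emb_keuler [RHS]rmorphM /= emb_kmono //.
by rewrite frac_euler_lmono rmorph_int.
Qed.

(** On degree-0 fractions the Euler operators satisfy the linear relation with coefficients [a i];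
    hence the operator of index 0 is left out. *)
Definition log_frame (j : 'I_n) : K -> K := keuler (lift ord0 j).

(** The exponent of [x_(j+1) ^ a_0 / x_0 ^ a_(j+1)]. These [n] monomials, written [y_j] below,
    generate a subgroup of finite index in the group of degree-0 monomials. *)
Definition yexp (j : 'I_n) (i : 'I_n.+1) : int :=
  (a ord0)%:Z * (i == lift ord0 j)%:R - (a (lift ord0 j))%:Z * (i == ord0)%:R.

Lemma dot_yexp w j : dot w (yexp j) =
  (a ord0)%:Z * w (lift ord0 j) - (a (lift ord0 j))%:Z * w ord0.
Proof. by rewrite dotBr !dotZr !dot_delta. Qed.

Lemma dot_aw_yexp j : dot aw (yexp j) = 0.
Proof. by rewrite dot_yexp /aw; ring. Qed.

Lemma yexp_lift j i : yexp j (lift ord0 i) = (a ord0)%:Z * (i == j)%:R.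
Proof. by rewrite /yexp (inj_eq lift_inj) eq_sym (eq_sym _ ord0)
  (negbTE (neq_lift _ _)) mulr0 subr0 eq_sym. Qed.

Lemma char0_intr (z : int) : (z%:~R == 0 :> K) = (z == 0).
Proof.
have nat0 (m : nat) : (m%:R == 0 :> K) = (m == 0)%N.
  rewrite -(rmorph_nat iota) fmorph_eq0.
  by have /pcharf0P -> := char0.
case: z => m; first by rewrite -pmulrn nat0.
by rewrite NegzE mulrNz -pmulrn oppr_eq0 nat0.
Qed.

Lemma derivation0 d : derivation iota d -> d (0 : K) = 0.
Proof. by move=> [dD _ _]; apply: (der0 dD). Qed.

Lemma derivation_sum d (I : Type) (s : seq I) (F : I -> K) : derivation iota d ->
  d (\sum_(i <- s) F i) = \sum_(i <- s) d (F i).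
Proof.
move=> dd; have [dD _ _] := dd.
by apply: (big_morph d dD); exact: derivation0.
Qed.

Lemma derivationX d (x : K) m : derivation iota d ->
  d (x ^+ m) = m%:R * x ^+ m.-1 * d x.
Proof.
move=> dd; have [dD dM _] := dd.
elim: m => [|m IH]; first by rewrite expr0 (der1 dM) !mul0r.
rewrite exprS dM IH /=; case: m IH => [|m] _ /=; first by rewrite expr0; ring.
by rewrite exprS -(addn1 m.+1) natrD; ring.
Qed.

Lemma derivationV d (x : K) : derivation iota d -> x != 0 ->
  d x = 0 -> d x^-1 = 0.
Proof.
move=> [dD dM _] x0 dx; have := dM x x^-1.
rewrite mulfV // (der1 dM) dx mul0r add0r => /esym/eqP.
by rewrite mulf_eq0 (negbTE x0) => /eqP.
Qed.

Lemma derivation_divr d (x y : K) : derivation iota d -> y != 0 ->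
  d x = 0 -> d y = 0 -> d (x / y) = 0.
Proof.
move=> dd y0 dx dy; have [dD dM _] := dd.
by rewrite dM dx (derivationV dd) // mul0r mulr0 addr0.
Qed.

End GradedField.

Section DerivationCombination.
Variables (k K : fieldType) (iota : {rmorphism k -> K}) (n : nat).

Lemma derivation_sub_comb d (c : 'I_n -> K) (D : 'I_n -> K -> K) :
  derivation iota d -> (forall j, derivation iota (D j)) ->
  derivation iota (fun x => d x - \sum_j c j * D j x).
Proof.
move=> [dD dM dC] hD; split=> [u v|u v|e].
- have E j : c j * D j (u + v) = c j * D j u + c j * D j v.
    by have [h _ _] := hD j; rewrite h mulrDr.
  by rewrite dD (eq_bigr _ (fun j _ => E j)) big_split opprD addrACA.
- have E j : c j * D j (u * v) = c j * D j u * v + u * (c j * D j v).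
    by have [_ h _] := hD j; rewrite h mulrDr mulrA (mulrCA _ u).
  rewrite dM (eq_bigr _ (fun j _ => E j)) big_split -mulr_suml -mulr_sumr.
  by rewrite mulrBl mulrBr opprD addrACA.
- have E j : c j * D j (iota e) = 0 by have [_ _ h] := hD j; rewrite h mulr0.
  by rewrite dC (eq_bigr _ (fun j _ => E j)) big1 // subr0.
Qed.

End DerivationCombination.

(** * Monomial valuations and their discrepancies *)

Section Valuations.
Variables (k K : fieldType) (iota : {rmorphism k -> K}).
Implicit Types (v : K -> int) (x y : K).

Definition vge v (c : int) x : Prop := x = 0 \/ c <= v x.

Section OneValuation.
Variable v : K -> int.
Hypothesis hv : is_dval iota v.

Lemma dvalM x y : x != 0 -> y != 0 -> v (x * y) = v x + v y.
Proof. by have [_ h _ _ _] := hv; apply: h. Qed.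

Lemma dvalC c : v (iota c) = 0.
Proof. by have [_ _ _ _ h] := hv; apply: h. Qed.

Lemma dval1 : v 1 = 0.
Proof. by rewrite -(rmorph1 iota) dvalC. Qed.

Lemma dvalV x : x != 0 -> v x^-1 = - v x.
Proof.
move=> x0; have := dvalM x0 (invr_neq0 x0).
rewrite mulfV // dval1; lia.
Qed.

Lemma dval_div x y : x != 0 -> y != 0 -> v (x / y) = v x - v y.
Proof. by move=> x0 y0; rewrite dvalM ?invr_neq0 // dvalV. Qed.

Lemma dvalX x m : x != 0 -> v (x ^+ m) = m%:Z * v x.
Proof.
move=> x0; elim: m => [|m IH]; first by rewrite expr0 dval1 mul0r.
by rewrite exprS dvalM ?expf_neq0 // IH; lia.
Qed.

Lemma dvalXz x (z : int) : x != 0 -> v (x ^ z) = z * v x.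
Proof.
move=> x0; case: z => m; first by rewrite -exprnP dvalX.
by rewrite NegzE -exprnN dvalV ?expf_neq0 // dvalX // mulNr.
Qed.

Lemma vge_neq0 c x : x != 0 -> vge v c x -> c <= v x.
Proof. by move=> /eqP x0 []. Qed.

Lemma vgeD c x y : vge v c x -> vge v c y -> vge v c (x + y).
Proof.
have [_ _ hD _ _] := hv.
move=> hx hy; have [->|x0] := eqVneq x 0; first by rewrite add0r.
have [->|y0] := eqVneq y 0; first by rewrite addr0.
have [->|xy0] := eqVneq (x + y) 0; first by left.
right; apply: le_trans (hD _ _ x0 y0 xy0).
by rewrite le_min (vge_neq0 x0 hx) (vge_neq0 y0 hy).
Qed.

Lemma vgeM c d x y : vge v c x -> vge v d y -> vge v (c + d) (x * y).
Proof.
move=> hx hy; have [->|x0] := eqVneq x 0; first by rewrite mul0r; left.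
have [->|y0] := eqVneq y 0; first by rewrite mulr0; left.
by right; rewrite dvalM // lerD ?vge_neq0.
Qed.

Lemma vgeC c : vge v 0 (iota c).
Proof. by right; rewrite dvalC. Qed.

Lemma vge_sum (I : Type) (s : seq I) (P : pred I) c (F : I -> K) :
  (forall i, P i -> vge v c (F i)) -> vge v c (\sum_(i <- s | P i) F i).
Proof.
move=> h; apply: (big_ind (vge v c)) => //; first by left.
by move=> x y; apply: vgeD.
Qed.

Lemma vge_prod (I : Type) (s : seq I) (P : pred I) (F : I -> K) :
  (forall i, P i -> vge v 0 (F i)) -> vge v 0 (\prod_(i <- s | P i) F i).
Proof.
move=> h; apply: (big_ind (vge v 0)) => //.
  by rewrite -(rmorph1 iota); apply: vgeC.
by move=> x y hx hy; rewrite -(addr0 0); apply: vgeM.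
Qed.

Lemma vge_sign x (m : nat) : vge v 0 x -> vge v 0 ((-1) ^+ m * x).
Proof.
move=> hx; rewrite -(addr0 0); apply: vgeM => //.
by rewrite -(rmorphN1 iota) -rmorphXn; apply: vgeC.
Qed.

Lemma vge_det m (A : 'M[K]_m) : (forall i j, vge v 0 (A i j)) -> vge v 0 (\det A).
Proof.
move=> h; apply: vge_sum => s _; apply: vge_sign.
by apply: vge_prod => i _; exact: h.
Qed.

Lemma vge_cofactor m (A : 'M[K]_m) i j :
  (forall i j, vge v 0 (A i j)) -> vge v 0 (cofactor A i j).
Proof.
by move=> h; apply: vge_sign; apply: vge_det => i' j'; rewrite !mxE.
Qed.

(* If [A] maps the column [c] into the maximal ideal, then so does its
   determinant: [\adj A *m (A *m c) = \det A *: c]. *)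
Lemma vge_det_kernel m (A : 'M[K]_m) (c : 'cV[K]_m) j :
  (forall i l, vge v 0 (A i l)) -> (forall i, vge v 1 ((A *m c) i 0)) ->
  vge v 1 (\det A * c j 0).
Proof.
move=> hA hc.
have -> : \det A * c j 0 = (\adj A *m (A *m c)) j 0.
  by rewrite mulmxA mul_adj_mx mul_scalar_mx mxE.
rewrite mxE; apply: vge_sum => i _; rewrite -(add0r 1) mxE.
by apply: vgeM => //; exact: vge_cofactor.
Qed.

(** A discrete valuation ring is a maximal proper subring of its field. Units for [v'] are units for
    [v], so [v x = v' x * v y'] for a uniformizer [y'] of [v']; as [v] takes the value 1, this
    forces [v y' = 1]. *)
Lemma sub_val_ring_eq v' : is_dval iota v' ->
  (val_ring v' `<=` val_ring v)%classic -> v' = v.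
Proof.
move=> hv' sub; have [v0 _ _ [y vy] _] := hv; have [v0' _ _ [y' vy'] _] := hv'.
have dM' x z : x != 0 -> z != 0 -> v' (x * z) = v' x + v' z.
  by have [_ h _ _ _] := hv'; apply: h.
have v1' : v' 1 = 0.
  by rewrite -(rmorph1 iota); have [_ _ _ _ h] := hv'; exact: h.
have dV' x : x != 0 -> v' x^-1 = - v' x.
  by move=> x0; have := dM' _ _ x0 (invr_neq0 x0); rewrite mulfV // v1'; lia.
have y0 : y != 0 by apply/eqP => e; rewrite e v0 in vy.
have y0' : y' != 0 by apply/eqP => e; rewrite e v0' in vy'.
have ge0 x : x != 0 -> 0 <= v' x -> 0 <= v x.
  move=> x0 h; have [e|//] : val_ring v x by apply: sub; right.
  by rewrite e eqxx in x0.
have eq0 x : x != 0 -> v' x = 0 -> v x = 0.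
  move=> x0 h; have h1 := ge0 _ x0; have h2 := ge0 _ (invr_neq0 x0).
  rewrite dV' // dvalV // in h2; lia.
have X0 (z : int) : y' ^ z != 0 by rewrite expfz_neq0.
have X' (z : int) : v' (y' ^ z) = z.
  have Xn (m : nat) : v' (y' ^+ m) = m%:Z.
    elim: m => [|m IH]; first by rewrite expr0 v1'.
    by rewrite exprS dM' ?expf_neq0 // IH vy'; lia.
  case: z => m; first by rewrite -exprnP Xn.
  by rewrite NegzE -exprnN dV' ?expf_neq0 // Xn.
have vE x : x != 0 -> v x = v' x * v y'.
  move=> x0; have : v (x / y' ^ (v' x)) = 0.
    apply: eq0; first by rewrite mulf_neq0 ?invr_neq0.
    by rewrite dM' ?invr_neq0 // dV' // X' subrr.
  by rewrite dval_div // dvalXz //; lia.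
have h1 := vE _ y0; have h2 : 0 <= v y' by apply: ge0; rewrite // vy'.
have vy1 : v y' = 1.
  rewrite {}vy in h1; have : 0 < v' y by nia.
  by nia.
apply: functional_extensionality_dep => x.
have [->|x0] := eqVneq x 0; first by rewrite v0 v0'.
by rewrite vE // vy1 mulr1.
Qed.

End OneValuation.

Lemma has_form_order_uniq n (D : 'I_n -> K -> K) v c c' :
  has_form_order D v c -> has_form_order D v c' -> c = c'.
Proof.
move=> [h1 [u1 [a1 b1 e1]]] [h2 [u2 [a2 b2 e2]]].
have := h1 _ a2 b2; have := h2 _ a1 b1; lia.
Qed.

Lemma form_orderE n (D : 'I_n -> K -> K) v c :
  has_form_order D v c -> form_order D v = c.
Proof.
move=> h; apply: has_form_order_uniq (h).
by apply: (@xgetPex _ 0 [set c | has_form_order D v c]); exists c.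
Qed.

End Valuations.

(** * Derivations of the field of degree-0 fractions *)

Section GradedField.
Variables (k : fieldType) (n : nat) (a : 'I_n.+1 -> nat).
Variables (K : fieldType) (iota : {rmorphism k -> K}).
Variable emb : {rmorphism K -> {fraction {mpoly k[n.+1]}}}.
Hypothesis char0 : [pchar k] =i pred0.
Hypothesis hK : degree0_field a iota emb.
Hypothesis a_gt0 : forall i, (0 < a i)%N.
Variable b : 'I_n.+1 -> int.
Hypothesis hb : dot (aw a) b = 1.
Local Notation S := {mpoly k[n.+1]}.
Local Notation aw := (aw a).
Local Notation kmono := (kmono emb).
Local Notation D := (log_frame emb).

Lemma a0_neq0 : (a ord0)%:Z != 0.
Proof. by rewrite eqz_nat -lt0n. Qed.

Lemma eq_kmono u u' : u =1 u' -> kmono u = kmono u'.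
Proof.
move=> e; rewrite /kmono; congr xget; apply/seteqP.
by split=> f /= ->; rewrite (eq_lmono _ e).
Qed.

Lemma kmonoZ c u : dot aw u = 0 -> kmono (fun i => c * u i) = kmono u ^ c.
Proof.
move=> u0; apply: (emb_inj (emb := emb)).
rewrite (emb_kmono hK) ?dotZr ?u0 ?mulr0 // fmorphXz ?kmono_neq0 //.
by rewrite (emb_kmono hK) // lmonoZ.
Qed.

Lemma kmonoD u1 u2 : dot aw u1 = 0 -> dot aw u2 = 0 ->
  kmono (fun i => u1 i + u2 i) = kmono u1 * kmono u2.
Proof.
move=> h1 h2; apply: (emb_inj (emb := emb)).
by rewrite rmorphM /= !(emb_kmono hK) ?dotDr ?h1 ?h2 ?addr0 // lmonoD.
Qed.

Lemma dot_sum w (I : Type) (s : seq I) (F : I -> 'I_n.+1 -> int) :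
  dot w (fun i => \sum_(j <- s) F j i) = \sum_(j <- s) dot w (F j).
Proof.
rewrite /dot exchange_big; apply: eq_bigr => i _.
by rewrite mulr_sumr.
Qed.

Lemma kmono_sum (I : Type) (s : seq I) (F : I -> 'I_n.+1 -> int) :
  (forall j, dot aw (F j) = 0) ->
  kmono (fun i => \sum_(j <- s) F j i) = \prod_(j <- s) kmono (F j).
Proof.
move=> h; elim: s => [|j s IH].
  rewrite big_nil; apply: (emb_inj (emb := emb)).
  rewrite (emb_kmono hK) ?rmorph1.
    by apply: lmono0 => i; rewrite big_nil.
  by rewrite dot_sum big_nil.
rewrite big_cons -IH -kmonoD //; last by rewrite dot_sum big1.
by apply: eq_kmono => i; rewrite big_cons.
Qed.

(** As [b] has weighted degree 1, division by the Laurent monomial of exponent [d * b] turns a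
    homogeneous polynomial of degree [d] into a combination of degree-0 monomials. *)
Definition kpoly (p : S) (d : int) : K :=
  \sum_(m <- msupp p) iota p@_m * kmono (fun i => (m i)%:Z - d * b i).

Lemma dot_mnm_shift d (m : 'X_{1..n.+1}) : wdeg aw m = d ->
  dot aw (fun i => (m i)%:Z - d * b i) = 0.
Proof. by move=> e; rewrite dotBr dotZr hb mulr1 -wdeg_dot e subrr. Qed.

Lemma emb_kpoly (p : S) d : whomog aw d p ->
  emb (kpoly p d) = p%:F * lmono k (fun i => - (d * b i)).
Proof.
move=> /whomogP hp; rewrite /kpoly rmorph_sum /=.
rewrite [in RHS](mpolyE p) rmorph_sum /= mulr_suml !big_seq.
apply: eq_bigr => m mp; rewrite rmorphM /= (emb_iota hK) (emb_kmono hK).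
  by rewrite lmonoD lmono_mnm mulrA -tofracM mul_mpolyC.
by rewrite dot_mnm_shift // hp.
Qed.

Lemma kpoly_frac (f : K) : f != 0 -> exists p q d,
  [/\ p != 0, q != 0, whomog aw d p, whomog aw d q &
      [/\ f = kpoly p d / kpoly q d, kpoly p d != 0 & kpoly q d != 0]].
Proof.
move=> f0; have [p [q [d [q0 hp hq fE]]]] := deg0_homog hK f.
have p0 : p != 0.
  apply: contra_neq f0 => p0; apply: (emb_inj (emb := emb)).
  by rewrite fE p0 rmorph0 mul0r rmorph0.
have neq0 r : r != 0 -> whomog aw d r -> kpoly r d != 0.
  move=> r0 hr; rewrite -(fmorph_eq0 emb) emb_kpoly // mulf_neq0 ?lmono_neq0 //.
  by rewrite tofrac_eq0.
exists p, q, d; split=> //; split; rewrite ?neq0 //.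
apply: (emb_inj (emb := emb)); rewrite fmorph_div /= !emb_kpoly // fE.
by rewrite invfM mulrACA mulfV ?mulr1 // lmono_neq0.
Qed.

Lemma yexp_span u i : dot aw u = 0 ->
  (a ord0)%:Z * u i = \sum_j u (lift ord0 j) * yexp a j i.
Proof.
move=> u0; case: (unliftP ord0 i) => [j ->|->].
  under eq_bigr => l _ do rewrite yexp_lift mulrCA.
  by rewrite -mulr_sumr; congr (_ * _); rewrite (bigD1 j) //= eqxx mulr1
    big1 ?addr0 // => l; rewrite eq_sym => /negbTE ->; rewrite mulr0.
under eq_bigr => j _ do rewrite /yexp (negbTE (neq_lift _ _)) mulr0 sub0r
  eqxx mulr1 mulrN mulrC.
rewrite sumrN; move: u0; rewrite /dot big_ord_recl /aw => /eqP.
by rewrite addr_eq0 => /eqP.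
Qed.

Lemma kmono_pow u : dot aw u = 0 ->
  kmono u ^+ a ord0 = \prod_j kmono (yexp a j) ^ u (lift ord0 j).
Proof.
move=> u0.
under eq_bigr => j _ do rewrite -kmonoZ ?dot_aw_yexp //.
rewrite -kmono_sum => [|j]; last by rewrite dotZr dot_aw_yexp mulr0.
by rewrite exprnP -kmonoZ //; apply: eq_kmono => i; exact: yexp_span.
Qed.

(** The power [a ord0] of a degree-0 monomial is a Laurent monomial in the [y_j]. In characteristic
    0 a derivation that kills a positive power of a nonzero element kills the element, and [K]
    consists of quotients of combinations of degree-0 monomials. *)
Lemma derivation_eq0 d : derivation iota d ->
  (forall j, d (kmono (yexp a j)) = 0) -> forall f, d f = 0.
Proof.
move=> dd dy; have [dD dM dC] := dd.
have d0 : d 0 = 0 := derivation0 dd.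
have prod0 (I : Type) (s : seq I) (F : I -> K) :
    (forall i, d (F i) = 0) -> d (\prod_(i <- s) F i) = 0.
  move=> h; apply: (big_ind (fun x => d x = 0)) => //; first exact: (der1 dM).
  by move=> x y hx hy; rewrite dM hx hy mul0r mulr0 addr0.
have dXz (x : K) (z : int) : x != 0 -> d x = 0 -> d (x ^ z) = 0.
  move=> x0 dx; have dXn (m : nat) : d (x ^+ m) = 0.
    by rewrite (derivationX _ _ dd) dx mulr0.
  case: z => m; first by rewrite -exprnP.
  by rewrite NegzE -exprnN (derivationV dd) ?expf_neq0.
have dmono u : dot aw u = 0 -> d (kmono u) = 0.
  move=> u0; have : d (kmono u ^+ a ord0) = 0.
    rewrite kmono_pow //; apply: prod0 => j; apply: dXz => //.
    exact: (kmono_neq0 hK (dot_aw_yexp a j)).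
  rewrite (derivationX _ _ dd) => /eqP; rewrite !mulf_eq0 expf_eq0.
  rewrite (negbTE (kmono_neq0 hK u0)) andbF orbF.
  by rewrite pmulrn (char0_intr iota char0) (negbTE a0_neq0) /= => /eqP.
have dpoly p e : whomog aw e p -> d (kpoly p e) = 0.
  move=> /whomogP hp; rewrite /kpoly (derivation_sum _ _ dd) big_seq big1 //.
  move=> m mp; rewrite dM dC mul0r dmono ?mulr0 ?addr0 //.
  by apply: dot_mnm_shift; rewrite hp.
move=> f; have [->//|f0] := eqVneq f 0.
have [p [q [e [p0 q0 hp hq [-> kp kq]]]]] := kpoly_frac f0.
by apply: (derivation_divr dd); rewrite ?dpoly.
Qed.

Lemma log_frame_kmono j u : dot aw u = 0 ->
  D j (kmono u) = (u (lift ord0 j))%:~R * kmono u.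
Proof. by move=> u0; apply: (keuler_kmono hK). Qed.

Lemma frame_log_frame : frame iota D.
Proof.
split=> [j|d dd]; first exact: keuler_derivation hK _.
have [dD dM dC] := dd.
have Dd j : derivation iota (D j) by exact: keuler_derivation hK _.
pose y j := kmono (yexp a j).
have y0 j : y j != 0 by exact: (kmono_neq0 hK (dot_aw_yexp a j)).
have a0 : (a ord0)%:Z%:~R != 0 :> K by rewrite (char0_intr iota) // a0_neq0.
have sumE (c : 'rV[K]_n) j : \sum_l c 0 l * D l (y j) = c 0 j * (a ord0)%:Z%:~R * y j.
  rewrite (bigD1 j) //= big1 ?addr0 => [|l lj].
    by rewrite log_frame_kmono ?dot_aw_yexp // yexp_lift eqxx mulr1 mulrA.
  rewrite log_frame_kmono ?dot_aw_yexp // yexp_lift (negbTE lj).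
  by rewrite mulr0 mul0r mulr0.
(* Forced by [D j y_j = a_0 y_j] and [D l y_j = 0] for [l != j]. *)
pose c : 'rV[K]_n := \row_j (d (y j) / ((a ord0)%:Z%:~R * y j)).
exists c; split=> [x|c' hc']; last first.
  apply/rowP => j; rewrite mxE (hc' (y j)) sumE -(mulrA (c' 0 j)) mulfK //.
  by rewrite mulf_neq0.
pose d' x := d x - \sum_j c 0 j * D j x.
have dd' : derivation iota d' by exact: derivation_sub_comb.
have : d' x = 0.
  apply: (derivation_eq0 dd') => j; rewrite -/(y j) /d' sumE mxE.
  by rewrite -mulrA divfK ?subrr // mulf_neq0.
by move/eqP; rewrite subr_eq0 => /eqP.
Qed.

End GradedField.

(** * Monomial valuations on the field of degree-0 fractions *)

Section GradedField.
Variables (k : fieldType) (n : nat) (a : 'I_n.+1 -> nat).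
Variables (K : fieldType) (iota : {rmorphism k -> K}).
Variable emb : {rmorphism K -> {fraction {mpoly k[n.+1]}}}.
Hypothesis char0 : [pchar k] =i pred0.
Hypothesis hK : degree0_field a iota emb.
Hypothesis a_gt0 : forall i, (0 < a i)%N.
Local Notation S := {mpoly k[n.+1]}.
Local Notation aw := (aw a).
Local Notation kmono := (kmono emb).
Local Notation D := (log_frame emb).
Implicit Types (w u : 'I_n.+1 -> int).

Definition kval w (f : K) : int := frac_order (word w) (emb f).

Lemma kval0 w : kval w 0 = 0.
Proof. by rewrite /kval rmorph0 frac_order0. Qed.

Lemma kvalM w f g : f != 0 -> g != 0 -> kval w (f * g) = kval w f + kval w g.
Proof.
by move=> f0 g0; rewrite /kval rmorphM frac_orderM ?fmorph_eq0 //;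
  apply: word_order.
Qed.

Lemma kval_kmono w u : dot aw u = 0 -> kval w (kmono u) = dot w u.
Proof. by move=> u0; rewrite /kval (emb_kmono hK) // frac_word_lmono. Qed.

(** Surjectivity of [w] on the degree-0 exponents, which makes [kval w] a normalized valuation. *)
Definition primitive_weight w := exists2 u, dot aw u = 0 & dot w u = 1.

Lemma kval_dval w : primitive_weight w -> is_dval iota (kval w).
Proof.
move=> [u u0 u1]; split.
- exact: kval0.
- by move=> x y; apply: kvalM.
- move=> x y x0 y0 xy0; rewrite /kval rmorphD; apply: frac_orderD.
  + exact: word_order.
  + by rewrite fmorph_eq0.
  + by rewrite fmorph_eq0.
  + by rewrite -rmorphD fmorph_eq0.
- by exists (kmono u); rewrite kval_kmono.
- move=> c; have [->|c0] := eqVneq c 0; first by rewrite rmorph0 kval0.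
  rewrite /kval (emb_iota hK) -[_%:F]divr1 -tofrac1 frac_orderE ?oner_neq0 //.
  + by rewrite -mpolyC1 !wordC ?oner_neq0 // subrr.
  + exact: word_order.
  + by rewrite mpolyC_eq0.
Qed.

(* Adding a multiple of the weights [a] does not change the valuation of a
   quotient of homogeneous polynomials of the same degree. *)
Lemma kval_shift w w' c t f : 0 < c -> (forall i, w' i = c * w i + t * aw i) ->
  kval w' f = c * kval w f.
Proof.
move=> c0 e; have [->|f0] := eqVneq f 0; first by rewrite !kval0 mulr0.
have [p [q [d [q0 hp hq fE]]]] := deg0_homog hK f.
have p0 : p != 0.
  by apply: contra_neq f0 => p0; apply: (emb_inj (emb := emb));
     rewrite fE p0 rmorph0 mul0r rmorph0.
have wE m : wdeg w' m = c * wdeg w m + t * wdeg aw m.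
  rewrite /wdeg !mulr_sumr -big_split /=; apply: eq_bigr => i _.
  by rewrite e; ring.
have word_shift r : r != 0 -> whomog aw d r -> word w' r = c * word w r + t * d.
  move=> r0 /whomogP hr; apply/eqP; rewrite eq_le.
  have [m mr e1] := word_attained w r0; have [m' mr' e2] := word_attained w' r0.
  have := word_le w' mr; have := word_le w mr'.
  rewrite e1 e2 !wE !hr //; nia.
rewrite /kval fE !frac_orderE ?word_shift //; try exact: word_order.
by ring.
Qed.

Lemma kval_frac w p q f : p != 0 -> q != 0 -> emb f = p%:F / q%:F ->
  kval w f = word w p - word w q.
Proof. by move=> p0 q0 fE; rewrite /kval fE frac_orderE //; exact: word_order. Qed.

Lemma vge_kval_frac w c p q f : q != 0 -> emb f = p%:F / q%:F ->
  wge w (c + word w q) p -> vge (kval w) c f.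
Proof.
move=> q0 fE hp; have [p0|p0] := eqVneq p 0.
  left; apply: (emb_inj (emb := emb)).
  by rewrite fE p0 rmorph0 mul0r rmorph0.
right; rewrite (kval_frac w p0 q0 fE).
by move: hp; rewrite wge_ler //; lia.
Qed.

Lemma word_sqr w (q : S) : q != 0 -> word w (q ^+ 2) = word w q + word w q.
Proof. by move=> q0; rewrite expr2 (word_order k w).1. Qed.

Lemma log_frame0 j : D j 0 = 0.
Proof. exact: (derivation0 (keuler_derivation hK _)). Qed.

(** Euler operators multiply each coefficient by an integer, so they never lower the least
    weight. *)
Lemma vge_log_frame w c j f : vge (kval w) c f -> vge (kval w) c (D j f).
Proof.
move=> [->|h].
  left; exact: log_frame0.
have [f0|f0] := eqVneq f 0.
  rewrite f0; left; exact: log_frame0.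
have [p [q [d [q0 hp hq fE]]]] := deg0_homog hK f.
have p0 : p != 0.
  by apply: contra_neq f0 => p0; apply: (emb_inj (emb := emb));
     rewrite fE p0 rmorph0 mul0r rmorph0.
rewrite (kval_frac w p0 q0 fE) in h.
have DE : emb (D j f) = (euler (lift ord0 j) p * q - p * euler (lift ord0 j) q)%:F
    / (q ^+ 2)%:F by rewrite (emb_keuler hK) fE frac_eulerE.
apply: (vge_kval_frac _ DE); rewrite ?expf_neq0 // word_sqr //.
apply: (@wge_le _ _ _ (word w p + word w q)); first by lia.
apply: wgeD; [|apply: wgeN]; apply: wgeM; rewrite ?wge_word //;
  apply: wge_euler; exact: wge_word.
Qed.

Definition weighted_euler w (p : S) : S := \sum_i (w i)%:~R *: euler i p.

Lemma mcoeff_weighted_euler w p m :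
  (weighted_euler w p)@_m = (wdeg w m)%:~R * p@_m.
Proof.
rewrite /weighted_euler raddf_sum /= /wdeg rmorph_sum /= mulr_suml.
apply: eq_bigr => i _; rewrite mcoeffZ mcoeff_euler rmorphM /= mulrA.
by rewrite -[(m i)%:Z%:~R]pmulrn.
Qed.

Lemma wge_weighted_euler w c p : wge w c p ->
  wge w (c + 1) (weighted_euler w p - c%:~R *: p).
Proof.
move=> /wgeP h; apply/wgeP => m.
rewrite mcoeff_msupp mcoeffB mcoeffZ mcoeff_weighted_euler -mulrBl -rmorphB.
rewrite mulf_eq0 negb_or -mcoeff_msupp => /andP[h1 /h h2].
have : wdeg w m != c by apply: contra_neq h1 => ->; rewrite subrr.
by lia.
Qed.

(* The derivation attached to the weight [w] acts on the leading form of
   weight [c] as multiplication by [c]; hence it kills units modulo the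
   maximal ideal. *)
Lemma vge_weighted_euler w f : w ord0 = 0 -> vge (kval w) 0 f ->
  vge (kval w) 1 (\sum_j (w (lift ord0 j))%:~R * D j f).
Proof.
move=> w0 hf; have [f0|f0] := eqVneq f 0.
  left; rewrite big1 // => j _; rewrite f0.
  by rewrite log_frame0 mulr0.
have {hf} h : 0 <= kval w f by case: hf => // e; rewrite e eqxx in f0.
have [p [q [d [q0 hp hq fE]]]] := deg0_homog hK f.
have p0 : p != 0.
  by apply: contra_neq f0 => p0; apply: (emb_inj (emb := emb));
     rewrite fE p0 rmorph0 mul0r rmorph0.
rewrite (kval_frac w p0 q0 fE) in h.
set al := word w p in h; set be := word w q in h.
pose P := weighted_euler w p; pose Q := weighted_euler w q.
have DE : emb (\sum_j (w (lift ord0 j))%:~R * D j f) =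
    (P * q - p * Q)%:F / (q ^+ 2)%:F.
  have sE r : weighted_euler w r =
      \sum_(j < n) (w (lift ord0 j))%:~R *: euler (lift ord0 j) r.
    by rewrite /weighted_euler big_ord_recl w0 scale0r add0r.
  rewrite rmorph_sum /= /P /Q !sE mulr_suml mulr_sumr -sumrB rmorph_sum /=.
  rewrite mulr_suml; apply: eq_bigr => j _.
  rewrite rmorphM /= rmorph_int (emb_keuler hK) fE frac_eulerE //.
  rewrite -scalerAl -scalerAr -scalerBr -mul_mpolyC.
  by rewrite (rmorph_int (@mpolyC n.+1 k)) [in RHS]tofracM rmorph_int mulrA.
apply: (vge_kval_frac _ DE); rewrite ?expf_neq0 // word_sqr // -/be.
have hP : wge w (al + 1) (P - al%:~R *: p) by apply: wge_weighted_euler (wge_word w p).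
have hQ : wge w (be + 1) (Q - be%:~R *: q) by apply: wge_weighted_euler (wge_word w q).
(* Subtracting the eigenvalues [al] and [be] of the leading forms gains one in weight. The remaining
   term vanishes if [al = be]; otherwise [al > be] and its weight is large enough. *)
have -> : P * q - p * Q = (P - al%:~R *: p) * q - p * (Q - be%:~R *: q)
    + (al - be)%:~R *: (p * q).
  rewrite rmorphB /= scalerBl mulrBl mulrBr -!scalerAl -!scalerAr.
  move: (al%:~R *: (p * q)) (be%:~R *: (p * q)) => X Y; ring.
apply: wgeD.
  apply: (@wge_le _ _ _ (al + 1 + be)); first by lia.
  apply: wgeD; first by apply: wgeM => //; exact: wge_word.
  apply: wgeN; have -> : al + 1 + be = al + (be + 1) by ring.
  by apply: wgeM => //; exact: wge_word.
have [->|ne] := eqVneq al be.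
  by rewrite subrr scale0r /wge msupp0.
apply: (@wge_le _ _ _ (al + be)); first by lia.
have hpq : wge w (al + be) (p * q) by apply: wgeM; exact: wge_word.
by apply/wgeP => m /msuppZ_le; move/wgeP: hpq; apply.
Qed.

Lemma jacobian_kmono (g : 'I_n -> 'I_n.+1 -> int) :
  (forall i, dot aw (g i) = 0) ->
  jacobian D (fun i => kmono (g i)) =
  (\det (\matrix_(i, j) g i (lift ord0 j)))%:~R * \prod_i kmono (g i).
Proof.
move=> hg; rewrite /jacobian -det_map_mx.
have -> : \prod_i kmono (g i) = \det (diag_mx (\row_i kmono (g i))).
  by rewrite det_diag; apply: eq_bigr => i _; rewrite mxE.
rewrite mulrC -det_mulmx; congr (\det _).
apply/matrixP => i j; rewrite mul_diag_mx !mxE (log_frame_kmono hK) //.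
by rewrite mulrC.
Qed.

End GradedField.

Lemma det_neq0_row_free (m : nat) (A : 'M[int]_m) (v : 'rV[int]_m) :
  \det A != 0 -> v *m A = 0 -> v = 0.
Proof.
move=> dA vA; have : v *m (A *m \adj A) = 0 by rewrite mulmxA vA mul0mx.
rewrite mul_mx_adj mul_mx_scalar => /rowP h; apply/rowP => i.
by have /eqP := h i; rewrite !mxE mulf_eq0 (negbTE dA) => /eqP.
Qed.

Section GradedField.
Variables (k : fieldType) (n : nat) (a : 'I_n.+1 -> nat).
Variables (K : fieldType) (iota : {rmorphism k -> K}).
Variable emb : {rmorphism K -> {fraction {mpoly k[n.+1]}}}.
Hypothesis char0 : [pchar k] =i pred0.
Hypothesis hK : degree0_field a iota emb.
Hypothesis a_gt0 : forall i, (0 < a i)%N.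
Local Notation S := {mpoly k[n.+1]}.
Local Notation aw := (aw a).
Local Notation kmono := (kmono emb).
Local Notation D := (log_frame emb).
Local Notation kval := (kval emb).
Implicit Types (w u : 'I_n.+1 -> int).

Definition exp_matrix (g : 'I_n -> 'I_n.+1 -> int) : 'M[int]_n :=
  \matrix_(i, j) g i (lift ord0 j).

Lemma det_exp_yexp : \det (exp_matrix (yexp a)) != 0.
Proof.
have -> : exp_matrix (yexp a) = ((a ord0)%:Z)%:M.
  by apply/matrixP => i j; rewrite !mxE yexp_lift (eq_sym j); case: eqP; rewrite ?mulr1 ?mulr0.
by rewrite det_scalar expf_neq0 // a0_neq0.
Qed.

Lemma primitive_yexp w u : dot aw u = 0 -> dot w u = 1 ->
  exists j, u (lift ord0 j) * dot w (yexp a j) != 0.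
Proof.
move=> u0 u1; apply: contrapT => /forallNP h.
have : (a ord0)%:Z * dot w u = 0.
  rewrite -dotZr.
  have -> : dot w (fun i => (a ord0)%:Z * u i) =
      dot w (fun i => \sum_j u (lift ord0 j) * yexp a j i).
    by apply: eq_bigr => i _; rewrite yexp_span.
  rewrite dot_sum big1 // => j _; rewrite dotZr.
  by apply/eqP; apply/negPn/negP; exact: h.
by rewrite u1 mulr1 => /eqP; rewrite (negbTE (a0_neq0 a_gt0)).
Qed.

(** Among the [y_i], one whose index [j] satisfies [u_j != 0] is replaced by [u]; multiples of [u]
    are subtracted from the others to bring their [w]-value to 0. *)
Lemma adapted_family w : primitive_weight a w ->
  exists (g : 'I_n -> 'I_n.+1 -> int) (j : 'I_n),
    [/\ forall i, dot aw (g i) = 0, forall i, dot w (g i) = (i == j)%:R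
      & \det (exp_matrix g) != 0].
Proof.
move=> [u u0 u1]; have [j hj] := primitive_yexp u0 u1.
move: hj; rewrite mulf_eq0 negb_or => /andP[uj Wj].
pose g i := if i == j then u else
  (fun l => yexp a i l - dot w (yexp a i) * u l).
exists g, j; split=> [i|i|].
- rewrite /g; case: eqP => // _.
  by rewrite dotBr dotZr u0 mulr0 dot_aw_yexp subr0.
- rewrite /g; case: eqP => // _.
  by rewrite dotBr dotZr u1 mulr1 subrr.
rewrite -(intr_eq0 rat) -det_map_mx; apply/det0P => -[v v0 /rowP vA].
(* The coefficient of [u] in the combination [v] of the rows; column [j] shows that it vanishes. *)
pose s := v 0 j - \sum_(l | l != j) v 0 l * (dot w (yexp a l))%:~R.
have col i : v 0 i * ((i != j)%:R * (a ord0)%:R) + s * (u (lift ord0 i))%:~R = 0.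
  have := vA i; rewrite !mxE (bigD1 j) //= !mxE /g eqxx => <-.
  rewrite /s mulrBl addrCA; congr (_ + _); rewrite mulr_suml.
  transitivity (\sum_(l | l != j) (v 0 l * ((i == l)%:R * (a ord0)%:R) -
      v 0 l * (dot w (yexp a l))%:~R * (u (lift ord0 i))%:~R)).
    rewrite sumrB; congr (_ - _); have [->|ij] := eqVneq i j.
      rewrite big1 ?mul0r ?mulr0 // => l; rewrite eq_sym => /negbTE ->.
      by rewrite mul0r mulr0.
    rewrite (bigD1 i) //= eqxx big1 ?addr0 // => l /andP[_].
    by rewrite eq_sym => /negbTE ->; rewrite mul0r mulr0.
  apply: eq_bigr => l lj; rewrite !mxE (negbTE lj) yexp_lift intrB !intrM.
  by rewrite -[(a ord0)%:Z%:~R]pmulrn; case: (i == l) => /=; ring.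
have s0 : s = 0.
  have := col j; rewrite eqxx mul0r mulr0 add0r => /eqP.
  by rewrite mulf_eq0 intr_eq0 (negbTE uj) orbF => /eqP.
have vi i : i != j -> v 0 i = 0.
  move=> ij; have := col i; rewrite ij s0 mul0r addr0 mul1r => /eqP.
  by rewrite mulf_eq0 pnatr_eq0 eqn0Ngt a_gt0 orbF => /eqP.
case/eqP: v0; apply/rowP => i; rewrite mxE.
have [->|/vi //] := eqVneq i j.
by move: s0; rewrite /s big1 ?subr0 // => l /vi ->; rewrite mul0r.
Qed.

Lemma jacobian_kmonoE g : (forall i, dot aw (g i) = 0) ->
  \det (exp_matrix g) != 0 -> forall v, is_dval iota v ->
  jacobian D (fun i => kmono (g i)) != 0 /\
  v (jacobian D (fun i => kmono (g i))) = \sum_i v (kmono (g i)).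
Proof.
move=> hg dg v hv; rewrite (jacobian_kmono hK) // -/(exp_matrix g).
have z0 : (\det (exp_matrix g))%:~R != 0 :> K by rewrite (char0_intr iota).
have p0 : \prod_i kmono (g i) != 0.
  by apply/prodf_neq0 => i _; exact: (kmono_neq0 hK).
split; first by rewrite mulf_neq0.
rewrite (dvalM hv) // -(rmorph_int iota) (dvalC hv) add0r.
have : forall s : seq 'I_n, v (\prod_(i <- s) kmono (g i)) =
    \sum_(i <- s) v (kmono (g i)).
  elim=> [|i s IH]; first by rewrite !big_nil (dval1 hv).
  rewrite !big_cons (dvalM hv) ?IH //; first exact: (kmono_neq0 hK).
  by rewrite prodf_seq_neq0; apply/allP => l _; exact: (kmono_neq0 hK).
by apply.
Qed.

(** Jacobians of elements of the valuation ring have value at least 1: the matrix of logarithmic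
    derivatives has entries in the ring and maps the column of weights, which are constants, into
    the maximal ideal. The adapted family attains the value 1. *)
Lemma form_order_kval w : primitive_weight a w -> form_order D (kval w) = -1.
Proof.
move=> pw; have hv := kval_dval hK pw.
apply: form_orderE; split.
  move=> u hu j0; rewrite opprK.
  have [u1 u10 u11] := pw; have [j] := primitive_yexp u10 u11.
  rewrite mulf_eq0 negb_or => /andP[_ Wj].
  (* A multiple of the weights [a] is subtracted to annihilate the coordinate of index 0, which [D]
     omits; the valuation is only rescaled. *)
  pose w' i := (a ord0)%:Z * w i + (- w ord0) * aw i.
  have w'0 : w' ord0 = 0 by rewrite /w' /aw; ring.
  have a0 : 0 < (a ord0)%:Z by rewrite ltz_nat.
  have w'E f : kval w' f = (a ord0)%:Z * kval w f.
    exact: (kval_shift hK f a0 (fun i => erefl (w' i))).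
  pose A := \matrix_(i, j) D j (u i).
  pose c : 'cV[K]_n := \col_j (w' (lift ord0 j))%:~R.
  have := @vge_det_kernel _ _ _ _ hv n A c j.
  rewrite /c mxE -/(jacobian D u) => H.
  have wj : w' (lift ord0 j) != 0.
    by move: Wj; rewrite dot_yexp /w' /aw mulNr (mulrC (w ord0)).
  have wj0 : (w' (lift ord0 j))%:~R != 0 :> K by rewrite (char0_intr iota).
  suff : vge (kval w) 1 (jacobian D u * (w' (lift ord0 j))%:~R).
    case=> [/eqP|]; first by rewrite mulf_eq0 (negbTE j0) (negbTE wj0).
    by rewrite (dvalM hv) // -(rmorph_int iota) (dvalC hv) addr0.
  apply: H => [i l|i].
    rewrite mxE; apply: (vge_log_frame hK).
    by case: (hu i) => [->|]; [left|right].
  have -> : (A *m c) i 0 = \sum_l (w' (lift ord0 l))%:~R * D l (u i).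
    by rewrite mxE; apply: eq_bigr => l _; rewrite !mxE mulrC.
  have [||->|h] := @vge_weighted_euler _ _ _ _ _ _ hK w' (u i).
  - exact: w'0.
  - case: (hu i) => [->|h]; [by left|right].
    by rewrite w'E mulr_ge0 // ltW.
  - by left.
  - by right; rewrite w'E in h; nia.
have [g [j [g0 gw dg]]] := adapted_family pw.
exists (fun i => kmono (g i)); have [n0 ->] := jacobian_kmonoE g0 dg hv.
split=> // [i|].
  by right; rewrite (kval_kmono hK) // gw; case: eqP.
rewrite opprK; under eq_bigr => i _ do rewrite (kval_kmono hK) // gw.
by rewrite (bigD1 j) //= eqxx big1 ?addr0 // => i /negbTE ->.
Qed.

Lemma log_frame_local x j f : local_ring_at emb x f -> local_ring_at emb x (D j f).
Proof.
move=> [p [q [qx fE]]].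
have q0 : q != 0 by apply: contra_neq qx => ->; rewrite meval0.
exists (euler (lift ord0 j) p * q - p * euler (lift ord0 j) q), (q ^+ 2).
by rewrite rmorphXn expf_neq0 //= (emb_keuler hK) fE frac_eulerE.
Qed.

(** The logarithmic derivations preserve the local ring, hence its localization [val_ring v], so no
    Jacobian has a pole. The Jacobian of the [y_j] is a unit: a nonzero integer times a product of
    units. *)
Lemma form_order_horizontal x v : prime_divisor_at iota (local_ring_at emb x) v ->
  (forall u, dot aw u = 0 -> v (kmono u) = 0) -> form_order D v = 0.
Proof.
move=> [hv Ov loc] vu; apply: form_orderE.
have pres j f : vge v 0 f -> vge v 0 (D j f).
  move=> /loc [r [s [Or Os s0 vs ->]]].
  have [dD dM dC] := keuler_derivation hK (lift ord0 j).
  have -> : D j (r / s) = (D j r * s - r * D j s) * (s ^+ 2)^-1.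
    have e : D j (r / s) * s + r / s * D j s = D j r.
      by rewrite -dM divfK.
    rewrite -e; move: (D j (r / s)) (D j s) => X Y; field.
    exact: s0.
  have hs : vge v 0 (s ^+ 2)^-1.
    by right; rewrite (dvalV hv) ?expf_neq0 // (dvalX hv) // vs mulr0 oppr0.
  rewrite -(addr0 0); apply: (vgeM hv) => //.
  have ge g : local_ring_at emb x g -> vge v 0 g by move=> /Ov.
  apply: (vgeD hv).
    by rewrite -(addr0 0); apply: (vgeM hv); apply: ge => //; exact: log_frame_local.
  rewrite -mulN1r -(addr0 0); apply: (vgeM hv).
    by rewrite -(rmorphN1 iota); exact: (vgeC hv).
  by rewrite -(addr0 0); apply: (vgeM hv); apply: ge => //; exact: log_frame_local.
split=> [u hu j0|].
  rewrite oppr0; apply: (vge_neq0 j0); apply: (vge_det hv) => i j.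
  by rewrite mxE; apply: pres; exact: hu.
exists (fun i => kmono (yexp a i)).
have [n0 ->] := jacobian_kmonoE (dot_aw_yexp a) det_exp_yexp hv.
split=> // [i|]; first by right; rewrite vu ?dot_aw_yexp.
by rewrite big1 // => i _; rewrite vu ?dot_aw_yexp.
Qed.

(** Distinct monomials cannot cancel, so the sum keeps their common [w]-value. Shifting all
    exponents by [M] reduces this to polynomials. *)
Lemma kval_kmono_comb w (T : eqType) (s : seq T) (c : T -> k)
    (e : T -> 'I_n.+1 -> int) :
  uniq s -> (0 < size s)%N -> (forall x, x \in s -> c x != 0) ->
  {in s &, forall x y, e x =1 e y -> x = y} ->
  (forall x, dot aw (e x) = 0) -> (forall x, dot w (e x) = 0) ->
  \sum_(x <- s) iota (c x) * kmono (e x) != 0 /\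
  kval w (\sum_(x <- s) iota (c x) * kmono (e x)) = 0.
Proof.
move=> us s0 c0 ei ea ew; set F := \sum_(x <- s) _.
pose M : nat := (\sum_(x <- s) \sum_i `|e x i|%N)%N.
have eM x i : x \in s -> 0 <= e x i + M%:Z.
  move=> xs; suff : (`|e x i| <= M)%N by lia.
  rewrite /M (bigD1_seq x) //= (bigD1 i) //= -addnA; exact: leq_addr.
pose mon x : 'X_{1..n.+1} := [multinom absz (e x i + M%:Z)%R | i < n.+1].
have monE x i : x \in s -> (mon x i)%:Z = e x i + M%:Z.
  by move=> /(eM _ i); rewrite mnmE; lia.
have mon_inj : {in s &, injective mon}.
  move=> x y xs ys exy; apply: ei => // i.
  by have := monE x i xs; rewrite exy monE //; lia.
pose Q : S := \sum_(x <- s) c x *: 'X_[mon x].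
pose Z : 'X_{1..n.+1} := [multinom M | i < n.+1].
have FE : emb F = Q%:F / ('X_[Z] : S)%:F.
  apply: (mulIf (x := ('X_[Z] : S)%:F)); first by rewrite tofrac_eq0 mpolyX_neq0.
  rewrite divfK ?tofrac_eq0 ?mpolyX_neq0 // /F /Q !rmorph_sum /= mulr_suml.
  rewrite !big_seq; apply: eq_bigr => x xs.
  rewrite rmorphM /= (emb_iota hK) (emb_kmono hK) // -mul_mpolyC tofracM -mulrA.
  congr (_ * _); rewrite -!lmono_mnm -lmonoD; apply: eq_lmono => i.
  by rewrite monE // mnmE.
have Qc x : x \in s -> Q@_(mon x) = c x.
  move=> xs; rewrite /Q raddf_sum /= (bigD1_seq x) //= mcoeffZ mcoeffX eqxx mulr1.
  rewrite big_seq_cond big1 ?addr0 // => y /andP[ys yx].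
  rewrite mcoeffZ mcoeffX; case: eqP => [/mon_inj e1|]; last by rewrite mulr0.
  by rewrite e1 ?eqxx in yx.
have Q0 : Q != 0.
  case: (s) s0 c0 Qc => [//|x t] _ c0 Qc; apply/eqP => Q0.
  by have := c0 x (mem_head _ _); rewrite -Qc ?mem_head // Q0 mcoeff0 eqxx.
have suppQ m : m \in msupp Q -> exists2 x, x \in s & m = mon x.
  move=> mQ; apply: contrapT => h; move: mQ.
  rewrite mcoeff_msupp /Q raddf_sum /= big_seq big1 ?eqxx // => x xs.
  rewrite mcoeffZ mcoeffX; case: eqP => [e1|]; last by rewrite mulr0.
  by case: h; exists x.
have F0 : F != 0.
  rewrite -(fmorph_eq0 emb) FE mulf_neq0 ?invr_eq0 ?tofrac_eq0 //.
  exact: mpolyX_neq0.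
split=> //; rewrite (kval_frac w Q0 (mpolyX_neq0 _ Z) FE) wordX.
have [m /suppQ[x xs ->] ->] := word_attained w Q0.
apply/eqP; rewrite subr_eq0 !wdeg_dot -[X in _ == X]add0r -(ew x) -dotDr.
by apply/eqP; apply: eq_bigr => i _; rewrite monE // mnmE.
Qed.

(** The members of value 0 in an adapted family are algebraically independent modulo the maximal
    ideal: different monomials in them have different exponents, because the exponent matrix is
    nonsingular. *)
Lemma divisorial_kval w : primitive_weight a w -> divisorial iota n (kval w).
Proof.
move=> pw; split; first exact: (kval_dval hK pw).
have [g [j [g0 gw dg]]] := adapted_family pw.
have gw0 l : dot w (g (lift j l)) = 0.
  by rewrite gw eq_sym (negbTE (neq_lift _ _)).
exists (fun l => kmono (g (lift j l))); split=> [l|P P0].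
  by right; rewrite (kval_kmono hK) // gw0.
pose e (m : 'X_{1..n.-1}) (i : 'I_n.+1) : int := \sum_l (m l)%:Z * g (lift j l) i.
have ea m : dot aw (e m) = 0.
  by rewrite dot_sum big1 // => l _; rewrite dotZr g0 mulr0.
have ew m : dot w (e m) = 0.
  by rewrite dot_sum big1 // => l _; rewrite dotZr gw0 mulr0.
have -> : mmap iota (fun l => kmono (g (lift j l))) P =
    \sum_(m <- msupp P) iota P@_m * kmono (e m).
  apply: eq_bigr => m _; congr (_ * _); rewrite (kmono_sum hK) => [|l]; last first.
    by rewrite dotZr g0 mulr0.
  by apply: eq_bigr => l _; rewrite (kmonoZ hK).
apply: kval_kmono_comb; [| | | |exact: ea|exact: ew].
- exact: msupp_uniq.
- by rewrite lt0n size_eq0 msupp_eq0.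
- by move=> m; rewrite mcoeff_msupp.
move=> m m' _ _ emm'.
pose v : 'rV[int]_n := \row_i if unlift j i is Some l then (m l)%:Z - (m' l)%:Z else 0.
suff v0 : v = 0.
  apply/mnmP => l; have := congr1 (fun r : 'rV[int]_n => r 0 (lift j l)) v0.
  rewrite !mxE liftK; lia.
apply: (det_neq0_row_free dg); apply/rowP => i; rewrite !mxE.
rewrite (bigD1 j) //= !mxE unlift_none mul0r add0r.
have := emm' (lift ord0 i); rewrite /e => h.
rewrite (eq_bigl (fun l => l \in [pred l | l != j])) //.
rewrite (reindex_omap (lift j) (unlift j)) => [|l lj]; last first.
  by case: unliftP lj => [l' -> //|->]; rewrite inE eqxx.
rewrite (eq_bigl xpredT) => [|l]; last first.
  by rewrite liftK eqxx andbT inE eq_sym neq_lift.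
under eq_bigr => l _ do rewrite !mxE liftK mulrBl.
by rewrite sumrB h subrr.
Qed.

End GradedField.

(** * Prime divisors of the weighted projective space *)

Definition delta (N : nat) (j : 'I_N) (i : 'I_N) : int := (i == j)%:R.

Lemma word_delta_gt0 (k : fieldType) (N : nat) (j : 'I_N) (p : {mpoly k[N]})
    (x : 'I_N -> k) : p != 0 -> 0 < word (delta j) p -> x j = 0 -> p.@[x] = 0.
Proof.
move=> p0 wp xj; rewrite mevalE big_seq big1 // => m mp.
rewrite (bigD1 j) //= xj expr0n.
have := word_le (delta j) mp; rewrite wdeg_dot dotC dot_delta => h.
have -> : (m j == 0)%N = false by lia.
by rewrite mul0r mulr0.
Qed.

Lemma word_ge0 (k : fieldType) (N : nat) (w : 'I_N -> int) (p : {mpoly k[N]}) :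
  p != 0 -> (forall i, 0 <= w i) -> 0 <= word w p.
Proof.
move=> p0 w0; have [m _ ->] := word_attained w p0.
by apply: sumr_ge0 => i _; rewrite mulr_ge0.
Qed.

Lemma gez1_of_posM (c q s t : int) : 0 < c -> 0 < s -> 0 <= t -> c * q = s + t ->
  1 <= q.
Proof. by move=> c0 s0 t0 e; rewrite -gtz0_ge1; nia. Qed.

Section GradedField.
Variables (k : fieldType) (n : nat) (a : 'I_n.+1 -> nat).
Variables (K : fieldType) (iota : {rmorphism k -> K}).
Variable emb : {rmorphism K -> {fraction {mpoly k[n.+1]}}}.
Hypothesis char0 : [pchar k] =i pred0.
Hypothesis hK : degree0_field a iota emb.
Hypothesis a_gt0 : forall i, (0 < a i)%N.
Hypothesis delta_prim : forall j, primitive_weight a (delta j).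
Local Notation S := {mpoly k[n.+1]}.
Local Notation aw := (aw a).
Local Notation kmono := (kmono emb).
Local Notation D := (log_frame emb).
Local Notation kval := (kval emb).
Implicit Types (w u : 'I_n.+1 -> int).

(** The exponent of [x_l ^ a_i0 / x_i0 ^ a_l]: the analogue of [yexp] for the chart [x_i0 != 0]. *)
Definition zexp (i0 l i : 'I_n.+1) : int :=
  (a i0)%:Z * (i == l)%:R - (a l)%:Z * (i == i0)%:R.

Lemma dot_zexp w i0 l :
  dot w (zexp i0 l) = (a i0)%:Z * w l - (a l)%:Z * w i0.
Proof. by rewrite dotBr !dotZr !dot_delta. Qed.

Lemma dot_aw_zexp i0 l : dot aw (zexp i0 l) = 0.
Proof. by rewrite dot_zexp /aw; ring. Qed.

Lemma lmono_delta (l : 'I_n.+1) : lmono k (fun i => (i == l)%:R) = xvar k l.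
Proof.
rewrite /lmono (bigD1 l) //= eqxx expr1z big1 ?mulr1 // => i /negbTE ->.
by rewrite expr0z.
Qed.

Lemma lmono_zexp i0 l :
  lmono k (zexp i0 l) = ('X_l ^+ a i0 : S)%:F / ('X_i0 ^+ a l : S)%:F.
Proof.
rewrite /zexp lmonoD lmonoN !lmonoZ !lmono_delta -!exprnP /xvar.
by rewrite -!tofracXn.
Qed.

Lemma meval_Xn x (l : 'I_n.+1) e : ('X_l ^+ e : S).@[x] = x l ^+ e.
Proof. by rewrite rmorphXn /= mevalXU. Qed.

Lemma zexp_local x i0 l : x i0 != 0 ->
  local_ring_at emb x (kmono (zexp i0 l)).
Proof.
move=> x0; exists ('X_l ^+ a i0), ('X_i0 ^+ a l).
by rewrite meval_Xn expf_neq0 // (emb_kmono hK) ?dot_aw_zexp // lmono_zexp.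
Qed.

Lemma zexp_local_inv x i0 l : x l != 0 ->
  local_ring_at emb x (kmono (zexp i0 l))^-1.
Proof.
move=> x0; exists ('X_i0 ^+ a l), ('X_l ^+ a i0).
rewrite meval_Xn expf_neq0 // fmorphV /= (emb_kmono hK) ?dot_aw_zexp //.
by rewrite lmono_zexp invf_div.
Qed.

Lemma kmono_zexp_diag i0 : kmono (zexp i0 i0) = 1.
Proof.
apply: (emb_inj (emb := emb)); rewrite (emb_kmono hK) ?dot_aw_zexp // rmorph1.
by apply: lmono0 => i; rewrite /zexp subrr.
Qed.

Section PrimeDivisor.
Variables (x : 'I_n.+1 -> k) (i0 : 'I_n.+1) (v : K -> int).
Hypothesis xi0 : x i0 != 0.
Hypothesis pdv : prime_divisor_at iota (local_ring_at emb x) v.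

Local Notation theta := (fun l => v (kmono (zexp i0 l))).

Let hv : is_dval iota v. Proof. by have [] := pdv. Qed.

Lemma local_vge f : local_ring_at emb x f -> vge v 0 f.
Proof. by have [_ h _] := pdv; apply: h. Qed.

Lemma theta_ge0 l : 0 <= theta l.
Proof.
have := local_vge (zexp_local l xi0); apply: vge_neq0.
by apply: (kmono_neq0 hK); exact: dot_aw_zexp.
Qed.

(** Up to the factor [a i0], the numbers [theta l] serve as values of the coordinates [x_l],
    normalized to 0 at [x_i0]. *)
Lemma val_kmono_theta u : dot aw u = 0 ->
  (a i0)%:Z * v (kmono u) = \sum_l u l * theta l.
Proof.
move=> u0; rewrite -(dvalX hv) ?(kmono_neq0 hK) // exprnP -(kmonoZ hK) //.
have -> : kmono (fun i => (a i0)%:Z * u i) =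
    kmono (fun i => \sum_l u l * zexp i0 l i).
  apply: eq_kmono => i.
  under eq_bigr => l _ do rewrite /zexp mulrBr.
  rewrite sumrB (bigD1 i) //= eqxx mulr1 big1 => [|l].
    rewrite addr0 mulrC; under eq_bigr => l _ do rewrite mulrA.
    rewrite -mulr_suml; move: u0; rewrite dotC /dot /aw => ->.
    by rewrite mul0r subr0.
  by rewrite eq_sym => /negbTE ->; rewrite !mulr0.
rewrite (kmono_sum hK) => [|l]; last by rewrite dotZr dot_aw_zexp mulr0.
have : forall s : seq 'I_n.+1, v (\prod_(l <- s) kmono (fun i => u l * zexp i0 l i))
    = \sum_(l <- s) u l * theta l.
  elim=> [|l s IH]; first by rewrite !big_nil (dval1 hv).
  have nz l' : kmono (fun i => u l' * zexp i0 l' i) != 0.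
    by apply: (kmono_neq0 hK); rewrite dotZr dot_aw_zexp mulr0.
  rewrite !big_cons (dvalM hv) ?IH //; last first.
    by rewrite prodf_seq_neq0; apply/allP => l' _; exact: nz.
  rewrite (kmonoZ hK) ?dot_aw_zexp // (dvalXz hv) //.
  by apply: (kmono_neq0 hK); exact: dot_aw_zexp.
by apply.
Qed.

(** If [theta j > 0], then [x j = 0], as otherwise the inverse monomial would be regular too. In
    [z = A / B] with [v B = 0], the denominator of [A] is not divisible by [x_j], since it does not
    vanish at [x]; neither is the numerator of [B], since this would make [v B] positive. *)
Lemma prime_divisor_sub j : 0 < theta j ->
  (val_ring v `<=` val_ring (kval (delta j)))%classic.
Proof.
move=> tj z zv; have [->|z0] := eqVneq z 0; first by left.
right; have [_ _ loc] := pdv; have [A [B [OA OB B0 vB zE]]] := loc _ zv.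
have A0 : A != 0 by apply: contra_neq z0 => A0; rewrite zE A0 mul0r.
have [p [r [d [rx hp hr AE]]]] := local_ring_homog hK OA.
have [p' [r' [d' [r'x hp' hr' BE]]]] := local_ring_homog hK OB.
have nz (q : S) : q.@[x] != 0 -> q != 0.
  by apply: contra_neq => ->; rewrite meval0.
have r0 := nz _ rx; have r'0 := nz _ r'x.
have num0 (g : K) (q s : S) : g != 0 -> emb g = q%:F / s%:F -> q != 0.
  move=> g0 gE; apply: contra_neq g0 => q0; apply: (emb_inj (emb := emb)).
  by rewrite gE q0 rmorph0 mul0r rmorph0.
have p0 := num0 _ _ _ A0 AE; have p'0 := num0 _ _ _ B0 BE.
have dl0 (i : 'I_n.+1) : 0 <= delta j i by rewrite /delta ler0n.
have hd := kval_dval hK (delta_prim j).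
rewrite zE (dval_div hd) // (kval_frac _ p0 r0 AE) (kval_frac _ p'0 r'0 BE).
suff [-> ->] : word (delta j) r = 0 /\ word (delta j) p' = 0.
  by rewrite subr0 sub0r opprK addr_ge0 // word_ge0.
have zj0 : kmono (zexp i0 j) != 0.
  by apply: (kmono_neq0 hK); exact: dot_aw_zexp.
split; apply/eqP; apply/negPn/negP => nz0.
  have wr : 0 < word (delta j) r by rewrite lt_neqAle eq_sym nz0 word_ge0.
  have xj : x j != 0.
    by apply: contra_neq rx; apply: word_delta_gt0.
  have := vge_neq0 (invr_neq0 zj0) (local_vge (zexp_local_inv i0 xj)).
  by rewrite (dvalV hv) // oppr_ge0 leNgt tj.
have wp' : 0 < word (delta j) p' by rewrite lt_neqAle eq_sym nz0 word_ge0.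
(* Multiplication by [U = r' ^ a_i0 / x_i0 ^ e], a unit at [x], gives [B] a monomial denominator;
   then [B * U] is a combination of degree-0 monomials divisible by [x_j]. *)
pose ai := a i0; have ai0 : (0 < ai)%N by exact: a_gt0.
pose P := p' * r' ^+ ai.-1; pose R := r' ^+ ai.
have R0 : R != 0 by rewrite expf_neq0.
have P0 : P != 0 by rewrite mulf_neq0 ?expf_neq0.
have [m0 m0r] : exists m0, m0 \in msupp r'.
  by have [m0 m0r _] := word_attained aw r'0; exists m0.
have d'E : d' = (adeg a m0)%:Z by rewrite adegE; move/whomogP: hr' => ->.
set e := adeg a m0 in d'E.
have hR : whomog aw (d' * ai%:Z) R by apply: whomogXn.
have hP : whomog aw (d' * ai%:Z) P.
  have -> : d' * ai%:Z = d' + d' * ai.-1%:Z.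
    by rewrite -{1}(prednK ai0) -add1n PoszD mulrDr mulr1.
  by apply: whomogM => //; apply: whomogXn.
have hX : whomog aw (d' * ai%:Z) ('X_i0 ^+ e : S).
  have -> : d' * ai%:Z = aw i0 * e%:Z by rewrite d'E /aw mulrC.
  by apply: whomogXn; rewrite -(wdegU aw i0); apply: whomogX.
have X0 : 'X_i0 ^+ e != 0 :> S by rewrite expf_neq0 // mpolyXi_neq0.
have [_ lift _] := hK.
have [U UE] := lift _ _ _ X0 hR hX.
have Ux : x i0 ^+ e != 0 by rewrite expf_neq0.
have OU : local_ring_at emb x U by exists R, ('X_i0 ^+ e); rewrite meval_Xn.
have OU' : local_ring_at emb x U^-1.
  exists ('X_i0 ^+ e), R; rewrite rmorphXn expf_neq0 //=.
  by rewrite fmorphV UE invf_div.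
have U0 : U != 0.
  by rewrite -(fmorph_eq0 emb) UE mulf_neq0 ?invr_eq0 ?tofrac_eq0.
have vU : v U = 0.
  have := vge_neq0 U0 (local_vge OU).
  have := vge_neq0 (invr_neq0 U0) (local_vge OU').
  rewrite (dvalV hv) // oppr_ge0 => h1 h2.
  by apply/eqP; rewrite eq_le h1 h2.
pose ex (m : 'X_{1..n.+1}) (i : 'I_n.+1) : int := (m i)%:Z - e%:Z * (i == i0)%:R.
have ex0 m : m \in msupp P -> dot aw (ex m) = 0.
  move=> mP; rewrite dotBr dotZr dot_delta -wdeg_dot.
  by move/whomogP: hP => ->; rewrite // d'E /aw subrr.
have BUE : B * U = \sum_(m <- msupp P) iota P@_m * kmono (ex m).
  apply: (emb_inj (emb := emb)); rewrite rmorphM /= BE UE.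
  transitivity (P%:F / ('X_i0 ^+ e : S)%:F).
    rewrite mulf_div -!tofracM; apply/eqP.
    rewrite eqr_div ?tofrac_eq0 ?mulf_neq0 // -!tofracM tofrac_eq /P /R.
    by rewrite -[in X in X == _](prednK ai0) exprS; apply/eqP; ring.
  rewrite rmorph_sum /= [in LHS](mpolyE P) rmorph_sum /= mulr_suml !big_seq.
  apply: eq_bigr => m mP; rewrite rmorphM /= (emb_iota hK) (emb_kmono hK) ?ex0 //.
  rewrite /ex lmonoD lmonoN lmonoZ lmono_delta lmono_mnm -exprnP /xvar.
  by rewrite -tofracXn mulrA -tofracM mul_mpolyC.
have : vge v 1 (B * U).
  rewrite BUE big_seq; apply: (vge_sum hv) => m mP.
  rewrite -(add0r 1); apply: (vgeM hv); first exact: (vgeC hv).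
  right; have := val_kmono_theta (ex0 _ mP).
  have t0 : theta i0 = 0 by rewrite kmono_zexp_diag (dval1 hv).
  have -> : \sum_l ex m l * theta l = \sum_l (m l)%:Z * theta l.
    apply: eq_bigr => l _; rewrite /ex.
    by have [->|_] := eqVneq l i0; rewrite ?t0 ?mulr0 // subr0.
  rewrite (bigD1 j) //= => thE; apply: (gez1_of_posM _ _ _ thE).
  - by rewrite ltz_nat.
  - rewrite mulr_gt0 //; have := word_le (delta j) mP.
    rewrite wdeg_dot dotC dot_delta; apply: lt_le_trans.
    rewrite /P (word_order k (delta j)).1 ?expf_neq0 //.
    by rewrite ltr_pwDl // word_ge0 ?expf_neq0.
  - by apply: sumr_ge0 => l _; rewrite mulr_ge0 ?theta_ge0.
case=> [/eqP|]; first by rewrite mulf_eq0 (negbTE B0) (negbTE U0).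
by rewrite (dvalM hv) // vB vU.
Qed.

(** A positive [theta j] gives an inclusion of discrete valuation rings, hence an equality; if all
    [theta l] vanish, so do the values of all degree-0 monomials. *)
Lemma prime_divisor_cases :
  (exists2 j, j != i0 & v = kval (delta j)) \/
  (forall u, dot aw u = 0 -> v (kmono u) = 0).
Proof.
have [[j tj]|h] := pselect (exists j, 0 < theta j).
  left; exists j.
    apply: contraTneq tj => ->.
    by rewrite kmono_zexp_diag (dval1 hv) ltxx.
  apply: (sub_val_ring_eq (kval_dval hK (delta_prim j)) hv).
  exact: prime_divisor_sub.
right=> u u0; have := val_kmono_theta u0.
rewrite big1 => [/eqP|l _].
  by rewrite mulf_eq0 eqz_nat eqn0Ngt a_gt0 => /eqP.
have tl := theta_ge0 l.
suff -> : v (kmono (zexp i0 l)) = 0 by rewrite mulr0.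
by apply/eqP; rewrite eq_le tl andbT leNgt; apply/negP => tl'; apply: h; exists l.
Qed.

End PrimeDivisor.

End GradedField.

(** * Interior lattice points *)

(** [g] is the least positive value of the linear form; the remainder of [c i] modulo [g] is again a
    value. *)
Lemma int_bezout (N : nat) (c : 'I_N -> int) (i0 : 'I_N) : c i0 != 0 ->
  exists (g : nat) u, [/\ (0 < g)%N, dot c u = g%:Z &
    forall i, exists q, c i = g%:Z * q].
Proof.
move=> ci0.
pose P (g : nat) := `[< (0 < g)%N /\ exists u, dot c u = g%:Z >].
have exP : exists g, P g.
  exists `|c i0|%N; apply/asboolP; split; first by rewrite absz_gt0.
  exists (fun i => Num.sg (c i0) * delta i0 i).
  by rewrite dotZr [dot _ _]dot_delta abszE [RHS]normrEsg.
case: (ex_minnP exP) => g /asboolP[g0 [u ug]] gmin; exists g, u; split=> // i.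
exists (c i %/ g%:Z)%Z; have gz0 : g%:Z != 0 by rewrite eqz_nat -lt0n.
have := divz_eq (c i) g; rewrite mulrC => ce; rewrite [LHS]ce.
suff -> : (c i %% g)%Z = 0 by rewrite addr0.
have r0 := modz_ge0 (c i) gz0.
have rg : (c i %% g)%Z < g%:Z by rewrite ltz_pmod.
apply: contrapT => /eqP rn0.
have := gmin `|(c i %% g)%Z|%N.
have gE : dot c (fun l => delta i l - (c i %/ g)%Z * u l) = (c i %% g)%Z.
  by rewrite dotBr dotZr dot_delta ug {1}ce; ring.
have -> : P `|(c i %% g)%Z|%N.
  apply/asboolP; split; first by rewrite absz_gt0.
  by exists (fun l => delta i l - (c i %/ g)%Z * u l); rewrite gE gez0_abs.
move=> /(_ isT); move: r0 rg; move: (c i %% g)%Z => r r0 rg; lia.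
Qed.

Section WellFormed.
Variables (n : nat) (a : 'I_n.+1 -> nat).
Hypothesis n_gt0 : (0 < n)%N.
Hypothesis a_gt0 : forall i, (0 < a i)%N.
Hypothesis wf : well_formed a.

Lemma well_formed_bezout i : exists2 b : 'I_n.+1 -> int,
  b i = 0 & dot (aw a) b = 1.
Proof.
have [l li] : exists l, l != i.
  have [->|i0] := eqVneq i ord0; last by exists ord0; rewrite eq_sym.
  by exists ord_max; rewrite -val_eqE /= -lt0n.
pose c l := if l == i then 0 else aw a l.
have cl : c l != 0 by rewrite /c (negbTE li) eqz_nat -lt0n.
have [g [u [g0 ug gd]]] := int_bezout cl.
have g1 : g = 1%N.
  apply/eqP; rewrite -dvdn1 -(wf i).
  apply/dvdn_biggcdP => j ji; have [q] := gd j.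
  rewrite /c (negbTE ji) /aw => e.
  by have := congr1 absz e; rewrite abszM /= => ->; rewrite dvdn_mulr.
exists (fun l => if l == i then 0 else u l); first by rewrite eqxx.
rewrite {}g1 in ug; rewrite -[RHS]ug; apply: eq_bigr => j _; rewrite /c.
by case: ifP; rewrite ?mulr0 ?mul0r.
Qed.

(** Well-formedness provides a Laurent monomial of degree 1 not involving [x_j]; dividing [x_j] by
    its power [a j] gives a degree-0 monomial of order 1 along [x_j = 0]. *)
Lemma well_formed_delta j : primitive_weight a (delta j).
Proof.
have [b bj hb] := well_formed_bezout j.
exists (fun i => delta j i - (aw a j) * b i).
  by rewrite dotBr dotZr dot_delta hb mulr1 subrr.
rewrite dotBr dotZr dot_delta /delta eqxx dotC.
by rewrite [dot b _](dot_delta b j) bj mulr0 subr0.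
Qed.

Definition wsum : nat := \sum_i a i.

Lemma dot_1_aw : \sum_i aw a i = wsum%:Z.
Proof.
by rewrite /wsum /aw -natz natr_sum; apply: eq_bigr => i _; rewrite natz.
Qed.

(* [h w_i - a_i \sum w] is, up to the factor [a_i], a barycentric coordinate
   minus that of the origin, of the lattice point [w] of Z^{n+1}/Za. *)
Definition bary (w : 'I_n.+1 -> int) i : int :=
  wsum%:Z * w i - (a i)%:Z * \sum_l w l.

(* A lattice point other than the origin in the interior of the simplex. *)
Definition interior_point (w : 'I_n.+1 -> int) : Prop :=
  (forall i, - (a i)%:Z < bary w i) /\ exists i, bary w i != 0.

(** A multiple of [a], invisible to [bary], is subtracted to make [w] orthogonal to [b], and the
    result is divided by the gcd [g] of its coordinates. The bounds survive, since [- a i < g * z]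
    and [1 <= g] imply [- a i < z]. *)
Lemma interior_point_primitive w : interior_point w ->
  exists2 w', interior_point w' & primitive_weight a w'.
Proof.
move=> [w_in [i wi]]; have [b _ hb] := well_formed_bezout ord0.
pose w0 l := w l - dot w b * aw a l.
have w0E l : bary w0 l = bary w l.
  rewrite /bary /w0 sumrB -mulr_sumr dot_1_aw /aw; ring.
have [l wl] : exists l, w0 l != 0.
  apply: contrapT => /forallNP h; case/negP: wi; rewrite -w0E /bary.
  have e l : w0 l = 0 by apply/eqP; apply/negPn/negP; exact: h.
  by rewrite e big1 ?mulr0 ?subr0.
have [g [u [g0 ug gd]]] := int_bezout wl.
have [w' w'E] : exists w' : 'I_n.+1 -> int, forall i, w0 i = g%:Z * w' i.
  by have [w' hw'] := choice gd; exists w'.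
have bE j : bary w j = g%:Z * bary w' j.
  rewrite -w0E /bary; under eq_bigr => m _ do rewrite w'E.
  by rewrite -mulr_sumr w'E; ring.
have gz : g%:Z != 0 by rewrite eqz_nat -lt0n.
exists w'; first split.
- move=> j; have := w_in j; rewrite bE; move: (bary w' j) (a_gt0 j) => z.
  by move=> aj h; nia.
- by exists i; move: wi; rewrite bE mulf_eq0 negb_or => /andP[].
have w'u : dot w' u = 1.
  apply: (mulfI gz); rewrite -dotZl mulr1; apply: etrans ug.
  by apply: eq_bigr => m _; rewrite w'E.
have w'b : dot w' b = 0.
  apply: (mulfI gz); rewrite -dotZl mulr0.
  transitivity (dot w0 b); first by apply: eq_bigr => m _; rewrite w'E.
  by rewrite /w0 dotBl dotZl hb mulr1 subrr.
exists (fun m => u m - dot (aw a) u * b m).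
  by rewrite dotBr dotZr hb mulr1 subrr.
by rewrite dotBr dotZr w'b mulr0 subr0.
Qed.

End WellFormed.

Section GradedField.
Variables (k : fieldType) (n : nat) (a : 'I_n.+1 -> nat).
Variables (K : fieldType) (iota : {rmorphism k -> K}).
Variable emb : {rmorphism K -> {fraction {mpoly k[n.+1]}}}.
Hypothesis char0 : [pchar k] =i pred0.
Hypothesis hK : degree0_field a iota emb.
Hypothesis n_gt0 : (0 < n)%N.
Hypothesis a_gt0 : forall i, (0 < a i)%N.
Hypothesis wf : well_formed a.
Local Notation S := {mpoly k[n.+1]}.
Local Notation aw := (aw a).
Local Notation kmono := (kmono emb).
Local Notation D := (log_frame emb).
Local Notation kval := (kval emb).
Implicit Types (w u : 'I_n.+1 -> int).

Definition points_model : set (set K) :=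
  [set O | exists2 x : 'I_n.+1 -> k,
     (exists i, x i != 0) & O = local_ring_at emb x].

Lemma log_frameP : frame iota D.
Proof.
have [b _ hb] := well_formed_bezout n_gt0 a_gt0 wf ord0.
exact: (frame_log_frame char0 hK a_gt0 hb).
Qed.

Definition vertex (i : 'I_n.+1) : 'I_n.+1 -> k := fun l => (l == i)%:R.

Lemma vertex_neq0 i : vertex i i != 0.
Proof. by rewrite /vertex eqxx oner_neq0. Qed.

(** The shifted weight [W] is nonnegative and vanishes at [i0]. A denominator that does not vanish
    at the vertex contains a power of [x_i0], of weight 0, so its order is at most 0. *)
Lemma vertex_local_kval i0 w f : (forall l, 0 <= dot w (zexp a i0 l)) ->
  local_ring_at emb (vertex i0) f -> vge (kval w) 0 f.
Proof.
move=> w0 /(local_ring_homog hK)[p [q [d [qx hp hq fE]]]].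
have [->|f0] := eqVneq f 0; first by left.
right; pose W l := (a i0)%:Z * w l + (- w i0) * aw l.
have WE l : W l = dot w (zexp a i0 l) by rewrite dot_zexp /W /aw; ring.
have ai0 : 0 < (a i0)%:Z by rewrite ltz_nat.
have := kval_shift hK f ai0 (fun l => erefl (W l)).
have W0 l : 0 <= W l by rewrite WE.
have q0 : q != 0 by apply: contra_neq qx => ->; rewrite meval0.
have p0 : p != 0.
  by apply: contra_neq f0 => p0; apply: (emb_inj (emb := emb));
     rewrite fE p0 rmorph0 mul0r rmorph0.
rewrite (kval_frac _ p0 q0 fE) => e.
suff wq : word W q <= 0.
  rewrite -(pmulr_rge0 _ ai0) -e subr_ge0.
  by apply: le_trans wq _; apply: word_ge0.
have [m mq mx] : exists2 m, m \in msupp q & forall l, l != i0 -> m l = 0%N.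
  apply: contrapT => h; case/negP: qx; apply/eqP.
  rewrite mevalE big_seq big1 // => m mq.
  have [l li ml] : exists2 l, l != i0 & m l != 0%N.
    apply: contrapT => h'; apply: h; exists m => // l li.
    by apply/eqP; apply/negPn/negP => ml; apply: h'; exists l.
  rewrite (bigD1 l) //= /vertex (negbTE li) expr0n (negbTE ml).
  by rewrite mul0r mulr0.
apply: le_trans (word_le W mq) _; rewrite /wdeg (bigD1 i0) //= big1 => [|l /mx ->].
  have -> : W i0 = 0 by rewrite /W /aw; ring.
  by rewrite addr0 mul0r.
by rewrite mulr0.
Qed.

(** The discrepancy along [kval w] is [- 1 - bary a w i0 / a i0] for a suitable vertex [i0], and
    interior points satisfy [- a i0 < bary a w i0]. *)
Theorem canonical_no_interior_point : canonical_singularities iota n points_model ->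
  forall w, ~ interior_point a w.
Proof.
move=> [_ /(_ _ log_frameP)[_ can]] w0.
move=> /(interior_point_primitive n_gt0 a_gt0 wf)[w [w_in _] pw] {w0}.
have dprim := well_formed_delta n_gt0 a_gt0 wf.
(* The centre of [kval w] contains the vertex where [w i / a i] is least. *)
have [i0 i0min] : exists i0, forall l, 0 <= dot w (zexp a i0 l).
  have [i0 _ h] := @arg_minP _ rat _ ord0 xpredT
    (fun i => (w i)%:~R / (a i)%:R) isT.
  exists i0 => l; rewrite dot_zexp subr_ge0.
  have := h l isT; rewrite ler_pdivrMr ?ltr0n ?a_gt0 // mulrAC.
  rewrite ler_pdivlMr ?ltr0n ?a_gt0 // !pmulrn -!intrM ler_int.
  by rewrite (mulrC (a l)%:Z) (mulrC (a i0)%:Z).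
have ai0 : 0 < (a i0)%:Z by rewrite ltz_nat.
have sumW : \sum_l dot w (zexp a i0 l) < (a i0)%:Z.
  have := w_in i0; rewrite /bary.
  under [X in _ -> X < _]eq_bigr => l _ do rewrite dot_zexp.
  rewrite sumrB -mulr_sumr -mulr_suml -[\sum_i (a i)%:Z]/(\sum_i aw i) dot_1_aw.
  by move=> h; rewrite -ltrN2 opprB.
(* The exponent of [x_i0 ^ h / (x_0 ... x_n) ^ a_i0], with [h] the sum of the weights: it has degree
   0 and order [- a_i0] along each [x_j = 0] with [j != i0]. *)
pose fexp l : int := (wsum a)%:Z * delta i0 l - (a i0)%:Z.
have fexp0 : dot aw fexp = 0.
  rewrite /fexp (_ : (fun l => _) = (fun l => (wsum a)%:Z * delta i0 l - (a i0)%:Z * 1)).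
    rewrite dotBr !dotZr [dot _ (delta i0)]dot_delta /dot.
    under [X in _ - _ * X]eq_bigr => i _ do rewrite mulr1.
    by rewrite dot_1_aw /aw mulrC subrr.
  by apply: functional_extensionality_dep => l; rewrite mulr1.
have wf_ : dot w fexp = bary a w i0 + 0.
  rewrite addr0 /bary /fexp (_ : (fun l => _) =
     (fun l => (wsum a)%:Z * delta i0 l - (a i0)%:Z * 1)).
    rewrite dotBr !dotZr [dot _ (delta i0)]dot_delta /dot.
    by under [X in _ - _ * X]eq_bigr => i _ do rewrite mulr1.
  by apply: functional_extensionality_dep => l; rewrite mulr1.
have leq : local_equation iota D (a i0) (local_ring_at emb (vertex i0)) (kmono fexp).
  split; first by apply: (kmono_neq0 hK).
  move=> v pdv.
  have [[j ji ->]|v0] := prime_divisor_cases hK a_gt0 dprim (vertex_neq0 i0) pdv.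
    rewrite (form_order_kval char0 hK a_gt0 (dprim j)) (kval_kmono hK) //.
    rewrite dotC [dot _ (delta j)]dot_delta /fexp /delta (negbTE ji) mulr0 sub0r.
    by rewrite mulrN1.
  by rewrite (form_order_horizontal char0 hK a_gt0 pdv v0) v0 // mulr0.
have exc : exceptional_over iota n points_model (kval w).
  split; first exact: (divisorial_kval hK a_gt0 pw).
  move=> [O [x [i1 xi1] ->] pdv].
  have [[j _ wj]|w0] := prime_divisor_cases hK a_gt0 dprim xi1 pdv; last first.
    have [u u0 u1] := pw; have := w0 _ u0.
    by rewrite (kval_kmono hK) // u1.
  (* If [kval w] were the valuation of [x_j = 0], then [j = i0] would contradict the minimality of
     [i0], and [j != i0] the bound [sumW]. *)
  have wE l : dot w (zexp a i0 l) = zexp a i0 l j.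
    rewrite -(kval_kmono hK) ?dot_aw_zexp // wj (kval_kmono hK) ?dot_aw_zexp //.
    by rewrite dotC dot_delta.
  have [ji|ji] := eqVneq j i0.
    have [l li] : exists l, l != i0.
      have [->|i0n0] := eqVneq i0 ord0; last by exists ord0; rewrite eq_sym.
      by exists ord_max; rewrite -val_eqE /= -lt0n.
    have := i0min l; rewrite wE /zexp ji eqxx eq_sym (negbTE li).
    rewrite mulr0 sub0r mulr1 oppr_ge0 lez_nat leqNgt a_gt0 //.
  have : (a i0)%:Z <= \sum_l dot w (zexp a i0 l).
    rewrite (bigD1 j) //= wE /zexp eqxx (negbTE ji) mulr0 mulr1 subr0.
    by rewrite lerDl; apply: sumr_ge0 => l _; exact: i0min.
  by rewrite leNgt sumW.
have XO : points_model (local_ring_at emb (vertex i0)).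
  by exists (vertex i0) => //; exists i0; exact: vertex_neq0.
have sub : (local_ring_at emb (vertex i0) `<=` val_ring (kval w))%classic.
  by move=> f /(vertex_local_kval i0min)[->|]; [left|right].
have := can _ _ _ _ (a_gt0 i0) XO leq exc sub.
rewrite /discrepancy (form_order_kval char0 hK a_gt0 pw) (kval_kmono hK) // wf_.
rewrite addr0 subr_ge0 ler_pdivrMr ?ltr0n // mulN1r.
rewrite pmulrn -mulrNz ler_int => h.
by have := w_in i0; rewrite ltNge h.
Qed.

End GradedField.

(** * Factoriality of polynomial rings *)

Section Factorial.
Variable R : idomainType.
Implicit Types (p q x y : R).

Definition divides p x : Prop := exists y, x = y * p.

Definition prime_elt p : Prop :=
  [/\ p != 0, p \isn't a GRing.unit &
    forall x y, divides p (x * y) -> divides p x \/ divides p y].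

(** The number [m] of primes is recorded for the induction in [factored_of_pseudo_irreducible]. *)
Definition prime_factored (m : nat) x : Prop :=
  exists u (s : seq R), [/\ u \is a GRing.unit, size s = m,
    forall p, p \in s -> prime_elt p & x = u * \prod_(p <- s) p].

Definition factorial : Prop := forall x, x != 0 -> exists m, prime_factored m x.

Lemma divides_mulr p x y : divides p y -> divides p (x * y).
Proof. by move=> [z ->]; exists (x * z); rewrite mulrA. Qed.

Lemma divides_mull p x y : divides p x -> divides p (x * y).
Proof. by move=> [z ->]; exists (z * y); rewrite mulrAC. Qed.

Lemma divides_unit p x : divides p x -> x \is a GRing.unit -> p \is a GRing.unit.
Proof. by move=> [y ->]; rewrite unitrM => /andP[]. Qed.

Lemma prime_dvd_prod p (s : seq R) : prime_elt p ->
  divides p (\prod_(q <- s) q) -> exists2 q, q \in s & divides p q.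
Proof.
move=> [p0 pu pp]; elim: s => [|q s IH].
  rewrite big_nil => /divides_unit; rewrite unitr1 => /(_ isT) h.
  by rewrite h in pu.
rewrite big_cons => /pp [h|/IH [q' q's h]]; first by exists q; rewrite ?mem_head.
by exists q' => //; rewrite inE q's orbT.
Qed.

Lemma prime_factored_cancel p x m : x != 0 -> prime_elt p ->
  prime_factored m (p * x) -> (0 < m)%N /\ prime_factored m.-1 x.
Proof.
move=> x0 pp [u [s [uu <- sp e]]]; have [p0 pu ppr] := pp.
have [q qs [c qE]] : exists2 q, q \in s & divides p q.
  apply: prime_dvd_prod => //; case: (ppr u (\prod_(q <- s) q)) => //.
    by exists x; rewrite -e mulrC.
  by move/divides_unit => /(_ uu) h; rewrite h in pu.
have [q0 qu qpr] := sp _ qs.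
have cu : c \is a GRing.unit.
  case: (qpr c p) => [|[d dE]|[d dE]]; first by exists 1; rewrite mul1r.
    have : d * p = 1.
      apply: (mulIf q0); rewrite mul1r [RHS]qE [in RHS]dE; ring.
    by move=> dp; case/negP: pu; apply/unitrPr; exists d; rewrite mulrC.
  have : d * c = 1.
    by apply: (mulIf p0); rewrite mul1r -mulrA -qE -dE.
  by move=> dc; apply/unitrPr; exists d; rewrite mulrC.
have sz : (0 < size s)%N by case: (s) qs.
split=> //; exists (u * c), (rem q s); split.
- by rewrite unitrM uu cu.
- by rewrite size_rem.
- by move=> q' /mem_rem /sp.
apply: (mulfI p0); rewrite e (perm_big _ (perm_to_rem qs)) big_cons /=.
by move: (\prod_(i <- rem q s) i) => X; rewrite qE; ring.
Qed.

Lemma prime_factored_div m c x : c != 0 -> x != 0 ->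
  (exists l, prime_factored l c) -> prime_factored m (c * x) ->
  exists l, prime_factored l x.
Proof.
move=> c0 x0 [l [u [s [uu _ sp cE]]]].
rewrite cE; elim: s sp m {c0 cE} => [|p s IH] sp m.
  rewrite big_nil mulr1 => -[v [t [vu _ tp e]]]; exists (size t).
  exists (v / u), t; split=> //; first by rewrite unitrM vu unitrV.
  by apply: (mulrI uu); rewrite e mulrA (mulrC u) divrK.
have pp : prime_elt p by apply: sp; rewrite mem_head.
have {}sp q : q \in s -> prime_elt q by move=> qs; apply: sp; rewrite inE qs orbT.
rewrite big_cons /=; set y := \prod_(q <- s) q => h.
have y0 : y != 0.
  by rewrite prodf_seq_neq0; apply/allP => q /sp[].
have u0 : u != 0 by apply: contraTneq uu => ->; rewrite unitr0.
have : prime_factored m (p * (u * y * x)).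
  by rewrite (_ : p * (u * y * x) = u * (p * y) * x) //; ring.
move=> /(prime_factored_cancel (mulf_neq0 (mulf_neq0 u0 y0) x0) pp)[_].
exact: IH.
Qed.

Lemma prime_factoredM l m x y : prime_factored l x -> prime_factored m y ->
  prime_factored (l + m) (x * y).
Proof.
move=> [u [s [uu <- sp ->]]] [v [t [vu <- tp ->]]].
exists (u * v), (s ++ t); rewrite unitrM uu vu size_cat big_cat; split=> //.
  by move=> p; rewrite mem_cat => /orP[/sp|/tp].
by rewrite /=; ring.
Qed.

Lemma prime_factored_prime p : prime_elt p -> prime_factored 1 p.
Proof.
move=> pp; exists 1, [:: p]; rewrite unitr1 big_seq1 mul1r; split=> //.
by move=> q; rewrite inE => /eqP ->.
Qed.

End Factorial.

Lemma factorial_field (F : fieldType) : factorial F.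
Proof.
move=> x x0; exists 0%N, x, [::]; rewrite unitfE big_nil mulr1.
by split.
Qed.

Lemma factorial_iso (A B : idomainType) (f : {rmorphism A -> B}) (g : B -> A) :
  cancel f g -> cancel g f -> factorial B -> factorial A.
Proof.
move=> fK gK fB x x0.
have fi := can_inj fK.
have f0 y : (f y == 0) = (y == 0) by rewrite -(rmorph0 f) (inj_eq fi).
have fu y : f y \is a GRing.unit -> y \is a GRing.unit.
  move=> /unitrPr[z e]; apply/unitrPr; exists (g z); apply: fi.
  by rewrite rmorphM rmorph1 gK.
have div y z : divides (f y) (f z) <-> divides y z.
  split=> [[c e]|[c ->]]; last by exists (f c); rewrite rmorphM.
  by exists (g c); apply: fi; rewrite rmorphM gK.
have [|m [u [s [uu sz sp e]]]] := fB (f x); first by rewrite f0.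
exists m, (g u), [seq g p | p <- s]; rewrite size_map; split=> //.
- by apply: fu; rewrite gK.
- move=> p /mapP[q /sp [q0 qu qp] ->]; split.
  + by rewrite -f0 gK.
  + apply: contra qu => /unitrPr[z ez]; apply/unitrPr; exists (f z).
    by rewrite -[q]gK -rmorphM ez rmorph1.
  + by move=> y z /div; rewrite gK rmorphM => /qp[h|h]; [left|right];
      apply/div; rewrite gK.
apply: fi; rewrite e rmorphM gK big_map rmorph_prod.
by congr (_ * _); apply: eq_bigr => p _; rewrite gK.
Qed.

Section Gauss.
Variable R : idomainType.
Hypothesis fR : factorial R.
Implicit Types (p q f g : {poly R}).

Lemma divides_polyC (c : R) f : divides c%:P f <-> forall i, divides c f`_i.
Proof.
split=> [[g ->] i|h]; first by exists g`_i; rewrite coefMC.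
have [e he] := choice h.
exists (\poly_(i < size f) e i); apply/polyP => i.
rewrite coefMC coef_poly; case: ltnP => [_|si]; first exact: he.
by rewrite nth_default // mul0r.
Qed.

(* Gauss: the lowest coefficients of [f] and [g] not divisible by [c] meet in
   a coefficient of [f * g] not divisible by [c]. *)
Lemma prime_polyC (c : R) : prime_elt c -> prime_elt c%:P.
Proof.
move=> [c0 cu cp]; split; first by rewrite polyC_eq0.
  by apply: contra cu; rewrite poly_unitE coefC eqxx => /andP[].
move=> f g /divides_polyC h; apply: contrapT => /not_orP[nf ng].
pose N f i := `[< ~ divides c f`_i >].
have exN f' : ~ divides c%:P f' -> exists i, N f' i.
  move=> nf'; apply: contrapT => hN; apply: nf'; apply/divides_polyC => i.
  by apply: contrapT => hi; apply: hN; exists i; apply/asboolP.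
case: (ex_minnP (exN f nf)) => i /asboolP fi imin.
case: (ex_minnP (exN g ng)) => j /asboolP gj jmin.
have low f' i0 : (forall l, N f' l -> (i0 <= l)%N) -> forall l, (l < i0)%N ->
    divides c f'`_l.
  move=> hmin l li; apply: contrapT => hl.
  by have := hmin l; rewrite leqNgt li /N (asboolT hl) => /(_ isT).
have dD x y : divides c x -> divides c y -> divides c (x + y).
  by move=> [x' ->] [y' ->]; exists (x' + y'); rewrite mulrDl.
have [z e] := h (i + j)%N.
have hi : (i < (i + j).+1)%N by rewrite ltnS leq_addr.
move: e; rewrite coefM (bigD1 (Ordinal hi)) //= addKn.
set rest := \sum_(l | _) _ => e.
have [y re] : divides c rest.
  apply: (big_ind (divides c)) => //; first by exists 0; rewrite mul0r.
  move=> l li; have [lt|ge] := ltnP l i.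
    by apply: divides_mull; apply: low lt.
  apply: divides_mulr; apply: (low _ j) => //.
  have {}li : l != i :> nat by apply: contra li => /eqP li; apply/eqP/val_inj.
  have := ltn_ord l; lia.
have : divides c (f`_i * g`_j).
  by exists (z - y); rewrite mulrBl -e -re addrK.
by case/cp.
Qed.

(** Irreducibility over the fraction field of [R], with denominators cleared. *)
Definition pseudo_irreducible p : Prop :=
  forall (c : R) g h, c != 0 -> c%:P * p = g * h ->
    (size g <= 1)%N \/ (size h <= 1)%N.

(** Each prime factor of [c] divides [g * p] and not [p], hence divides [g] and can be cancelled. *)
Lemma primitive_divides p (c : R) b g :
  (forall q : R, prime_elt q -> ~ divides q%:P p) ->
  c != 0 -> c%:P * b = g * p -> divides p b.
Proof.
move=> hp c0; have [m [u [s [uu _ sp cE]]]] := fR c0.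
rewrite {}cE; elim: s sp g => [|q s IH] sp g {c0}.
  rewrite big_nil mulr1 => e; exists (u^-1%:P * g).
  by rewrite -mulrA -e mulrA -polyCM mulVr // mul1r.
rewrite big_cons mulrCA => e.
have qp : prime_elt q by apply: sp; rewrite mem_head.
have [_ _ qd] := prime_polyC qp.
have [q0 _ _] := qp.
case: (qd g p) => [||/(hp _ qp)//].
  by exists ((u * \prod_(j <- s) j)%:P * b); rewrite -e polyCM; ring.
move=> [g' gE]; apply: (IH _ g').
  by move=> q' q's; apply: sp; rewrite inE q's orbT.
have qP0 : q%:P != 0 by rewrite polyC_eq0.
apply: (mulfI qP0); rewrite mulrA -polyCM e gE; ring.
Qed.

(** Over the fraction field, the gcd of [p] and [a] is [p] or 1 up to constants, so [p] divides [a]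
    or [b] there; [primitive_divides] removes the denominators. *)
Lemma prime_of_primitive p : (1 < size p)%N -> pseudo_irreducible p ->
  (forall q : R, prime_elt q -> ~ divides q%:P p) -> prime_elt p.
Proof.
move=> sp irr hp.
have p0 : p != 0 by rewrite -size_poly_gt0; apply: ltn_trans sp.
have pd b : Pdiv.IdomainDefs.dvdp p b -> divides p b.
  move=> /Pdiv.WeakIdomain.dvdpP[[c g] /= c0 e].
  by apply: (primitive_divides hp c0 (g := g)); rewrite mul_polyC.
split=> //.
  by apply/negP; rewrite poly_unitE => /andP[/eqP sp1]; rewrite sp1 in sp.
move=> a b [y e].
have dab : Pdiv.IdomainDefs.dvdp p (a * b).
  by apply/Pdiv.WeakIdomain.dvdpP; exists (1, y); rewrite ?oner_neq0 ?scale1r.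
set d := Pdiv.CommonIdomain.gcdp p a.
have /Pdiv.WeakIdomain.dvdpP[[c g] /= c0 cE] : Pdiv.IdomainDefs.dvdp d p.
  exact: Pdiv.CommonIdomain.dvdp_gcdl.
have g0 : g != 0.
  apply: contra_neq p0 => g0; have := cE; rewrite g0 mul0r => /eqP.
  by rewrite -mul_polyC mulf_eq0 polyC_eq0 (negbTE c0) => /eqP.
have d0 : d != 0.
  by rewrite Pdiv.CommonIdomain.gcdp_eq0 (negbTE p0).
have := irr c g d c0; rewrite mul_polyC => /(_ cE) [sg|sd].
  left; apply: pd; apply/Pdiv.WeakIdomain.dvdpP.
  have /Pdiv.WeakIdomain.dvdpP[[c' g'] /= c'0 e'] : Pdiv.IdomainDefs.dvdp d a.
    exact: Pdiv.CommonIdomain.dvdp_gcdr.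
  rewrite (size1_polyC sg) in cE g0; rewrite polyC_eq0 in g0.
  exists (g`_0 * c', c *: g'); first by rewrite mulf_neq0.
  rewrite /= -[RHS]scalerAl [RHS]scalerAr cE -scalerA e' -mul_polyC; ring.
right; apply: pd; rewrite -(@Pdiv.CommonIdomain.Gauss_dvdpr _ b a p) //.
rewrite Pdiv.CommonIdomain.coprimep_def -/d.
by rewrite eqn_leq sd size_poly_gt0.
Qed.

(** Dividing [p] by a prime constant removes one prime factor from its leading coefficient, so this
    process stops at a primitive polynomial. *)
Lemma factored_of_pseudo_irreducible N p : (1 < size p)%N ->
  pseudo_irreducible p -> prime_factored N (lead_coef p) ->
  exists m, prime_factored m p.
Proof.
elim: N p => [|N IH] p sp irr hN.
  exists 1%N; apply: prime_factored_prime; apply: prime_of_primitive => //.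
  move=> q qp [g gE].
  have g0 : lead_coef g != 0.
    rewrite lead_coef_eq0; apply: contraTneq sp => g0.
    by rewrite gE g0 mul0r size_poly0.
  have := prime_factored_cancel g0 qp (m := 0).
  by rewrite mulrC -[q in _ * q](lead_coefC q) -lead_coefM -gE => /(_ hN) [].
have [[q [qp [g gE]]]|hq] := pselect (exists q : R, prime_elt q /\ divides q%:P p);
  last first.
  exists 1%N; apply: prime_factored_prime; apply: prime_of_primitive => //.
  by move=> q qp h; apply: hq; exists q.
have [q0 _ _] := qp.
have gn0 : g != 0.
  by apply: contraTneq sp => g0; rewrite gE g0 mul0r size_poly0.
have sg : size g = size p by rewrite gE mulrC mul_polyC size_scale.
have [|||m hm] := IH g; first by rewrite sg.
- move=> c x y c0 e; case: (irr c (x * q%:P) y c0).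
  + by rewrite gE mulrA e; ring.
  + by rewrite mulrC mul_polyC size_scale //; left.
  + by right.
- have := @prime_factored_cancel _ q (lead_coef g) N.+1.
  rewrite lead_coef_eq0 mulrC -[q in _ * q](lead_coefC q) -lead_coefM -gE.
  by move=> /(_ gn0 qp hN) [].
exists (m + 1)%N; rewrite gE; apply: prime_factoredM => //.
by apply: prime_factored_prime; apply: prime_polyC.
Qed.

Lemma prime_factored_polyC m (c : R) : prime_factored m c -> prime_factored m c%:P.
Proof.
move=> [u [s [uu sz sp ->]]]; exists u%:P, (map polyC s).
rewrite size_map; split=> //.
- have u0 : u != 0 by apply: contraTneq uu => ->; rewrite unitr0.
  by rewrite poly_unitE size_polyC coefC eqxx uu u0.
- by move=> q /mapP[r /sp rp ->]; apply: prime_polyC.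
- by rewrite polyCM rmorph_prod big_map.
Qed.

(** If [c%:P * p = g * h] with [g] and [h] nonconstant, both have smaller size than [p]; the primes
    of [c] are then cancelled from the factorization of [g * h]. *)
Lemma factorial_poly : factorial {poly R}.
Proof.
move=> p; have [N] := ubnP (size p); elim: N p => // N IH p pN p0.
have [sp|sp] := leqP (size p) 1.
  rewrite (size1_polyC sp) in p0 *; rewrite polyC_eq0 in p0.
  by have [m hm] := fR p0; exists m; apply: prime_factored_polyC.
have [irr|] := pselect (pseudo_irreducible p).
  have l0 : lead_coef p != 0 by rewrite lead_coef_eq0.
  by have [m hm] := fR l0; apply: factored_of_pseudo_irreducible hm.
move=> /existsNP[c /existsNP[g /existsNP[h /not_implyP[c0 /not_implyP[e]]]]].
move=> /not_orP[/negP sg /negP sh]; rewrite -ltnNge in sg; rewrite -ltnNge in sh.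
have g0 : g != 0 by rewrite -size_poly_gt0; apply: ltn_trans sg.
have h0 : h != 0 by rewrite -size_poly_gt0; apply: ltn_trans sh.
have szp : size p = (size g + size h).-1.
  by rewrite -size_mul // -e mul_polyC size_scale.
have [||mg hg] := IH g => //; first by lia.
have [||mh hh] := IH h => //; first by lia.
have cP0 : c%:P != 0 by rewrite polyC_eq0.
apply: (prime_factored_div cP0 p0).
  by have [m hm] := fR c0; exists m; apply: prime_factored_polyC.
by rewrite e; apply: prime_factoredM hg hh.
Qed.

End Gauss.

Section MpolyUnivariate.
Variables (R : nzRingType) (n : nat).

Lemma muniX (m : 'X_{1..n.+1}) : muni ('X_[m] : {mpoly R[n.+1]}) =
  'X_[[multinom m (widen_ord (leqnSn n) i) | i < n]] *: 'X^(m ord_max).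
Proof. by rewrite muniE msuppX big_seq1 mcoeffX eqxx scale1r. Qed.

Lemma muni_mwiden (c : {mpoly R[n]}) : muni (mwiden c) = c%:P.
Proof.
have muni_sum (s : seq 'X_{1..n}) (f : 'X_{1..n} -> R) :
    muni (mwiden (\sum_(m <- s) f m *: 'X_[m])) = (\sum_(m <- s) f m *: 'X_[m])%:P.
  elim: s => [|m s IH]; first by rewrite !big_nil mwiden0 muni0.
  rewrite !big_cons mwidenD muniD polyCD IH; congr (_ + _).
  rewrite mwidenZ muniZ mwidenX muniX mnmwiden_ordmax expr0 alg_polyC.
  rewrite -mul_polyC -polyCM mul_mpolyC; congr (_ *: 'X_[_])%:P.
  by apply/mnmP => i; rewrite mnmE mnmwiden_widen.
by rewrite {1}(mpolyE c) muni_sum -mpolyE.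
Qed.

Lemma muni_ord_max : muni ('X_ord_max : {mpoly R[n.+1]}) = 'X.
Proof.
rewrite muniX mnm1E eqxx expr1 (_ : [multinom _ | i < n] = 0%MM) ?mpolyX0 ?scale1r //.
apply/mnmP => i; rewrite mnmE mnm1E mnm0E; apply/eqP; rewrite eqb0.
by rewrite -val_eqE /= gtn_eqF.
Qed.

Lemma mmultiK : cancel (@mmulti n R) (@muni n R).
Proof.
move=> p; rewrite /mmulti rmorph_sum /= -[RHS]coefK poly_def.
by apply: eq_bigr => i _; rewrite muniM muni_mwiden rmorphXn /= muni_ord_max mul_polyC.
Qed.

(** Every coefficient of [p] can be read off [muni p], so [muni] is injective; together with
    [mmultiK] it is an isomorphism. *)
Lemma coef_muni (p : {mpoly R[n.+1]}) (m : 'X_{1..n.+1}) :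
  (muni p)`_(m ord_max)@_[multinom m (widen_ord (leqnSn n) i) | i < n] = p@_m.
Proof.
rewrite muniE coef_sum raddf_sum /=.
under eq_bigr => m' _ do rewrite coefZ coefXn mulr_natr mcoeffMn mcoeffZ mcoeffX.
have e (m' : 'X_{1..n.+1}) : ([multinom m' (widen_ord (leqnSn n) i) | i < n] ==
    [multinom m (widen_ord (leqnSn n) i) | i < n]) && (m ord_max == m' ord_max) =
    (m' == m).
  apply/andP/eqP => [[/eqP h /eqP h2]|->] //; apply/mnmP => i.
  have [iE|] := eqVneq i ord_max; first by rewrite iE.
  rewrite -val_eqE /= => ni; have ilt : (i < n)%N by have := ltn_ord i; lia.
  have := congr1 (fun q : 'X_{1..n} => q (Ordinal ilt)) h; rewrite !mnmE.
  by rewrite (_ : widen_ord _ _ = i) //; apply: val_inj.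
have h (m' : 'X_{1..n.+1}) : p@_m' * ([multinom m' (widen_ord (leqnSn n) i) | i < n] ==
    [multinom m (widen_ord (leqnSn n) i) | i < n])%:R *+ (m ord_max == m' ord_max)
    = p@_m' * (m' == m)%:R.
  by rewrite -e; case: eqP; case: eqP; rewrite /= ?mulr1 ?mulr0 ?mul0rn.
under eq_bigr => m' _ do rewrite h.
have [mp|mp] := boolP (m \in msupp p); last first.
  rewrite (memN_msupp_eq0 mp) big_seq big1 // => m' m'p.
  by case: eqP => [e'|_]; [rewrite -e' m'p in mp | rewrite mulr0].
rewrite (bigD1_seq m mp (msupp_uniq p)) /= eqxx mulr1 big1 ?addr0 //.
by move=> m' /negbTE ->; rewrite mulr0.
Qed.

Lemma muniK : cancel (@muni n R) (@mmulti n R).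
Proof.
by move=> p; apply/mpolyP => m; rewrite -!coef_muni mmultiK.
Qed.

End MpolyUnivariate.

Lemma factorial_mpoly (k : fieldType) (n : nat) : factorial {mpoly k[n]}.
Proof.
elim: n => [|n IH].
  apply: (@factorial_iso _ k (@mcoeff 0 k 0%MM) (@mpolyC 0 k)).
  - exact: mpolyKC.
  - by move=> c; rewrite /= mcoeffC eqxx mulr1.
  - exact: factorial_field.
apply: (@factorial_iso _ {poly {mpoly k[n]}} (@muni n k) (@mmulti n k)).
- exact: muniK.
- exact: mmultiK.
- exact: factorial_poly.
Qed.

(** * The Fano index divides the sum of the weights *)

Section PrimeOrder.
Variables (k : fieldType) (N : nat).
Local Notation S := {mpoly k[N]}.
Implicit Types (p q r : S).

Lemma msize_gt0 p : p != 0 -> (0 < msize p)%N.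
Proof. by rewrite lt0n msize_poly_eq0. Qed.

Lemma mpoly_unitE p : p \is a GRing.unit = (msize p == 1%N).
Proof.
apply/idP/idP => [/unitrPr[q pq]|/msize_poly1P[c c0 ->]].
  have p0 : p != 0.
    by apply/eqP => p0; move/eqP: pq; rewrite p0 mul0r eq_sym oner_eq0.
  have q0 : q != 0.
    by apply/eqP => q0; move/eqP: pq; rewrite q0 mulr0 eq_sym oner_eq0.
  have := msizeM p0 q0; rewrite pq msize1.
  move: (msize_gt0 p0) (msize_gt0 q0).
  by move: (msize p) (msize q) => x y; lia.
by apply/unitrPr; exists (c^-1)%:MP; rewrite -mpolyCM mulfV.
Qed.

Lemma mpolyX_unit (i : 'I_N) : ('X_i : S) \isn't a GRing.unit.
Proof. by rewrite mpoly_unitE msizeX mdeg1. Qed.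

Variable pi : S.
Hypothesis pi_prime : prime_elt pi.

Lemma prime_neq0 : pi != 0. Proof. by case: pi_prime. Qed.

Lemma prime_msize : (1 < msize pi)%N.
Proof.
have [p0 pu _] := pi_prime; rewrite mpoly_unitE in pu.
by move: (msize_gt0 p0) pu; move: (msize pi) => x; lia.
Qed.

Lemma prime_split p : p != 0 -> exists e r, p = pi ^+ e * r /\ ~ divides pi r.
Proof.
have [M] := ubnP (msize p); elim: M p => // M IH p pM p0.
have [[q qE]|h] := pselect (divides pi p); last by exists 0%N, p; rewrite mul1r.
have q0 : q != 0 by apply: contra_neq p0 => q0; rewrite qE q0 mul0r.
have [||e [r [rE hr]]] := IH q => //.
  have := msizeM q0 prime_neq0; rewrite -qE; move: prime_msize pM (msize_gt0 q0).
  by move: (msize pi) (msize p) (msize q) => x y z; lia.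
by exists e.+1, r; split=> //; rewrite qE rE exprS; ring.
Qed.

Definition ordp p : nat :=
  xget 0%N (fun e => exists r, p = pi ^+ e * r /\ ~ divides pi r).

Lemma prime_split_uniq e e' r r' : ~ divides pi r -> ~ divides pi r' ->
  pi ^+ e * r = pi ^+ e' * r' -> e = e'.
Proof.
wlog le : e e' r r' / (e <= e')%N.
  move=> h hr hr' E; have [le|le] := leqP e e'; first exact: (h _ _ r r').
  by apply/esym; apply: (h _ _ r' r) => //; apply: ltnW.
move=> hr hr'; rewrite -(subnKC le) exprD -mulrA.
move/(mulfI (expf_neq0 _ prime_neq0)).
case: (e' - e)%N => [|d] rE; first by rewrite addn0.
by case: hr; exists (pi ^+ d * r'); rewrite rE exprS; ring.
Qed.

Lemma ordp_split p : p != 0 -> exists2 r, p = pi ^+ ordp p * r & ~ divides pi r.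
Proof.
move=> /prime_split[e [r er]].
have [|r' [rE hr]] := @xgetPex _ 0%N
  (fun e => exists r, p = pi ^+ e * r /\ ~ divides pi r).
  by exists e, r.
by exists r'.
Qed.

Lemma ordpE e p r : p != 0 -> p = pi ^+ e * r -> ~ divides pi r -> ordp p = e.
Proof.
move=> p0 pE hr; have [r' pE' hr'] := ordp_split p0.
by apply: (prime_split_uniq hr' hr); rewrite -pE -pE'.
Qed.

Lemma ordp_gt0 p : p != 0 -> (0 < ordp p)%N <-> divides pi p.
Proof.
move=> p0; have [r pE hr] := ordp_split p0; split=> [a|[q qE]].
  exists (pi ^+ (ordp p).-1 * r).
  by rewrite mulrAC -exprSr prednK.
rewrite lt0n; apply/eqP => o0; apply: hr; exists q.
by rewrite -qE [RHS]pE o0 mul1r.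
Qed.

Lemma ordp0 p : p != 0 -> ~ divides pi p -> ordp p = 0%N.
Proof. by move=> p0 /(ordp_gt0 p0) /negP; rewrite -leqNgt leqn0 => /eqP. Qed.

Lemma ordp_self : ordp pi = 1%N.
Proof.
apply: (@ordpE _ _ 1); rewrite ?prime_neq0 ?expr1 ?mulr1 //.
move/divides_unit; rewrite unitr1 => /(_ isT).
by have [_ /negP] := pi_prime.
Qed.

Lemma ordpM p q : p != 0 -> q != 0 -> ordp (p * q) = (ordp p + ordp q)%N.
Proof.
move=> p0 q0; have [r pE hr] := ordp_split p0; have [s qE hs] := ordp_split q0.
apply: (@ordpE _ _ (r * s)); first by rewrite mulf_neq0.
  by rewrite exprD mulrACA -pE -qE.
by have [_ _ h] := pi_prime => /h[].
Qed.

Lemma ordpX p e : p != 0 -> ordp (p ^+ e) = (e * ordp p)%N.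
Proof.
move=> p0; elim: e => [|e IH]; last by rewrite exprS ordpM ?expf_neq0 // IH mulSn.
apply: ordp0; first by rewrite expr0 oner_neq0.
rewrite expr0 => /divides_unit; rewrite unitr1 => /(_ isT).
by have [_ /negP] := pi_prime.
Qed.

Lemma ordp_order : order_fun (fun p => (ordp p)%:Z).
Proof.
split=> p q p0 q0; first by rewrite ordpM // PoszD.
move=> pq0.
have [r pE hr] := ordp_split p0; have [s qE hs] := ordp_split q0.
set m := minn (ordp p) (ordp q).
have mp : (m <= ordp p)%N by rewrite geq_minl.
have mq : (m <= ordp q)%N by rewrite geq_minr.
have sE : p + q = pi ^+ m * (pi ^+ (ordp p - m) * r + pi ^+ (ordp q - m) * s).
  by rewrite mulrDr !mulrA -!exprD !subnKC // -pE -qE.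
have t0 : pi ^+ (ordp p - m) * r + pi ^+ (ordp q - m) * s != 0.
  by apply: contra_neq pq0 => t0; rewrite sE t0 mulr0.
have -> : ordp (p + q) = (m + ordp (pi ^+ (ordp p - m) * r + pi ^+ (ordp q - m) * s))%N.
  rewrite sE ordpM ?expf_neq0 ?prime_neq0 // ordpX ?prime_neq0 //.
  by rewrite ordp_self muln1.
rewrite /m; lia.
Qed.

End PrimeOrder.

Lemma horner_mmap (k : fieldType) (N : nat) (h : 'I_N -> {poly k})
    (p : {mpoly k[N]}) (t : k) :
  (mmap polyC h p).[t] = p.@[fun i => (h i).[t]].
Proof.
rewrite /mmap horner_sum mevalE; apply: eq_bigr => m _.
rewrite hornerM hornerC horner_prod; congr (_ * _).
by apply: eq_bigr => i _; rewrite horner_exp.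
Qed.

Lemma meval_whomog (k : fieldType) (n : nat) (a : 'I_n.+1 -> nat)
    (p : {mpoly k[n.+1]}) (d : nat) (t : k) (x : 'I_n.+1 -> k) :
  whomog (aw a) d%:Z p -> p.@[fun i => t ^+ a i * x i] = t ^+ d * p.@[x].
Proof.
move=> /whomogP hp; rewrite !mevalE mulr_sumr !big_seq; apply: eq_bigr => m mp.
rewrite mulrCA; congr (_ * _).
under eq_bigr => i _ do rewrite exprMn -exprM.
rewrite big_split /=; congr (_ * _); rewrite -expr_sum; congr (_ ^+ _).
by apply/eqP; rewrite -eqz_nat; have := hp _ mp; rewrite -adegE => ->.
Qed.

(** On the points [(t, 1, 0, ..., 0)] the polynomial has a root unless it is a nonzero constant [c].
    In that case homogeneity gives it the value [c t ^ d] at [(1, t ^ a_1, 0, ..., 0)], which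
    vanishes for [t = 0]. *)
Lemma whomog_zero (k : closedFieldType) (n : nat) (a : 'I_n.+1 -> nat)
    (p : {mpoly k[n.+1]}) (d : nat) : (0 < n)%N -> (forall i, (0 < a i)%N) ->
  (0 < d)%N -> whomog (aw a) d%:Z p ->
  exists2 x, (exists i, x i != 0) & p.@[x] = 0.
Proof.
case: n a p => // n a p _ a_gt0 d_gt0 hp.
pose i1 : 'I_n.+2 := lift ord0 ord0.
pose h (i : 'I_n.+2) : {poly k} := if i == ord0 then 'X else (i == i1)%:R.
pose x1 (t : k) (i : 'I_n.+2) : k := if i == ord0 then t else (i == i1)%:R.
have hE t : (mmap polyC h p).[t] = p.@[x1 t].
  rewrite horner_mmap; apply: meval_eq => i; rewrite /h /x1.
  by case: (i == ord0); rewrite ?hornerX //; case: (i == i1);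
    rewrite -?[1]/(1%:P) ?hornerC ?horner0.
have [s1|/eqP s1] := boolP (size (mmap polyC h p) == 1%N); last first.
  have /closed_rootP[t /rootP] : size (mmap polyC h p) != 1%N by apply/eqP.
  by rewrite hE => z; exists (x1 t) => //; exists i1; rewrite /x1 /= oner_neq0.
have /size_poly1P[c c0 hc] := s1.
have pc t : p.@[x1 t] = c by rewrite -hE hc hornerC.
pose g (i : 'I_n.+2) : {poly k} :=
  if i == ord0 then 1 else if i == i1 then 'X ^+ a i1 else 0.
have gE t : (mmap polyC g p).[t] =
    p.@[fun i => if i == ord0 then 1 else if i == i1 then t ^+ a i1 else 0].
  rewrite horner_mmap; apply: meval_eq => i; rewrite /g.
  by case: (i == ord0); last case: (i == i1);
    rewrite ?hornerXn ?horner0 // -[1]/(1%:P) hornerC.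
have G : mmap polyC g p - c *: 'X ^+ d = 0.
  apply: closed_poly_eq0 => t t0; rewrite hornerD hornerN hornerZ hornerXn gE.
  rewrite -(pc (t ^- a ord0)) mulrC -(meval_whomog t _ hp).
  rewrite -[X in _ - X](meval_eq (v1 :=
    fun i => if i == ord0 then 1 else if i == i1 then t ^+ a i1 else 0)).
    by rewrite subrr.
  move=> i; rewrite /x1; have [->|_] := eqVneq i ord0.
    by rewrite mulfV // expf_neq0.
  by have [->|_] := eqVneq i i1; rewrite ?mulr1 ?mulr0.
exists (fun i => if i == ord0 then 1 else if i == i1 then 0 ^+ a i1 else 0).
  by exists ord0; rewrite eqxx oner_neq0.
rewrite -gE; move/eqP: G; rewrite subr_eq0 => /eqP ->.
by rewrite hornerZ hornerXn expr0n -[d == 0%N]negbK -lt0n d_gt0 mulr0.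
Qed.

Section MpolyX.
Variables (k : fieldType) (N : nat).
Local Notation S := {mpoly k[N]}.

Lemma word_delta_divides (i : 'I_N) (p : S) : p != 0 ->
  0 < word (delta i) p <-> divides 'X_i p.
Proof.
move=> p0; split=> [h|[q qE]]; last first.
  have q0 : q != 0 by apply: contra_neq p0 => q0; rewrite qE q0 mul0r.
  rewrite qE (word_order k (delta i)).1 ?mpolyXi_neq0 // wordX wdegU {2}/delta.
  rewrite eqxx ltr_wpDl // word_ge0 // => j; exact: ler0n.
exists (\sum_(m <- msupp p) p@_m *: 'X_[m - U_(i)]).
rewrite {1}(mpolyE p) mulr_suml !big_seq; apply: eq_bigr => m mp.
rewrite -scalerAl -mpolyXD submK //; apply/mnm_lepP => j; rewrite mnm1E.
have [<-|//] := eqVneq i j.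
have := lt_le_trans h (word_le (delta i) mp).
by rewrite wdeg_dot dotC dot_delta.
Qed.

Lemma prime_mpolyX (i : 'I_N) : prime_elt ('X_i : S).
Proof.
split; [exact: mpolyXi_neq0 | exact: mpolyX_unit | move=> x y].
have [->|x0] := eqVneq x 0; first by move=> _; left; exists 0; rewrite mul0r.
have [->|y0] := eqVneq y 0; first by move=> _; right; exists 0; rewrite mul0r.
move=> /(word_delta_divides _ (mulf_neq0 x0 y0)); rewrite (word_order k _).1 //.
have d0 (j : 'I_N) : 0 <= delta i j by exact: ler0n.
have wx := word_ge0 x0 d0; have wy := word_ge0 y0 d0.
have [h _|h] := ltP 0 (word (delta i) x).
  by left; apply/(word_delta_divides _ x0).
have -> : word (delta i) x = 0 by apply/eqP; rewrite eq_le h wx.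
by rewrite add0r => h'; right; apply/(word_delta_divides _ y0).
Qed.

End MpolyX.

Section GradedField.
Variables (k : fieldType) (n : nat) (a : 'I_n.+1 -> nat).
Variables (K : fieldType) (iota : {rmorphism k -> K}).
Variable emb : {rmorphism K -> {fraction {mpoly k[n.+1]}}}.
Hypothesis hK : degree0_field a iota emb.
Hypothesis a_gt0 : forall i, (0 < a i)%N.
Local Notation S := {mpoly k[n.+1]}.
Local Notation aw := (aw a).

(* An order function on polynomials whose positive elements are the multiples
   of a homogeneous [pi] gives a prime divisor through any zero of [pi]: in
   r/s = (r s^(a_i - 1) / x_i^e) / (s^(a_i) / x_i^e) both terms are regular at
   the zero as soon as its i-th coordinate is not 0. *)
Lemma prime_divisor_of_order (o : S -> int) (pi : S) c x i0 :
  order_fun o -> (forall p, p != 0 -> 0 <= o p) ->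
  (forall p, p != 0 -> 0 < o p -> divides pi p) -> o pi = 1 -> pi != 0 ->
  whomog aw c pi -> pi.@[x] = 0 -> x i0 != 0 ->
  is_dval iota (fun f => frac_order o (emb f)) ->
  prime_divisor_at iota (local_ring_at emb x) (fun f => frac_order o (emb f)).
Proof.
move=> oo o_ge0 o_div o1 pi0 hpi pix xi0 hv.
have reg q : q.@[x] != 0 -> o q = 0.
  move=> qx; have q0 : q != 0 by apply: contra_neq qx => ->; rewrite meval0.
  apply/eqP; rewrite eq_le o_ge0 // andbT leNgt; apply/negP.
  move/(o_div _ q0) => [r rE]; case/negP: qx; apply/eqP.
  by rewrite rE mevalM pix mulr0.
have oX p e : p != 0 -> o (p ^+ e) = o p * e%:Z.
  move=> p0; elim: e => [|e IH].
    by rewrite reg ?mulr0 // expr0 meval1 oner_neq0.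
  by rewrite exprS oo.1 ?expf_neq0 // IH -add1n PoszD mulrDr mulr1.
have split e p : p != 0 -> e%:Z <= o p ->
    exists2 q, p = pi ^+ e * q & o p = e%:Z + o q.
  elim: e p => [|e IH] p p0 h; first by exists p; rewrite ?mul1r ?add0r.
  have [|q qE] := o_div p p0; first by apply: lt_le_trans h.
  have q0 : q != 0 by apply: contra_neq p0 => q0; rewrite qE q0 mul0r.
  have oq : o p = o q + 1 by rewrite qE oo.1 // o1.
  have [|r rE er] := IH q q0; first by move: h; rewrite oq -addn1 PoszD lerD2r.
  exists r; first by rewrite qE rE exprSr mulrAC.
  by rewrite oq er -addn1 PoszD addrAC.
split=> // [f|z].
  move=> [p [q [qx fE]]]; have [->|f0] := eqVneq f 0; first by left.
  right; have q0 : q != 0 by apply: contra_neq qx => ->; rewrite meval0.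
  have p0 : p != 0.
    by apply: contra_neq f0 => p0; apply: (emb_inj (emb := emb));
       rewrite fE p0 rmorph0 mul0r rmorph0.
  by rewrite fE frac_orderE // (reg q) // subr0 o_ge0.
have [-> _|z0] := eqVneq z 0.
  exists 0, 1; rewrite mul0r oner_neq0; split=> //.
  - by exists 0, 1; rewrite meval1 oner_neq0 !rmorph0 mul0r.
  - by exists 1, 1; rewrite meval1 oner_neq0 !rmorph1 divr1.
  - exact: (dval1 hv).
case=> [/eqP|]; first by rewrite (negbTE z0).
have [r [s [d [s0 hr hs zE]]]] := deg0_homog hK z.
have r0 : r != 0.
  by apply: contra_neq z0 => r0; apply: (emb_inj (emb := emb));
     rewrite zE r0 rmorph0 mul0r rmorph0.
rewrite zE frac_orderE // subr_ge0 => ors.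
have [e eE] : exists e : nat, o s = e%:Z.
  by exists `|o s|%N; rewrite gez0_abs // o_ge0.
have [|r1 r1E or1] := split e r r0; first by rewrite -eE.
have [|s1 s1E os1] := split e s s0; first by rewrite eE.
have {os1} os1 : o s1 = 0 by move: os1; rewrite eE -[LHS]addr0 => /addrI.
have s10 : s1 != 0 by apply: contra_neq s0 => s10; rewrite s1E s10 mulr0.
have r10 : r1 != 0 by apply: contra_neq r0 => r10; rewrite r1E r10 mulr0.
have pe0 : pi ^+ e != 0 by rewrite expf_neq0.
have zE1 : emb z = r1%:F / s1%:F.
  rewrite zE r1E s1E !tofracM invfM mulrACA mulfV ?mul1r //.
  by rewrite tofrac_eq0.
have hpe : whomog aw (c * e%:Z) (pi ^+ e) by exact: whomogXn.
have hs1 : whomog aw (d - c * e%:Z) s1.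
  by apply: (whomog_degM pe0 s10) hpe; rewrite -s1E.
have hr1 : whomog aw (d - c * e%:Z) r1.
  by apply: (whomog_degM pe0 r10) hpe; rewrite -r1E.
have [m0 m0s] : exists m0, m0 \in msupp s1.
  by have [m0 m0s _] := word_attained aw s10; exists m0.
have dE : d - c * e%:Z = (adeg a m0)%:Z.
  by rewrite adegE; move/whomogP: hs1 => ->.
set d1 := adeg a m0 in dE; rewrite {}dE in hs1 hr1.
have ai := a_gt0 i0; pose A := r1 * s1 ^+ (a i0).-1; pose B := s1 ^+ a i0.
have hB : whomog aw (d1%:Z * (a i0)%:Z) B by exact: whomogXn.
have hA : whomog aw (d1%:Z * (a i0)%:Z) A.
  have -> : d1%:Z * (a i0)%:Z = d1%:Z + d1%:Z * (a i0).-1%:Z.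
    by rewrite -{1}(prednK ai) -add1n PoszD mulrDr mulr1.
  by apply: whomogM => //; apply: whomogXn.
have hX : whomog aw (d1%:Z * (a i0)%:Z) ('X_i0 ^+ d1 : S).
  rewrite mulrC -[(a i0)%:Z]/(aw i0) -(wdegU aw i0).
  by apply: whomogXn; apply: whomogX.
have X0 : 'X_i0 ^+ d1 != 0 :> S by rewrite expf_neq0 // mpolyXi_neq0.
have Xx : ('X_i0 ^+ d1 : S).@[x] != 0 by rewrite rmorphXn /= mevalXU expf_neq0.
have [_ lift _] := hK.
have [al alE] := lift _ _ _ X0 hA hX; have [be beE] := lift _ _ _ X0 hB hX.
have B0 : B != 0 by rewrite expf_neq0.
have be0 : be != 0.
  by rewrite -(fmorph_eq0 emb) beE mulf_neq0 ?invr_eq0 ?tofrac_eq0.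
exists al, be; split=> //.
- by exists A, ('X_i0 ^+ d1).
- by exists B, ('X_i0 ^+ d1).
- by rewrite beE frac_orderE // (reg _ Xx) subr0 /B (oX _ _ s10) os1 mul0r.
apply: (emb_inj (emb := emb)); rewrite fmorph_div /= alE beE zE1.
rewrite invf_div mulrA divfK ?tofrac_eq0 // /A /B.
have -> : s1 ^+ a i0 = s1 * s1 ^+ (a i0).-1 by rewrite -exprS prednK.
by rewrite !tofracM -mulf_div divff ?mulr1 // tofrac_eq0 expf_neq0.
Qed.

End GradedField.

Section DegreeModulo.
Variables (k : fieldType) (n : nat) (a : 'I_n.+1 -> nat).
Local Notation S := {mpoly k[n.+1]}.
Local Notation aw := (aw a).
Variable M : int.

Definition nontoric (pi : S) : Prop :=
  prime_elt pi /\ forall i, ~ divides pi 'X_i.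

Lemma prime_divides_sym (R : idomainType) (p q : R) :
  prime_elt p -> prime_elt q -> divides p q -> divides q p.
Proof.
move=> [p0 pu pp] [q0 qu qp] [c qE].
case: (qp c p) => [||//]; first by exists 1; rewrite -qE mul1r.
move=> [d dE]; case/negP: pu; apply/unitrPr; exists d.
by apply: (mulIf q0); rewrite mul1r [RHS]qE [in RHS]dE; ring.
Qed.

Lemma divides_trans (R : idomainType) (p q r : R) :
  divides p q -> divides q r -> divides p r.
Proof. by move=> [c ->] [d ->]; exists (d * c); rewrite mulrA. Qed.

(* The degree of a homogeneous polynomial is determined modulo [M] by its
   orders modulo [M] along all homogeneous primes. *)
Lemma degree_mod (P : S) (d : int) (c : 'I_n.+1 -> int) : P != 0 ->
  whomog aw d P ->
  (forall i, (M %| word (delta i) P - c i)%Z) ->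
  (forall pi e, nontoric pi -> whomog aw e pi -> (M %| (ordp pi P)%:Z)%Z) ->
  (M %| d - dot aw c)%Z.
Proof.
have [N] := ubnP (msize P); elim: N P d c => // N IH P d c PN P0 hP hc hpi.
have [m [u [s [uu sm sp PE]]]] := factorial_mpoly P0.
case: s sm sp PE => [|pi s] sm sp PE.
  move: PE; rewrite big_nil mulr1 => PE.
  have /msize_poly1P[z z0 uE] : msize u == 1%N by rewrite -mpoly_unitE.
  have PC : P = z%:MP by rewrite PE uE.
  have mP : (0%MM : 'X_{1..n.+1}) \in msupp P by rewrite PC msuppC (negbTE z0) inE.
  have -> : d = 0 by move/whomogP: hP => /(_ _ mP); rewrite wdeg0 => ->.
  rewrite sub0r dvdzE abszN -dvdzE; apply: rpred_sum => i _.
  by have := hc i; rewrite PC wordC // sub0r dvdzE abszN -dvdzE => h; apply: dvdz_mull.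
have pp : prime_elt pi by apply: sp; rewrite mem_head.
have pi0 := prime_neq0 pp.
have piP : divides pi P.
  by exists (u * \prod_(q <- s) q); rewrite PE big_cons /=; ring.
have hom_fac e p q : P = p ^+ e * q -> p != 0 -> q != 0 -> (0 < e)%N ->
    exists2 c', whomog aw c' p & whomog aw (d - c' * e%:Z) q.
  move=> pqE p0 q0 e0; have [c' hp] : exists c', whomog aw c' p.
    apply: (@whomog_factor _ _ _ p (p ^+ e.-1 * q)) => //.
      by rewrite mulf_neq0 ?expf_neq0.
    by exists d; rewrite mulrA -exprS prednK // -pqE.
  exists c' => //; apply: (@whomog_degM _ _ _ _ _ (p ^+ e)) => //.
  - by rewrite expf_neq0.
  - by rewrite -pqE.
  - exact: whomogXn.
have msz e q : P = pi ^+ e * q -> q != 0 -> (0 < e)%N -> (msize q < N)%N.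
  move=> qE q0 e0.
  have : msize P = (msize (pi ^+ e) + msize q).-1.
    by rewrite qE msizeM // expf_neq0.
  have : (1 < msize (pi ^+ e))%N.
    have n0 : pi ^+ e.-1 != 0 by rewrite expf_neq0.
    rewrite -(prednK e0) exprS msizeM //.
    have := prime_msize pp; have := msize_gt0 n0.
    by move: (msize pi) (msize (pi ^+ e.-1)) => x y; lia.
  move: (msize_gt0 q0) PN; clear.
  by move: (msize P) (msize (pi ^+ e)) (msize q) => x y z; lia.
(* A prime dividing ['X_i] is associate to it. Dividing [P] by ['X_i] lowers [d] and [dot aw c]
   alike by [a i]. *)
have [[i pii]|ntor] := pselect (exists i, divides pi 'X_i).
  have Xi := prime_mpolyX k i.
  have [Q QE] : divides 'X_i P.
    exact: divides_trans (prime_divides_sym pp Xi pii) piP.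
  have Q0 : Q != 0 by apply: contra_neq P0 => Q0; rewrite QE Q0 mul0r.
  have X0 : 'X_i != 0 :> S by exact: mpolyXi_neq0.
  have hX : whomog aw (aw i) ('X_i : S) by rewrite -(wdegU aw i); exact: whomogX.
  have := IH Q (d - aw i) (fun l => c l - delta i l).
  rewrite dotBr [dot _ (delta i)]dot_delta.
  rewrite (_ : d - aw i - (dot aw c - aw i) = d - dot aw c); last by ring.
  apply=> //.
  - have := msizeM Q0 X0; rewrite -QE msizeX mdeg1.
    move: (msize_gt0 Q0) PN; clear.
    by move: (msize P) (msize Q) => x y; lia.
  - by apply: (whomog_degM X0 Q0) hX; rewrite mulrC -QE.
  - move=> l; have := hc l; rewrite QE (word_order k (delta l)).1 //.
    rewrite wordX wdegU {2}/delta eq_sym -/(delta i l).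
    by rewrite opprB addrA.
  - move=> pi' e [p1 p2] hpi'; have := hpi _ _ (conj p1 p2) hpi'.
    by rewrite QE ordpM // (ordp0 p1 X0 (p2 i)) addn0.
have ntor' : nontoric pi by split=> // i h; apply: ntor; exists i.
(* Dividing by the full power of [pi], whose exponent is a multiple of [M], changes the degree by a
   multiple of [M] and leaves the orders along non-associate primes unchanged. *)
have [Q QE piQ] := ordp_split pp P0.
have e0 : (0 < ordp pi P)%N by apply/(ordp_gt0 pp P0).
set e := ordp pi P in QE e0.
have Q0 : Q != 0 by apply: contra_neq P0 => Q0; rewrite QE Q0 mulr0.
have [c' hp hQ] := hom_fac e pi Q QE pi0 Q0 e0.
have Me : (M %| e%:Z)%Z by exact: hpi hp.
have := IH Q _ c (msz e Q QE Q0 e0) Q0 hQ.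
have wpi i : word (delta i) pi = 0.
  apply/eqP; rewrite eq_le (word_ge0 pi0) ?andbT; last first.
    by move=> l; exact: ler0n.
  rewrite leNgt; apply/negP => /(word_delta_divides _ pi0) h.
  by have [_ /(_ i)] := ntor'; apply; apply: prime_divides_sym h => //; exact: prime_mpolyX.
have pe0 : pi ^+ e != 0 by rewrite expf_neq0.
have wE i : word (delta i) P = word (delta i) Q.
  rewrite QE (word_order k _).1 //; suff -> : word (delta i) (pi ^+ e) = 0 by rewrite add0r.
  elim: (e) => [|e' IHe]; last first.
    by rewrite exprS (word_order k _).1 ?expf_neq0 // IHe wpi.
  by rewrite expr0 -mpolyC1 wordC ?oner_neq0.
have h1 i : (M %| word (delta i) Q - c i)%Z by rewrite -wE.
move=> /(_ h1) h2.
have : (M %| d - c' * e%:Z - dot aw c)%Z.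
  apply: h2 => pi' e' nt' hpi'; have [p1 _] := nt'.
  have [pq|pq] := pselect (divides pi' pi).
    rewrite (ordp0 p1 Q0) ?dvdz0 // => h; apply: piQ.
    exact: divides_trans (prime_divides_sym p1 pp pq) h.
  have := hpi _ _ nt' hpi'.
  by rewrite QE ordpM // ordpX // (ordp0 p1 pi0 pq) muln0 add0n.
move=> h; have -> : d - dot aw c = d - c' * e%:Z - dot aw c + c' * e%:Z by ring.
by rewrite rpredD // dvdz_mull.
Qed.

End DegreeModulo.

Section Index.
Variables (k : closedFieldType) (n : nat) (a : 'I_n.+1 -> nat).
Variables (K : fieldType) (iota : {rmorphism k -> K}).
Variable emb : {rmorphism K -> {fraction {mpoly k[n.+1]}}}.
Hypothesis char0 : [pchar k] =i pred0.
Hypothesis hK : degree0_field a iota emb.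
Hypothesis n_gt0 : (0 < n)%N.
Hypothesis a_gt0 : forall i, (0 < a i)%N.
Hypothesis wf : well_formed a.
Local Notation S := {mpoly k[n.+1]}.
Local Notation aw := (aw a).
Local Notation D := (log_frame emb).
Local Notation kval := (kval emb).
Local Notation X := (points_model emb).

Lemma toric_prime_divisor i : prime_divisor iota X (kval (delta i)).
Proof.
have [l li] : exists l, l != i.
  have [->|i0] := eqVneq i ord0; last by exists ord0; rewrite eq_sym.
  by exists ord_max; rewrite -val_eqE /= -lt0n.
exists (local_ring_at emb (vertex k l)).
  by exists (vertex k l) => //; exists l; exact: vertex_neq0.
apply: (prime_divisor_of_order hK a_gt0 (pi := 'X_i) (c := aw i) (i0 := l)).
- exact: word_order.
- by move=> p p0; apply: word_ge0 => // j; exact: ler0n.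
- by move=> p p0 /(word_delta_divides _ p0).
- by rewrite wordX wdegU /delta eqxx.
- exact: mpolyXi_neq0.
- by rewrite -(wdegU aw i); exact: whomogX.
- by rewrite mevalXU /vertex eq_sym (negbTE li).
- exact: vertex_neq0.
- exact: (kval_dval hK (well_formed_delta n_gt0 a_gt0 wf i)).
Qed.

(** A homogeneous prime has positive degree, hence a zero outside the origin, through which its
    order function is a prime divisor. Monomials have order 0, so [form_order_horizontal]
    applies. *)
Lemma nontoric_prime_divisor (pi : S) c : nontoric pi -> whomog aw c pi ->
  let v f := frac_order (fun p => (ordp pi p)%:Z) (emb f) in
  prime_divisor iota X v /\ form_order D v = 0.
Proof.
move=> [pp nt] hpi v; have pi0 := prime_neq0 pp.
have [m mpi _] := word_attained aw pi0.
have cE : c = (adeg a m)%:Z by rewrite adegE; move/whomogP: hpi => ->.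
have d0 : (0 < adeg a m)%N.
  rewrite lt0n; apply/eqP => d0; rewrite d0 in cE.
  have [_ pu _] := pp; case/negP: pu; rewrite mpoly_unitE.
  rewrite eqn_leq (msize_gt0 pi0) andbT msizeE.
  apply/bigmax_leqP_seq => m' m'pi _; rewrite ltnS leqn0 mdeg_eq0; apply/eqP/mnmP => i; rewrite mnm0E.
  have := whomogP _ _ _ hpi m' m'pi; rewrite cE -adegE => -[].
  move=> /eqP; rewrite /adeg sum_nat_eq0 => /forallP/(_ i).
  by rewrite muln_eq0 eqn0Ngt a_gt0 => /eqP.
rewrite cE in hpi.
have [x [i0 xi0] pix] := whomog_zero n_gt0 a_gt0 d0 hpi.
have oo := ordp_order pp.
have vE f p q : p != 0 -> q != 0 -> emb f = p%:F / q%:F ->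
    v f = (ordp pi p)%:Z - (ordp pi q)%:Z.
  by move=> p0 q0 fE; rewrite /v fE frac_orderE.
have oX (m' : 'X_{1..n.+1}) : ordp pi ('X_[m'] : S) = 0%N.
  apply: ordp0 => //; first exact: mpolyX_neq0.
  rewrite mpolyXE_id; have [_ _ pm] := pp.
  elim: (index_enum _) => [|i s IH].
    by rewrite big_nil => /divides_unit; rewrite unitr1 => /(_ isT);
      have [_ /negP] := pp.
  rewrite big_cons => /pm[|//]; elim: (m' i) => [|e IHe].
    by rewrite expr0 => /divides_unit; rewrite unitr1 => /(_ isT);
      have [_ /negP] := pp.
  by rewrite exprS => /pm[/nt|].
have vmono u : dot aw u = 0 -> v (kmono emb u) = 0.
  move=> u0; rewrite (vE _ 'X_[posm u] 'X_[posm (fun i => - u i)]) ?mpolyX_neq0 //.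
    by rewrite !oX.
  by rewrite (emb_kmono hK) // lmono_frac.
have [b _ hb] := well_formed_bezout n_gt0 a_gt0 wf ord0.
have hv : is_dval iota v.
  split.
  - by rewrite /v rmorph0 frac_order0.
  - by move=> f g f0 g0; rewrite /v rmorphM frac_orderM ?fmorph_eq0.
  - move=> f g f0 g0 fg0; rewrite /v rmorphD frac_orderD ?fmorph_eq0 //.
    by rewrite -rmorphD fmorph_eq0.
  - exists (kpoly iota emb b pi (adeg a m)%:Z).
    set u := fun i => - ((adeg a m)%:Z * b i).
    rewrite (vE _ (pi * 'X_[posm u]) 'X_[posm (fun i => - u i)]).
    + by rewrite ordpM ?mpolyX_neq0 // !oX (ordp_self pp).
    + by rewrite mulf_neq0 // mpolyX_neq0.
    + exact: mpolyX_neq0.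
    + by rewrite (emb_kpoly hK hb) // lmono_frac mulrA -tofracM.
  - move=> z; have [->|z0] := eqVneq z 0; first by rewrite /v !rmorph0 frac_order0.
    have zP0 : z%:MP_[n.+1] != 0 by rewrite mpolyC_eq0.
    have notdiv (w : k) : w != 0 -> ~ divides pi w%:MP.
      move=> w0 /divides_unit h; have [_ /negP pu _] := pp; apply: pu; apply: h.
      by rewrite mpoly_unitE msizeC w0.
    rewrite (vE _ z%:MP 1%:MP) ?mpolyC_eq0 ?oner_neq0 //.
      by rewrite !(ordp0 pp) ?mpolyC_eq0 ?oner_neq0 //; apply: notdiv; rewrite ?oner_neq0.
    by rewrite (emb_iota hK) mpolyC1 tofrac1 divr1.
have pd : prime_divisor_at iota (local_ring_at emb x) v.
  apply: (prime_divisor_of_order hK a_gt0 (pi := pi) (i0 := i0)) hpi _ _ _ => //.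
  - by move=> p p0; rewrite ltz_nat => /(ordp_gt0 pp p0).
  - by rewrite (ordp_self pp).
split; last exact: (form_order_horizontal char0 hK a_gt0 pd vmono).
by exists (local_ring_at emb x) => //; exists x => //; exists i0.
Qed.

(** If [m (- K_X - q A)] is the divisor of [f], the orders of [f] modulo [m q] are [m] along the
    coordinate hyperplanes and 0 along the other homogeneous primes. As [f] has degree 0,
    [degree_mod] shows that [m q] divides [m] times the sum of the weights. *)
Theorem fano_index_dvd q : (0 < q)%N -> divides_anticanonical iota n X q -> (q %| wsum a)%N.
Proof.
move=> q_gt0 /(_ _ (log_frameP char0 hK n_gt0 a_gt0 wf))[A _ [m m0 [f f0 hf]]].
have [P [Q [d [Q0 hP hQ fE]]]] := deg0_homog hK f.
have P0 : P != 0.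
  by apply: contra_neq f0 => P0; apply: (emb_inj (emb := emb));
     rewrite fE P0 rmorph0 mul0r rmorph0.
pose M := m%:Z * q%:Z.
have Mv v g : m%:Z * (- form_order D v - q%:Z * A v) = g ->
    (M %| g + m%:Z * form_order D v)%Z.
  move=> <-; rewrite (_ : _ + _ = - A v * M); first exact: dvdz_mull.
  by rewrite /M; move: (form_order D v) => z; ring.
(* [P Q^(M-1)] has the same orders as [P / Q] modulo [M]. *)
pose R := P * Q ^+ (`|M|.-1)%N.
have R0 : R != 0 by rewrite mulf_neq0 ?expf_neq0.
have M_gt0 : (0 < `|M|)%N by rewrite /M abszM muln_gt0 m0.
have oR (o : S -> int) : order_fun o -> (M %| o R - (o P - o Q))%Z.
  move=> oo.
  have o1 : o 1 = 0.
    by have := oo.1 1 1 (oner_neq0 _) (oner_neq0 _); rewrite mulr1 -[LHS]addr0 => /addrI <-.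
  have oX e : o (Q ^+ e) = o Q * e%:Z.
    elim: e => [|e IH]; first by rewrite expr0 o1 mulr0.
    by rewrite exprS oo.1 ?expf_neq0 // IH -add1n PoszD mulrDr mulr1.
  rewrite /R oo.1 ?expf_neq0 // oX.
  have -> : o P + o Q * (`|M|.-1)%:Z - (o P - o Q) = o Q * `|M|%N%:Z.
    by rewrite -[in RHS](prednK M_gt0) -add1n PoszD; ring.
  by apply: dvdz_mull; rewrite dvdzE.
have hR : whomog aw (d + d * (`|M|.-1)%:Z) R by apply: whomogM => //; apply: whomogXn.
have := @degree_mod _ _ a M R _ (fun=> m%:Z) R0 hR.
rewrite (_ : dot aw _ = m%:Z * (wsum a)%:Z); last first.
  by rewrite dotC /dot -mulr_sumr dot_1_aw.
have -> : d + d * (`|M|.-1)%:Z = d * `|M|%N%:Z.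
  by rewrite -[in RHS](prednK M_gt0) -add1n PoszD; ring.
move=> H; have {H} : (M %| d * `|M|%N%:Z - m%:Z * (wsum a)%:Z)%Z.
  apply: H => [i|pi e nt hpi].
    have := Mv _ _ (hf _ (toric_prime_divisor i)).
    rewrite (form_order_kval char0 hK a_gt0 (well_formed_delta n_gt0 a_gt0 wf i)).
    rewrite (kval_frac _ P0 Q0 fE) mulrN1 => h.
    have := rpredD h (oR _ (word_order k (delta i))).
    by congr (_ %| _)%Z; ring.
  have [pd fo] := nontoric_prime_divisor nt hpi.
  have := Mv _ _ (hf _ pd); rewrite fo mulr0 addr0.
  have oo := ordp_order nt.1.
  rewrite fE frac_orderE // => h; have := rpredD h (oR _ oo).
  by congr (_ %| _)%Z; ring.
move=> h; have : (M %| m%:Z * (wsum a)%:Z)%Z.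
  have h2 : (M %| d * `|M|%N%:Z)%Z by apply: dvdz_mull; rewrite dvdzE.
  by have := rpredB h2 h; rewrite opprB addrC subrK.
by rewrite dvdzE /M !abszM /= dvdn_pmul2l.
Qed.

End Index.

(** * Bounds from the box principle *)

Lemma card_box (I : finType) (h : nat) (b : I -> nat) : (forall i, b i <= h)%N ->
  #|family (fun i => [pred y : 'I_h | (y < b i)%N])| = (\prod_i b i)%N.
Proof.
move=> bh; rewrite card_family foldrE big_map enumT; apply: eq_bigr => i _.
have wi : injective (widen_ord (bh i)).
  by move=> y z /(congr1 val) e; apply: val_inj.
rewrite -[RHS](card_ord (b i)) -(card_imset _ wi).
apply: eq_card => y; rewrite inE; apply/idP/imsetP => [yb|[z _ ->]].
  by exists (Ordinal yb) => //; apply: val_inj.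
exact: (ltn_ord z).
Qed.

(** A side of length 1 switches a coordinate off, so boxes of different dimensions share one index
    type. *)
Lemma box_pigeonhole (I : finType) (b b' : I -> nat) (F : (I -> nat) -> I -> nat) :
  (forall y i, (forall i, y i < b i)%N -> (F y i < b' i)%N) ->
  (\prod_i b' i < \prod_i b i)%N ->
  exists y y', [/\ forall i, (y i < b i)%N, forall i, (y' i < b i)%N,
    exists i, y i <> y' i & forall i, F y i = F y' i].
Proof.
move=> Fb lt; pose h := (\max_i maxn (b i) (b' i)).+1.
have hi i : (maxn (b i) (b' i) <= h)%N.
  by apply: leqW; apply: (leq_bigmax (F := fun i => maxn (b i) (b' i))).
have bh i : (b i <= h)%N by have := hi i; rewrite geq_max => /andP[].
have bh' i : (b' i <= h)%N by have := hi i; rewrite geq_max => /andP[].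
pose B := family (fun i => [pred y : 'I_h | (y < b i)%N]).
pose B' := family (fun i => [pred y : 'I_h | (y < b' i)%N]).
have inB (y : {ffun I -> 'I_h}) : y \in B -> forall i, (y i < b i)%N.
  by move=> /familyP yB i; have := yB i; rewrite inE.
pose G (y : {ffun I -> 'I_h}) : {ffun I -> 'I_h} :=
  [ffun i => inord (F (fun i => y i) i)].
have GE y i : y \in B -> G y i = F (fun i => y i) i :> nat.
  move=> yB; rewrite ffunE inordK //.
  by apply: leq_trans (bh' i); apply: Fb; exact: inB.
have : ~~ dinjectiveb G B.
  apply/negP => /dinjectiveP inj; have := card_in_imset inj.
  suff : (#|G @: B| <= #|B'|)%N by rewrite !card_box // => h1 h2; rewrite h2 leqNgt lt in h1.
  apply: subset_leq_card; apply/fintype.subsetP => z /imsetP[y yB ->].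
  by apply/familyP => i; rewrite inE GE //; apply: Fb; exact: inB.
move/dinjectivePn => [y yB [y' /andP[/= yy' y'B] e]].
exists (fun i => nat_of_ord (y i)), (fun i => nat_of_ord (y' i)); split; [exact: inB|exact: inB| |].
  apply: contrapT => h0; case/negP: yy'; apply/eqP/ffunP => i.
  by apply: val_inj; apply: contrapT => ne; apply: h0; exists i; exact: nesym.
by move=> i; rewrite -!GE // e.
Qed.

Section ProductBounds.
Variables (n : nat) (a : 'I_n.+1 -> nat).
Hypothesis a_gt0 : forall i, (0 < a i)%N.
Local Notation h := (wsum a).

(* The multiples of the barycentric coordinates [a / h] of the origin, reduced
   modulo 1, are never small unless they vanish. *)
Definition no_small_multiple : Prop :=
  forall (c : int) (x : 'I_n.+1 -> int),
    (forall i, exists z, x i = c * (a i)%:Z + h%:Z * z) -> \sum_i x i = 0 ->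
    (forall i, - (a i)%:Z < x i) -> forall i, x i = 0.

Lemma wsum_gt0 : (0 < h)%N.
Proof. by rewrite /wsum (bigD1 ord0) //= addn_gt0 a_gt0. Qed.

(** The vector [z] of integral parts is the lattice point: its coordinates sum to [- c], whence
    [bary a z = x]. *)
Lemma no_interior_small_multiple : (forall w, ~ interior_point a w) ->
  no_small_multiple.
Proof.
move=> hw c x hx sx xa i; have [z zE] := choice hx.
have hz : h%:Z != 0 by rewrite eqz_nat -lt0n wsum_gt0.
have sz : \sum_l z l = - c.
  move: sx; under eq_bigr => l _ do rewrite zE.
  rewrite big_split /= -!mulr_sumr -[\sum_i0 (a i0)%:Z]/(\sum_i0 aw a i0) dot_1_aw.
  rewrite mulrC -mulrDr => /eqP; rewrite mulf_eq0 (negbTE hz) addrC.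
  by rewrite addr_eq0 => /eqP.
have bE l : bary a z l = x l by rewrite /bary sz zE; ring.
apply: contrapT => /eqP xi; apply: (hw z); split=> [l|]; first by rewrite bE.
by exists i; rewrite bE.
Qed.

Hypothesis nsm : no_small_multiple.
Variable bz : 'I_n.+1 -> int.
Hypothesis hbz : dot (aw a) bz = 1.

Lemma modn_eq_intP (u v : nat) : (u %% h = v %% h)%N ->
  exists z, u%:Z - v%:Z = h%:Z * z.
Proof.
move=> e; exists ((u %/ h)%N%:Z - (v %/ h)%N%:Z).
rewrite {1}(divn_eq u h) {1}(divn_eq v h) e !PoszD !PoszM; ring.
Qed.

Lemma dvd_all_weights (c : int) : `|c| < h%:Z ->
  (forall i, exists z, c * (a i)%:Z = h%:Z * z) -> c = 0.
Proof.
move=> ch hc; have [z zE] := choice hc.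
have cE : c = h%:Z * \sum_i z i * bz i.
  rewrite -[LHS]mulr1 -hbz /dot !mulr_sumr; apply: eq_bigr => i _.
  by rewrite mulrA -/(aw a i) /aw zE mulrA.
move: cE ch; move: (\sum_i z i * bz i) => t ->.
have hz : 0 < h%:Z by rewrite ltz_nat wsum_gt0.
rewrite normrM (gtr0_norm hz) gtr_pMr // => t1.
by rewrite (_ : t = 0) ?mulr0 //; lia.
Qed.

Lemma wsumD1 i0 : (\sum_(i | i != i0) (a i)%:Z) = h%:Z - (a i0)%:Z.
Proof. by rewrite -dot_1_aw [in RHS](bigD1 i0) //= addrAC subrr add0r. Qed.

(** In the box, [y i0 < h] is a multiplier and the other [y i < a i] are shifts; the map records the
    [n] residues of [y i0 * a i + y i] modulo [h]. A collision yields a multiple whose coordinates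
    other than [i0] are smaller than the weights. *)
Lemma prod_le_pow i0 : (h * \prod_(i | i != i0) a i <= h ^ n)%N.
Proof.
rewrite leqNgt; apply/negP => lt.
pose b i := if i == i0 then h else a i.
pose b' (i : 'I_n.+1) := if i == i0 then 1%N else h.
pose F (y : 'I_n.+1 -> nat) i :=
  if i == i0 then 0%N else ((y i0 * a i + y i) %% h)%N.
have bE : (\prod_i b i = h * \prod_(i | i != i0) a i)%N.
  rewrite (bigD1 i0) //= {1}/b eqxx; congr (_ * _)%N.
  by apply: eq_bigr => i /negbTE; rewrite /b => ->.
have b'E : (\prod_i b' i = h ^ n)%N.
  rewrite (bigD1 i0) //= {1}/b' eqxx mul1n.
  under eq_bigr => i /negbTE ii0 do rewrite /b' ii0.
  by rewrite prod_nat_const cardC1 card_ord.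
have [||y [y' [yb y'b [l yl] Fe]]] := @box_pigeonhole _ b b' F.
- by move=> y i _; rewrite /F /b'; case: eqP => // _; rewrite ltn_mod wsum_gt0.
- by rewrite bE b'E.
(* Exchanging the two points changes all signs, so the coordinate at [i0], which the box does not
   control, may be taken nonnegative. *)
wlog sle : y y' yb y'b yl Fe / \sum_(i | i != i0) ((y' i)%:Z - (y i)%:Z) <= 0.
  move=> H; have [sle|slt] := leP (\sum_(i | i != i0) ((y' i)%:Z - (y i)%:Z)) 0.
    exact: (H y y').
  apply: (H y' y) => // [e|]; first by apply: yl.
  rewrite -oppr_ge0 -sumrN; under eq_bigr => i _ do rewrite opprB.
  exact: ltW.
pose c := (y i0)%:Z - (y' i0)%:Z.
pose x i := if i == i0 then - \sum_(i | i != i0) ((y' i)%:Z - (y i)%:Z)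
  else (y' i)%:Z - (y i)%:Z.
have xz i : i != i0 -> exists z, x i = c * (a i)%:Z + h%:Z * z.
  move=> ii0; have := Fe i; rewrite /F (negbTE ii0) => /modn_eq_intP[z zE].
  exists (- z); rewrite /x (negbTE ii0) /c mulrN -zE !PoszD !PoszM; ring.
have xsum : \sum_i x i = 0.
  rewrite (bigD1 i0) //= {1}/x eqxx addrC; apply/eqP; rewrite subr_eq0; apply/eqP.
  by apply: eq_bigr => i /negbTE; rewrite /x => ->.
have x0 := nsm (c := c) (x := x).
have {}x0 : forall i, x i = 0.
  apply: x0 => // [i|i].
    have [->|ii0] := eqVneq i i0; last exact: xz.
    have zex j : exists z : int, j != i0 -> x j = c * (a j)%:Z + h%:Z * z.
      have [->|/xz[z zE]] := eqVneq j i0; first by exists 0.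
      by exists z.
    have [z zE] := choice zex.
    (* As the weights sum to [h] and the [x i] to 0, the congruence at [i0] follows from the
       others. *)
    exists (- c - \sum_(i | i != i0) z i).
    move: xsum; rewrite (bigD1 i0) //= (eq_bigr _ zE) big_split /= -!mulr_sumr wsumD1.
    by move/eqP; rewrite addr_eq0 => /eqP ->; ring.
  rewrite /x; have [->|ii0] := eqVneq i i0.
    by apply: lt_le_trans (_ : 0 <= _); rewrite ?oppr_lt0 ?ltz_nat ?oppr_ge0.
  have := yb i; rewrite /b (negbTE ii0); have := y'b i; move: (a i); clear.
  by move: (y i) (y' i) => u v w; lia.
have c0 : c = 0.
  apply: dvd_all_weights => [|i].
    have := yb i0; have := y'b i0; rewrite /b eqxx /c; clear.
    by move: (y i0) (y' i0) (wsum a) => u v w; lia.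
  have [->|ii0] := eqVneq i i0; last first.
    have [z zE] := xz i ii0; exists (- z); move: zE; rewrite x0 mulrN.
    by move/esym/eqP; rewrite addr_eq0 => /eqP.
  have zex j : exists z : int, j != i0 -> c * (a j)%:Z = h%:Z * z.
    have [->|/xz[z]] := eqVneq j i0; first by exists 0.
    rewrite x0 => /esym/eqP; rewrite addr_eq0 => /eqP zE; exists (- z) => _.
    by rewrite zE mulrN.
  have [z zE] := choice zex.
  exists (c - \sum_(i | i != i0) z i); rewrite mulrBr mulr_sumr.
  rewrite -(eq_bigr _ zE) -mulr_sumr wsumD1; ring.
have [li0|li0] := eqVneq l i0.
  by apply: yl; rewrite li0; move: c0; rewrite /c => /eqP; rewrite subr_eq0 => /eqP[].
by have := x0 l; rewrite /x (negbTE li0) => /eqP; rewrite subr_eq0 => /eqP[] /esym.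
Qed.

(* Pigeonhole on the box of the [a_i], i in [J]: the sum of the coordinates is
   recorded modulo the remaining weights, and its quotient is the multiplier. *)
Lemma prod_le_tail (J : {set 'I_n.+1}) i0 i2 : i0 \in J -> i2 \notin J ->
  (\prod_(i in J) a i <=
   (\sum_(i | i \notin J) a i) * \prod_(i in J | i != i0) h)%N.
Proof.
move=> i0J i2J; rewrite leqNgt; apply/negP => lt.
pose E := (\sum_(i | i \notin J) a i)%N.
have E0 : (0 < E)%N by rewrite /E (bigD1 i2) //= addn_gt0 a_gt0.
pose b i := if i \in J then a i else 1%N.
pose b' i := if i == i0 then E else if i \in J then h else 1%N.
pose s (y : 'I_n.+1 -> nat) := (\sum_(i in J) y i)%N.
pose F y i := if i == i0 then (s y %% E)%N else
  if i \in J then ((y i + s y %/ E * a i) %% h)%N else 0%N.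
have [||y [y' [yb y'b [l yl] Fe]]] := @box_pigeonhole _ b b' F.
- move=> y i _; rewrite /F /b'; case: eqP => _; first by rewrite ltn_mod.
  by case: ifP => // _; rewrite ltn_mod wsum_gt0.
- rewrite [X in (_ < X)%N](_ : _ = \prod_(i in J) a i)%N; last by rewrite [RHS]big_mkcond.
  rewrite (bigD1 i0) //= {1}/b' eqxx; apply: leq_ltn_trans lt.
  rewrite -/E leq_mul2l; apply/orP; right; apply: eq_leq.
  rewrite [RHS](eq_bigl (fun i => (i != i0) && (i \in J))) => [|i]; last by rewrite andbC.
  rewrite [RHS]big_mkcondr /=; apply: eq_bigr => i /negbTE; rewrite /b' => ->.
  by case: ifP.
pose tau y : int := (s y %/ E)%N%:Z.
(* Exchanging the points if necessary makes the coordinates [- t * a i] outside [J] nonnegative. *)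
wlog tle : y y' yb y'b yl Fe / tau y' - tau y <= 0.
  move=> H; have [tle|tlt] := leP (tau y' - tau y) 0; first exact: (H y y').
  by apply: (H y' y) => // [e|]; [apply: yl | rewrite -oppr_ge0 opprB ltW].
pose t := tau y' - tau y.
pose x i := if i \in J then (y' i)%:Z - (y i)%:Z else - t * (a i)%:Z.
have sE : \sum_(i in J) x i = E%:Z * t.
  have -> : \sum_(i in J) x i = (s y')%:Z - (s y)%:Z.
    rewrite /s -!natz !natr_sum -sumrB; apply: eq_bigr => i iJ.
    by rewrite /x iJ !natz.
  have := Fe i0; rewrite /F eqxx => e.
  rewrite (divn_eq (s y') E) (divn_eq (s y) E) e !PoszD !PoszM /t /tau; ring.
have xz i : i != i0 -> exists z, x i = - t * (a i)%:Z + h%:Z * z.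
  move=> ii0; rewrite /x; have [iJ|_] := boolP (i \in J); last first.
    by exists 0; rewrite mulr0 addr0.
  have := Fe i; rewrite /F (negbTE ii0) iJ => /modn_eq_intP[z zE]; exists (- z).
  rewrite mulrN -zE /t /tau !PoszD !PoszM; ring.
have xsum : \sum_i x i = 0.
  rewrite (bigID (fun i => i \in J)) /= sE.
  have -> : \sum_(i | i \notin J) x i = - t * E%:Z.
    rewrite /E -[(\sum_(i | _) a i)%N%:Z]natz natr_sum mulr_sumr.
    by apply: eq_bigr => i iJ; rewrite /x (negbTE iJ) natz.
  by ring.
have {xsum} x0 : forall i, x i = 0.
  apply: (nsm (c := - t)) => // [i|i].
    have [->|ii0] := eqVneq i i0; last exact: xz.
    have zex j : exists z : int, j != i0 -> x j = - t * (a j)%:Z + h%:Z * z.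
      have [->|/xz[z zE]] := eqVneq j i0; first by exists 0.
      by exists z.
    have [z zE] := choice zex.
    exists (t - \sum_(i | i != i0) z i).
    move: xsum; rewrite (bigD1 i0) //= (eq_bigr _ zE) big_split /= -!mulr_sumr wsumD1.
    by move/eqP; rewrite addr_eq0 => /eqP ->; ring.
  rewrite /x; have [iJ|_] := boolP (i \in J); last first.
    apply: (@lt_le_trans _ _ 0); first by rewrite oppr_lt0 ltz_nat.
    by rewrite mulr_ge0 // oppr_ge0.
  have := yb i; have := y'b i; rewrite /b iJ; move: (a i); clear.
  by move: (y i) (y' i) => u v w; lia.
have := x0 l; rewrite /x; have [lJ|lJ] := boolP (l \in J).
  by move/eqP; rewrite subr_eq0 => /eqP[] /esym.
have := yb l; have := y'b l; rewrite /b (negbTE lJ) !ltnS !leqn0.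
by move=> /eqP e1 /eqP e2; case: yl; rewrite e1 e2.
Qed.

Lemma wsumD2 i0 i1 : i1 != i0 ->
  (\sum_(i | (i != i0) && (i != i1)) (a i)%:Z) = h%:Z - (a i0)%:Z - (a i1)%:Z.
Proof. by move=> i10; rewrite -wsumD1 [in RHS](bigD1 i1) //= addrAC subrr add0r. Qed.

(* When two weights agree, their coordinates need not be controlled in the
   pigeonhole: half the sum of the others does, up to a parity. *)
Lemma prod_le_pow2 i0 i1 : i1 != i0 -> a i0 = a i1 ->
  (h * \prod_(i | (i != i0) && (i != i1)) a i <=
   2 * \prod_(i | (i != i0) && (i != i1)) h)%N.
Proof.
move=> i10 aE; rewrite leqNgt; apply/negP => lt.
have i01 : i0 != i1 by rewrite eq_sym.
pose T i := (i != i0) && (i != i1).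
pose b i := if i == i0 then h else if i == i1 then 1%N else a i.
pose b' (i : 'I_n.+1) := if i == i0 then 2 else if i == i1 then 1%N else h.
pose g (y : 'I_n.+1 -> nat) i := ((y i0 * a i + y i) %/ h)%N.
pose G y := (y i0 + \sum_(i | T i) g y i)%N.
pose F (y : 'I_n.+1 -> nat) i :=
  if i == i0 then (G y %% 2)%N else if i == i1 then 0%N else
  ((y i0 * a i + y i) %% h)%N.
have bigT (f : 'I_n.+1 -> nat) :
    (\prod_i f i = f i0 * (f i1 * \prod_(i | T i) f i))%N.
  by rewrite (bigD1 i0) //= (bigD1 i1).
have [||y [y' [yb y'b [l yl] Fe]]] := @box_pigeonhole _ b b' F.
- move=> y i _; rewrite /F /b'; case: eqP => _; first by rewrite ltn_mod.
  by case: ifP => // _; rewrite ltn_mod wsum_gt0.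
- rewrite !bigT /b /b' eqxx (negbTE i10) eqxx !mul1n.
  rewrite (eq_bigr (fun=> h)) => [|i /andP[/negbTE -> /negbTE ->] //].
  by rewrite [X in (_ < _ * X)%N](eq_bigr a) // => i /andP[/negbTE -> /negbTE ->].
pose S y y' : int := \sum_(i | T i) ((y' i)%:Z - (y i)%:Z).
wlog sle : y y' yb y'b yl Fe / S y y' <= 0.
  move=> H; have [sle|slt] := leP (S y y') 0; first exact: (H y y').
  apply: (H y' y) => // [e|]; first by apply: yl.
  rewrite -oppr_ge0 -sumrN; under eq_bigr => i _ do rewrite opprB.
  exact: ltW.
pose c := (y i0)%:Z - (y' i0)%:Z.
pose e i : int := (g y i)%:Z - (g y' i)%:Z.
have xT i : T i -> (y' i)%:Z - (y i)%:Z = c * (a i)%:Z - h%:Z * e i.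
  move=> /andP[ii0 ii1]; have := Fe i; rewrite /F (negbTE ii0) (negbTE ii1) => er.
  have E1 := divn_eq (y i0 * a i + y i) h; have E2 := divn_eq (y' i0 * a i + y' i) h.
  have {}E1 : (y i)%:Z = (g y i)%:Z * h%:Z + ((y i0 * a i + y i) %% h)%N%:Z
      - (y i0)%:Z * (a i)%:Z by rewrite -!PoszM -PoszD -E1 PoszD addrC addKr.
  have {}E2 : (y' i)%:Z = (g y' i)%:Z * h%:Z + ((y' i0 * a i + y' i) %% h)%N%:Z
      - (y' i0)%:Z * (a i)%:Z by rewrite -!PoszM -PoszD -E2 PoszD addrC addKr.
  by rewrite E1 E2 er /c /e; ring.
have SE : S y y' = c * (h%:Z - (a i0)%:Z *+ 2) - h%:Z * \sum_(i | T i) e i.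
  rewrite /S (eq_bigr _ xT) sumrB -!mulr_sumr wsumD2 // -aE; congr (c * _ - _).
  by ring.
(* The parity of [G] is recorded for this: with [c + \sum e i] even, half of [- S y y'] is congruent
   to [c * a i0] modulo [h], and it is the common coordinate at [i0] and [i1]. *)
have [w wE] : exists w, c + \sum_(i | T i) e i = 2 * w.
  have := Fe i0; rewrite /F eqxx => er.
  exists ((G y %/ 2)%N%:Z - (G y' %/ 2)%N%:Z).
  have -> : c + \sum_(i | T i) e i = (G y)%:Z - (G y')%:Z.
    have sumZ f : (\sum_(i | T i) f i)%N%:Z = \sum_(i | T i) (f i)%:Z.
      by rewrite -natz natr_sum; apply: eq_bigr => i _; rewrite natz.
    by rewrite /G !PoszD !sumZ /c /e sumrB; ring.
  have E1 z : (G z)%:Z = (G z %/ 2)%N%:Z * 2 + (G z %% 2)%N%:Z.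
    by rewrite -PoszM -PoszD -divn_eq.
  by rewrite (E1 y) (E1 y') er; ring.
pose u := c * (a i0)%:Z - h%:Z * (w - \sum_(i | T i) e i).
have uE : u *+ 2 = - S y y'.
  rewrite SE /u; have -> : c = 2 * w - \sum_(i | T i) e i by rewrite -wE addrK.
  by ring.
have u0 : 0 <= u by rewrite -(pmulrn_lge0 _ (isT : (0 < 2)%N)) uE oppr_ge0.
pose x i := if T i then (y' i)%:Z - (y i)%:Z else u.
have nT i : ~~ T i -> i = i0 \/ i = i1.
  by rewrite negb_and !negbK => /orP[/eqP|/eqP]; [left|right].
have Ti0 : T i0 = false by rewrite /T eqxx.
have Ti1 : T i1 = false by rewrite /T eqxx andbF.
have xz i : exists z, x i = c * (a i)%:Z + h%:Z * z.
  rewrite /x; have [Ti|/nT[]->] := boolP (T i).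
  - by exists (- e i); rewrite xT // mulrN.
  - by exists (- (w - \sum_(i | T i) e i)); rewrite /u mulrN.
  - by exists (- (w - \sum_(i | T i) e i)); rewrite /u mulrN aE.
have x0 : forall i, x i = 0.
  apply: (nsm (c := c)) => // [|i].
    rewrite (bigD1 i0) //= (bigD1 i1) //= {1 2}/x Ti0 Ti1.
    rewrite (eq_bigr (fun i => (y' i)%:Z - (y i)%:Z)) => [|i Ti]; last first.
      by rewrite /x /T Ti.
    by rewrite -/(S y y') addrA -mulr2n uE addNr.
  rewrite /x; have [/andP[ii0 ii1]|_] := boolP (T i); last first.
    by apply: lt_le_trans u0; rewrite oppr_lt0 ltz_nat.
  have := yb i; have := y'b i; rewrite /b (negbTE ii0) (negbTE ii1).
  by move: (a i) (y i) (y' i); clear => v1 v2 v3; lia.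
have c0 : c = 0.
  apply: dvd_all_weights => [|i].
    have := yb i0; have := y'b i0; rewrite /b eqxx /c; clear.
    by move: (y i0) (y' i0) (wsum a) => v1 v2 v3; lia.
  have [z zE] := xz i; exists (- z); move: zE; rewrite x0 mulrN.
  by move/esym/eqP; rewrite addr_eq0 => /eqP.
have [Tl|/nT[]li] := boolP (T l).
- by have := x0 l; rewrite /x Tl => /eqP; rewrite subr_eq0 => /eqP[] /esym.
- by apply: yl; rewrite li; move: c0; rewrite /c => /eqP; rewrite subr_eq0 => /eqP[].
- have := yb l; have := y'b l; rewrite /b li (negbTE i10) eqxx !ltnS !leqn0.
  by move=> /eqP e1 /eqP e2; case: yl; rewrite li e1 e2.
Qed.

End ProductBounds.

(** * Comparison with the Sylvester sequence *)

Section AbelComparison.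
Variable R : realFieldType.
Implicit Types (al be t : nat -> R).

Lemma sum_gt_of_prod_gt1 t m : (0 < m)%N -> (forall i, (i < m)%N -> 0 < t i) ->
  1 < \prod_(i < m) t i -> m%:R < \sum_(i < m) t i.
Proof.
move=> m0 t0 pt; rewrite ltNge; apply/negP => le.
have [agm _] := @leif_AGM R 'I_m 'I_m t (fun i _ => ltW (t0 i (ltn_ord i))).
have s0 : 0 <= \sum_(i < m) t i by apply: sumr_ge0 => i _; apply: ltW; exact: t0.
suff : \prod_(i < m) t i <= 1 by rewrite leNgt pt.
apply: le_trans agm _; rewrite card_ord; apply: exprn_ile1.
  by rewrite divr_ge0.
by rewrite ler_pdivrMr ?ltr0n // mul1r.
Qed.

(* If the prefix products of a nonincreasing sequence are smaller than those of
   another one, then so is its sum: Abel summation and AM-GM. *)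
Lemma sum_lt_of_prefix_prod al be m : (0 < m)%N ->
  (forall i, (i < m)%N -> 0 < al i) -> (forall i, (i < m)%N -> 0 < be i) ->
  (forall i, (i.+1 < m)%N -> al i.+1 <= al i) ->
  (forall j, (0 < j <= m)%N -> \prod_(i < j) al i < \prod_(i < j) be i) ->
  \sum_(i < m) al i < \sum_(i < m) be i.
Proof.
move=> m0 al0 be0 mon pref; pose t i := be i / al i.
have t0 i : (i < m)%N -> 0 < t i by move=> im; rewrite divr_gt0 ?al0 ?be0.
have T0 j : (0 < j <= m)%N -> j%:R < \sum_(i < j) t i.
  move=> /andP[j0 jm]; apply: sum_gt_of_prod_gt1 => // [i ij|].
    by apply: t0; apply: leq_trans jm.
  rewrite /t prodf_div ltr_pdivlMr ?mul1r ?pref ?j0 //.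
  by apply: prodr_gt0 => i _; apply: al0; apply: leq_trans jm.
(* Abel summation: the partial sums of [t i - 1] are positive, so replacing the nonincreasing
   coefficients [al i] by the last one only lowers the sum. *)
have ab j : (j < m)%N -> al j * (\sum_(i < j.+1) t i - j.+1%:R) <=
    \sum_(i < j.+1) al i * (t i - 1).
  elim: j => [|j IH] jm; first by rewrite !big_ord1.
  rewrite [X in _ <= X]big_ord_recr [X in al _ * (X - _)]big_ord_recr /=.
  have := IH (ltnW jm); have := T0 j.+1 (ltnW jm) => Tj IHj.
  have mj := mon j jm.
  set s := \sum_(i < j.+1) t i in Tj IHj *; set r := \sum_(i < j.+1) _ in IHj *.
  have -> : al j.+1 * (s + t j.+1 - j.+2%:R) =
      al j.+1 * (s - j.+1%:R) + al j.+1 * (t j.+1 - 1).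
    by rewrite -[j.+2]addn1 natrD; ring.
  rewrite lerD2r; apply: le_trans IHj; apply: ler_wpM2r => //.
  by rewrite subr_ge0 ltW.
have := ab m.-1; rewrite prednK // leqnn => /(_ isT) h.
have h' : 0 < al m.-1 * (\sum_(i < m) t i - m%:R).
  by rewrite mulr_gt0 ?al0 ?ltn_predL // subr_gt0 T0 ?m0 /=.
rewrite -subr_gt0 -sumrB; apply: lt_le_trans h' (le_trans h _).
rewrite le_eqVlt; apply/orP; left; apply/eqP; apply: eq_bigr => i _.
by rewrite mulrBr mulr1 /t mulrC divfK // gt_eqF ?al0.
Qed.

End AbelComparison.

Lemma sylvester_prod_gt0 m : (0 < sylvester_prod m)%N.
Proof. by elim: m => //= m IH; rewrite muln_gt0 IH. Qed.

Section SylvesterComparison.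
Variable R : realFieldType.
Local Notation Y := sylvester_prod.
Local Notation u := (fun i => ((Y i).+1%:R)^-1 : R).

Lemma sylvester_prodr_gt0 m : 0 < (Y m)%:R :> R.
Proof. by rewrite ltr0n sylvester_prod_gt0. Qed.

Lemma prod_sylvester_inv m : \prod_(i < m) u i = (Y m)%:R^-1.
Proof.
elim: m => [|m IH]; first by rewrite big_ord0 invr1.
by rewrite big_ord_recr /= IH natrM invfM.
Qed.

(** Telescoping, by [1 / (y + 1) = 1 / y - 1 / (y (y + 1))]. *)
Lemma sum_sylvester_inv m l :
  \sum_(i < l) u (m + i)%N = (Y m)%:R^-1 - (Y (m + l))%:R^-1.
Proof.
elim: l => [|l IH]; first by rewrite big_ord0 addn0 subrr.
rewrite big_ord_recr /= IH addnS /= natrM -natr1.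
have Y0 := sylvester_prodr_gt0 (m + l); move: (Y (m + l))%:R Y0 => y y0.
by field; rewrite !gt_eqF ?addr_gt0 ?y0 ?ltr01 ?sylvester_prodr_gt0.
Qed.

(* The comparison behind all the bounds: a nonincreasing sequence with
   [x_0 ... x_(i-1) <= 1 - x_0 - ... - x_(i-1)] has the smallest product when
   it is [1/s_1, ..., 1/s_j, 1/y_(j+1)]. *)
Lemma sylvester_product_bound (al : nat -> R) j z eps : 0 <= eps ->
  (forall i, (i < j)%N -> 0 < al i) ->
  (forall i, (i.+1 < j)%N -> al i.+1 <= al i) ->
  (forall i, (i <= j)%N -> \prod_(l < i) al l <= 1 - \sum_(l < i) al l) ->
  z = 1 - \sum_(l < j) al l + eps -> 0 < z -> ((0 < j)%N -> z <= al j.-1) ->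
  (Y j)%:R^-1 * ((Y j)%:R^-1 + eps) <= \prod_(l < j) al l * z.
Proof.
move=> eps0 al0 mon pr zE z0 zal; rewrite leNgt; apply/negP => lt.
pose P i := \prod_(l < i) al l.
pose good i := (i <= j)%N && ((Y i)%:R^-1 <= P i).
have ex : exists i, good i by exists 0%N; rewrite /good /P big_ord0 invr1 lexx.
have bd i : good i -> (i <= j)%N by case/andP.
(* Let [i] be the last index with a prefix product at least that of the Sylvester sequence. From [i]
   on, the products of [xi] are smaller than those of [eta], hence so is the sum: [1 - \sum_(l < i)
   al l + eps < 1 / Y i + eps <= P i + eps], against [pr]. *)
case: (ex_maxnP ex bd) => i /andP[ij Pi] imax.
pose xi l := if (l < j)%N then al l else z.
pose eta l := if (l < j)%N then u l else (Y j)%:R^-1 + eps.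
have P0 l : (l <= j)%N -> 0 < P l.
  by move=> lj; apply: prodr_gt0 => l' _; apply: al0; apply: leq_trans lj.
have prefix (f g : nat -> R) l : (l <= j)%N -> (forall i, (i < j)%N -> f i = g i) ->
    \prod_(i < l) f i = \prod_(i < l) g i.
  by move=> lj fg; apply: eq_bigr => l' _; apply: fg; apply: leq_trans lj.
have xiP l : (l <= j)%N -> \prod_(i < l) xi i = P l.
  by move=> lj; apply: prefix => // l' l'j; rewrite /xi l'j.
have etaP l : (l <= j)%N -> \prod_(i < l) eta i = (Y l)%:R^-1.
  move=> lj; rewrite -prod_sylvester_inv.
  by apply: (prefix eta (fun i => u i)) => // l' l'j; rewrite /eta l'j.
have split_prod (f : nat -> R) l : \prod_(l' < i + l) f l' =
    \prod_(l' < i) f l' * \prod_(l' < l) f (i + l')%N.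
  by rewrite big_split_ord.
have : \sum_(l < (j - i).+1) xi (i + l)%N < \sum_(l < (j - i).+1) eta (i + l)%N.
  apply: (@sum_lt_of_prefix_prod R (fun l => xi (i + l)%N) (fun l => eta (i + l)%N)) => //.
  - by move=> l _; rewrite /xi; case: ifP => // /al0.
  - move=> l _; rewrite /eta; case: ifP => _; first by rewrite invr_gt0 ltr0n.
    by rewrite ltr_pwDl // invr_gt0 sylvester_prodr_gt0.
  - move=> l lj; rewrite /xi addnS; case: ifP => lj'.
      by rewrite ltnW //; apply: mon.
    case: ifP => // lj2; have jE : j = (i + l).+1 by lia.
    by apply: le_trans (zal _) _; rewrite jE.
  move=> l /andP[l0 lj].
  have il : 0 < \prod_(l' < i) xi l' by rewrite xiP // P0.
  have ie : 0 < \prod_(l' < i) eta l' by rewrite etaP // invr_gt0 sylvester_prodr_gt0.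
  have e1 : \prod_(l' < i) eta l' <= \prod_(l' < i) xi l' by rewrite xiP // etaP.
  have : \prod_(l' < i + l) xi l' < \prod_(l' < i + l) eta l'.
    have [lj'|lj'] := leqP (i + l) j.
      rewrite xiP // etaP // ltNge; apply/negP => h.
      by have := imax (i + l)%N; rewrite /good lj' h => /(_ isT); rewrite -[X in (_ <= X)%N]addn0 leq_add2l leqNgt l0.
    have -> : (i + l)%N = j.+1.
      by apply/eqP; rewrite eqn_leq lj' andbT -(subnKC ij) -addnS leq_add2l.
    rewrite !big_ord_recr /= xiP // etaP // /xi /eta ltnn mulrC.
    by rewrite [X in _ < X]mulrC mulrC [X in _ < X]mulrC.
  rewrite !split_prod => h.
  have X0 : 0 < \prod_(l' < l) xi (i + l')%N.
    by apply: prodr_gt0 => l' _; rewrite /xi; case: ifP => // /al0.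
  rewrite ltNge; apply/negP => h'; move: h; rewrite ltNge => /negP; apply.
  by apply: ler_pM => //; apply: ltW; rewrite // prodr_gt0 // => l' _;
    rewrite /eta; case: ifP => _; rewrite ?invr_gt0 ?ltr0n // ltr_pwDl // invr_gt0 sylvester_prodr_gt0.
rewrite !big_ord_recr /= subnKC // /xi /eta ltnn.
have lj (l : 'I_(j - i)) : (i + l < j)%N by have := ltn_ord l; lia.
under eq_bigr => l _ do rewrite lj.
under [X in _ < X + _]eq_bigr => l _ do rewrite lj.
rewrite (sum_sylvester_inv i) subnKC // zE.
have split_sum : \sum_(l < i + (j - i)) al l =
    \sum_(l < i) al l + \sum_(l < j - i) al (i + l)%N by rewrite big_split_ord.
rewrite subnKC // in split_sum; rewrite {}split_sum.
have := pr i ij; rewrite -/(P i) => h1 h2; lra.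
Qed.

End SylvesterComparison.

(* [tail_const (m - 2)] replaces the optimal constant [m ^ (m - 1)] for
   [m = d + 2] in [tail_prod_bound], because it satisfies a recurrence. *)
Fixpoint tail_const (d : nat) : nat :=
  match d with
  | 0 => 2
  | 1 => 9
  | (d'.+1 as e).+1 => 2 ^ (e.+2) * tail_const e
  end.

Lemma tail_constS d : tail_const d.+2 = (2 ^ d.+3 * tail_const d.+1)%N.
Proof. by []. Qed.

Lemma exp2_mul_le (y m : nat) : (2 ^ m.+2 * y <= y.+1 ^ m.+2)%N.
Proof.
elim: m => [|m IH]; first by rewrite !expnS !expn0; nia.
case: y IH => [|y] IH; first by rewrite muln0.
rewrite expnS [X in (_ <= X)%N]expnS -mulnA; apply: leq_mul => //.
Qed.

Lemma sylvester_prodS m :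
  sylvester_prod m.+1 = (sylvester_prod m * (sylvester_prod m).+1)%N.
Proof. by []. Qed.

Lemma sylvester_prod_ge6 m : (6 <= sylvester_prod m.+2)%N.
Proof.
elim: m => // m; rewrite sylvester_prodS; move: (sylvester_prod m.+2) => z z6.
by apply: leq_trans z6 _; rewrite leq_pmulr.
Qed.

(** Passing to [j.+1] uses [2 ^ d.+3 * y <= y.+1 ^ d.+3] for [y = Y j], matched by the recurrence of
    [tail_const]. The base case [9 y ^ 3 + y (y + 1) <= 2 (y (y + 1)) ^ 2] holds for [y >= 6] but
    not for [y = 2]. *)
Lemma tail_const_bound d j : (2 <= j + d)%N ->
  (tail_const d.+1 * sylvester_prod j ^ d.+3 + sylvester_prod (j + d.+1) <=
   2 * sylvester_prod (j + d.+1) ^ 2)%N.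
Proof.
elim: d j => [|d IH] j jd.
  rewrite addn0 in jd; case: j jd => [|[|j]] // _; rewrite addn1.
  rewrite (sylvester_prodS j.+2).
  rewrite -(subnK (sylvester_prod_ge6 j)); move: (_ - 6)%N => t.
  rewrite (_ : tail_const 1 = 9) // -[(t + 6).+1]addn1.
  rewrite (_ : 2 * ((t + 6) * (t + 6 + 1)) ^ 2 =
    9 * (t + 6) ^ 3 + (t + 6) * (t + 6 + 1) +
    (t + 6) * (2 * t ^ 3 + 31 * t ^ 2 + 157 * t + 257))%N; last by ring.
  exact: leq_addr.
have jd' : (2 <= j.+1 + d)%N by rewrite addSnnS.
have := IH j.+1 jd'; rewrite (addSnnS j d.+1) => H; apply: leq_trans H.
rewrite leq_add2r.
rewrite tail_constS (sylvester_prodS j); move: (sylvester_prod j) => y.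
rewrite expnMn [(y ^ d.+4)%N]expnS.
rewrite (_ : 2 ^ d.+3 * tail_const d.+1 * (y * y ^ d.+3) =
  tail_const d.+1 * (y ^ d.+3 * (2 ^ d.+3 * y)))%N; last by ring.
by rewrite leq_mul2l leq_mul2l exp2_mul_le !orbT.
Qed.

(** * Lower bounds for the product of the last coordinates *)

Section Tail.
Variable R : realFieldType.
Implicit Types (x r : R).

(** The worst case is [x = r / 3]; it gives [tail_const 1 = 9]. *)
Lemma tail_step3 x r : r <= 3%:R * x -> x *+ 2 <= r ->
  2%:R / 9%:R * r ^+ 2 <= x * (r - x).
Proof. by move=> h1 h2; nra. Qed.

Lemma bernoulli x y m : 0 <= x -> 0 <= y ->
  x ^+ m.+1 + m.+1%:R * y * x ^+ m <= (x + y) ^+ m.+1.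
Proof.
move=> x0 y0; elim: m => [|m IH]; first by rewrite !expr1 expr0; lra.
rewrite [X in _ <= X]exprS.
have h : (x + y) * (x ^+ m.+1 + m.+1%:R * y * x ^+ m) <= (x + y) * (x + y) ^+ m.+1.
  by apply: ler_wpM2l => //; rewrite addr_ge0.
apply: le_trans h; rewrite -subr_ge0 -[m.+2]addn1 natrD addn1 !exprS.
have z0 : 0 <= x ^+ m by rewrite exprn_ge0.
have m0 : 0 <= m.+1%:R :> R by [].
move: (x ^+ m) (m.+1%:R) z0 m0 => z c z0 c0.
rewrite (_ : _ - _ = c * y ^+ 2 * z); last by ring.
by rewrite !mulr_ge0 ?exprn_ge0.
Qed.

(** Bernoulli's inequality for [2 (r - x) = r + (r - 2 x)]. Equality holds at [x = r / 2], whence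
    the powers of 2 in [tail_const]. *)
Lemma tail_step x r m : 0 <= x -> r <= m.+4%:R * x -> x *+ 2 <= r ->
  r ^+ m.+3 <= 2%:R ^+ m.+3 * (x * (r - x) ^+ m.+2).
Proof.
move=> x0 h1 h2; have r0 : 0 <= r by lra.
have y0 : 0 <= r - x *+ 2 by lra.
have := bernoulli m.+1 r0 y0.
have -> : r + (r - x *+ 2) = 2%:R * (r - x) by ring.
rewrite exprMn => B.
have -> : 2%:R ^+ m.+3 * (x * (r - x) ^+ m.+2) =
    2%:R * x * (2%:R ^+ m.+2 * (r - x) ^+ m.+2) by rewrite exprS; ring.
apply: le_trans (_ : 2%:R * x * (r ^+ m.+2 + m.+2%:R * (r - x *+ 2) * r ^+ m.+1) <= _);
  last by apply: ler_wpM2l => //; rewrite mulr_ge0.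
have z0 : 0 <= r ^+ m.+1 by rewrite exprn_ge0.
rewrite (exprS r m.+2) (exprS r m.+1); move: (r ^+ m.+1) z0 => z z0.
rewrite -subr_ge0.
have mE : m.+4%:R = m.+2%:R + 2%:R :> R by rewrite -natrD addn2.
have c2 : 2%:R <= m.+2%:R :> R by rewrite ler_nat.
rewrite {}mE in h1; move: (m.+2%:R) c2 h1 => c c2 h1.
rewrite (_ : _ - _ = (r - 2%:R * x) * (2%:R * c * x - r) * z); last by ring.
by rewrite !mulr_ge0 //; nra.
Qed.

End Tail.

Section NumericBound.
Variable R : realFieldType.
Variables (al : nat -> R) (n : nat) (eps : R).
Local Notation Y := sylvester_prod.
Local Notation P j := (\prod_(i < j) al i).
(** The mass of the coordinates from [j] on, plus a correction [eps] that will be [1 / h] or 0. *)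
Definition tail_sum j : R := 1 - \sum_(l < j) al l + eps.
Local Notation r := tail_sum.
Local Notation tau := (tail_sum n.-1).

Hypothesis n_ge2 : (2 <= n)%N.
Hypothesis eps0 : 0 <= eps.
Hypothesis al_gt0 : forall i, (i <= n)%N -> 0 < al i.
Hypothesis al_mon : forall i, (i < n)%N -> al i.+1 <= al i.
Hypothesis al_sum : \sum_(i < n.+1) al i = 1.
Hypothesis al_prod : forall j, (j <= n)%N -> P j <= 1 - \sum_(l < j) al l.
Hypothesis al_last : tau <= al n.-1 *+ 2.

Lemma tail_sumS j : r j = al j + r j.+1.
Proof. by rewrite /tail_sum big_ord_recr /=; ring. Qed.

Lemma tail_sum_ge j : (j <= n)%N -> P j <= r j.
Proof. by move=> jn; apply: le_trans (al_prod jn) _; rewrite lerDl. Qed.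

Lemma prefix_gt0 j : (j <= n)%N -> 0 < P j.
Proof.
move=> jn; apply: prodr_gt0 => i _; apply: al_gt0.
by apply: leq_trans (ltnW (ltn_ord i)) jn.
Qed.

Lemma tail_sum_gt0 j : (j <= n)%N -> 0 < r j.
Proof. by move=> jn; apply: lt_le_trans (prefix_gt0 jn) (tail_sum_ge jn). Qed.

Lemma tail_sum_le d j : (j + d)%N = n.-1 -> r j <= d.+2%:R * al j.
Proof.
elim: d j => [|d IH] j jd; first by rewrite addn0 in jd; rewrite jd mulr_natl.
rewrite tail_sumS; have jn : (j < n)%N by lia.
have := IH j.+1; rewrite addSnnS => /(_ jd) h; have := al_mon jn.
have : d.+3%:R = d.+2%:R + 1 :> R by rewrite -natr1.
have : 0 <= d.+2%:R :> R by [].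
move: h; move: (d.+2%:R) => c h c0 -> h'.
by have : c * al j.+1 <= c * al j by [apply: ler_wpM2l]; lra.
Qed.

(** The hypothesis bounds each coordinate of the tail above by half of the mass that remains with
    it, and [tail_sum_le] bounds it below by a fraction of that mass, as [tail_step3] and
    [tail_step] require. *)
Lemma tail_prod_bound d j : (j + d)%N = n.-1 ->
  (forall i, (j < i <= n.-1)%N -> al i.-1 < r i) ->
  r j ^+ d.+1 <= (tail_const d)%:R * (\prod_(i < d) al (j + i)%N * (tau / 2%:R)).
Proof.
elim: d j => [|d IH] j jd hr.
  rewrite addn0 in jd; rewrite expr1 big_ord0 mul1r jd /= mulrC divfK //.
  by rewrite pnatr_eq0.
have jd' : (j.+1 + d)%N = n.-1 by rewrite addSnnS.
have jn : (j.+1 <= n.-1)%N by rewrite -jd' leq_addr.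
have {}IH : r j.+1 ^+ d.+1 <=
    (tail_const d)%:R * (\prod_(i < d) al (j.+1 + i)%N * (tau / 2%:R)).
  by apply: IH => // i /andP[h1 h2]; apply: hr; rewrite h2 ltnW.
have lt : al j *+ 2 <= r j.
  have := hr j.+1; rewrite ltnSn jn => /(_ isT) /= h.
  by rewrite tail_sumS mulr2n lerD2l ltW.
have le := tail_sum_le jd.
have x0 : 0 < al j by apply: al_gt0; lia.
have rE : r j.+1 = r j - al j by rewrite (tail_sumS j) addrC addKr.
have -> : \prod_(i < d.+1) al (j + i)%N = al j * \prod_(i < d) al (j.+1 + i)%N.
  rewrite big_ord_recl /= addn0; congr (_ * _); apply: eq_bigr => i _.
  by rewrite addSnnS.
case: d jd jd' IH le => [|d] jd jd' IH le.
  rewrite addn0 in jd'; rewrite big_ord0 mulr1 -jd' rE.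
  have := tail_step3 le lt; rewrite /=; lra.
rewrite rE in IH.
apply: le_trans (tail_step (ltW x0) le lt) _.
rewrite tail_constS natrM natrX -[X in _ <= X]mulrA.
apply: ler_wpM2l; first by rewrite exprn_ge0.
by rewrite -(mulrA (al j)) [X in _ <= X]mulrCA ler_wpM2l // ltW.
Qed.

(** [j] is the last index up to which [sylvester_product_bound] applies with the remaining mass as
    final term. *)
Lemma last_split : exists j, [/\ (j <= n.-1)%N,
  (0 < j)%N -> r j <= al j.-1 &
  forall i, (j < i <= n.-1)%N -> al i.-1 < r i].
Proof.
pose good j := (j <= n.-1)%N && ((0 < j)%N ==> (r j <= al j.-1)).
have ex : exists j, good j by exists 0%N.
have bd j : good j -> (j <= n.-1)%N by case/andP.
case: (ex_maxnP ex bd) => j /andP[jn /implyP hj] jmax; exists j; split=> //.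
move=> i /andP[ji ilt]; rewrite ltNge; apply/negP => h.
have := jmax i; rewrite /good ilt h implybT => /(_ isT).
by rewrite leqNgt ji.
Qed.

Lemma prefix_tail_bound j : (j <= n.-1)%N -> ((0 < j)%N -> r j <= al j.-1) ->
  (Y j)%:R^-1 * ((Y j)%:R^-1 + eps) <= P j * r j.
Proof.
move=> jn hj; have jn' : (j <= n)%N by lia.
apply: sylvester_product_bound => //.
- by move=> i ij; apply: al_gt0; lia.
- by move=> i ij; apply: al_mon; lia.
- by move=> i ij; apply: al_prod; lia.
- exact: tail_sum_gt0.
Qed.

Lemma prefix_split j d : (j + d)%N = n.-1 ->
  P n.-1 = P j * \prod_(i < d) al (j + i)%N.
Proof. by move=> <-; rewrite big_split_ord. Qed.

Variable h : R.
Hypothesis h_gt0 : 0 < h.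
Hypothesis h_prod : h * P n.-1 * (tau / 2%:R) <= 1.

Lemma early_split_bound d j : (j + d.+1)%N = n.-1 ->
  (forall i, (j < i <= n.-1)%N -> al i.-1 < r i) ->
  h * (P j * r j ^+ d.+2) <= (tail_const d.+1)%:R.
Proof.
move=> jd hr; have jn : (j <= n.-1)%N by rewrite -jd leq_addr.
have := tail_prod_bound jd hr.
have PE := prefix_split jd; move=> T.
have Pj : 0 <= P j by apply: ltW; apply: prefix_gt0; lia.
apply: le_trans (_ : h * (P j * ((tail_const d.+1)%:R *
    (\prod_(i < d.+1) al (j + i)%N * (tau / 2%:R)))) <= _).
  by apply: ler_wpM2l; [exact: ltW | apply: ler_wpM2l].
rewrite -[X in _ <= X]mulr1.
apply: le_trans (_ : (tail_const d.+1)%:R * (h * P n.-1 * (tau / 2%:R)) <= _).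
  by rewrite PE le_eqVlt; apply/orP; left; apply/eqP; ring.
by apply: ler_wpM2l.
Qed.

(** [P j * r j >= Y_j ^ -2] together with [P j <= r j] gives [r j >= 1 / Y_j]. Hence
    [P j * r j ^ (d + 2) >= Y_j ^ -(d + 3)], and [h <= tail_const d.+1 * Y_j ^ (d + 3)]. *)
Lemma early_split_bound_ge4 d j : (4 <= n)%N -> (j + d.+1)%N = n.-1 ->
  ((0 < j)%N -> r j <= al j.-1) ->
  (forall i, (j < i <= n.-1)%N -> al i.-1 < r i) ->
  h + (Y n.-1)%:R <= 2%:R * (Y n.-1)%:R ^+ 2.
Proof.
move=> n4 jd hj hr; have := early_split_bound jd hr.
have jn : (j <= n.-1)%N by rewrite -jd leq_addr.
have jn' : (j <= n)%N by lia.
have y0 := sylvester_prodr_gt0 R j; have V0 : 0 < (Y j)%:R^-1 :> R by rewrite invr_gt0.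
have pt : (Y j)%:R^-1 ^+ 2 <= P j * r j.
  apply: le_trans (prefix_tail_bound jn hj).
  by rewrite expr2 ler_wpM2l ?lerDl // ltW.
have rV : (Y j)%:R^-1 <= r j.
  have r0 := tail_sum_gt0 jn'.
  rewrite leNgt; apply/negP => lt; move: pt; apply/negP; rewrite -ltNge.
  apply: (@le_lt_trans _ _ (r j * r j)); first by rewrite ler_wpM2r ?tail_sum_ge // ltW.
  by rewrite expr2 ltr_pM // ltW.
move=> hC; have hV : h * (Y j)%:R^-1 ^+ d.+3 <= (tail_const d.+1)%:R.
  apply: le_trans hC; apply: ler_wpM2l; first exact: ltW.
  rewrite [X in _ <= P j * X]exprS mulrA -[d.+3]/(2 + d.+1)%N exprD.
  have V0' := ltW V0; have r0' := ltW (tail_sum_gt0 jn').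
  apply: ler_pM; [exact: exprn_ge0|exact: exprn_ge0|exact: pt|].
  by apply: lerXn2r; rewrite ?nnegrE.
have hY : h <= (tail_const d.+1 * Y j ^ d.+3)%:R.
  rewrite natrM natrX -ler_pdivrMr ?exprn_gt0 //.
  by rewrite -exprVn.
have jd2 : (2 <= j + d)%N by move: n4 jd; clear; lia.
have := tail_const_bound jd2; rewrite jd -(ler_nat R) natrD
  [X in _ <= X]natrM [X in _ <= _ * X]natrX => H.
by apply: le_trans H; rewrite lerD2r.
Qed.

End NumericBound.

(** For [n = 3], with [A] the largest weight; [66 = y_3 (2 y_3 - 1)]. *)
Lemma threefold_bound (h A : nat) : (2 * A <= h)%N -> (h.+1 <= 4 * A)%N ->
  (A * (h.+1 - A) ^ 2 <= 9 * h ^ 2)%N -> (h <= 66)%N.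
Proof.
move=> h1 h2 h3; rewrite leqNgt; apply/negP => h67.
have AE : (h.+1 - A)%N%:R = h%:R + 1 - A%:R :> rat.
  by rewrite natrB ?natr1 //; lia.
move: h3; rewrite -(ler_nat rat) !natrM AE -!expr2.
have {}h2 : h%:R + 1 <= 4%:R * A%:R :> rat by rewrite natr1 -natrM ler_nat.
have h67' : 67%:R <= h%:R :> rat by rewrite ler_nat.
apply/negP; rewrite -ltNge.
(* Integrality matters here: the real numbers [h = 67] and [A = 67 / 2] satisfy all three
   inequalities. *)
have [lt|ge] := ltnP (2 * A) h; last first.
  have hE : h%:R = 2%:R * A%:R :> rat by rewrite -natrM; congr _%:R; lia.
  have A34 : 34%:R <= A%:R :> rat by rewrite ler_nat; lia.
  rewrite hE; move: (A%:R : rat) A34 => x x34; nra.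
have {}lt : 2%:R * A%:R + 1 <= h%:R :> rat.
  by rewrite -natrM natr1 ler_nat.
move: (A%:R : rat) (h%:R : rat) h2 h67' lt => x s h2 h67' lt.
(* x (s + 1 - x)^2 is smallest at x = (s - 1) / 2. *)
have q : (s - 1) * (s + 3%:R) ^+ 2 <= 8%:R * (x * (s + 1 - x) ^+ 2).
  pose b := (s - 1) / 2%:R; have xb : x <= b by rewrite /b; lra.
  have -> : (s - 1) * (s + 3%:R) ^+ 2 = 8%:R * (b * (s + 1 - b) ^+ 2).
    by rewrite /b; field.
  rewrite (ler_pM2l (ltr0Sn rat 7)) -subr_ge0.
  have -> : x * (s + 1 - x) ^+ 2 - b * (s + 1 - b) ^+ 2 =
    (b - x) * (2%:R * (s + 1) * (x + b) - (s + 1) ^+ 2 - x ^+ 2 - x * b - b ^+ 2).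
    by ring.
  apply: mulr_ge0; first by rewrite subr_ge0.
  have sb : s = 2%:R * b + 1 by rewrite /b; lra.
  rewrite sb in h2 h67' *; nra.
have : 72%:R * s ^+ 2 < (s - 1) * (s + 3%:R) ^+ 2 by nra.
lra.
Qed.

(** * The bound for nonincreasing weights *)

Section SortedWeights.
Variables (n : nat) (a : 'I_n.+1 -> nat).
Hypothesis n_ge2 : (2 <= n)%N.
Hypothesis a_gt0 : forall i, (0 < a i)%N.
Hypothesis a_sorted : forall i j : 'I_n.+1, (i <= j)%N -> (a j <= a i)%N.
Hypothesis nsm : no_small_multiple a.
Variable bz : 'I_n.+1 -> int.
Hypothesis hbz : dot (aw a) bz = 1.
Local Notation h := (wsum a).
Local Notation Y := sylvester_prod.

Definition bcoord (i : nat) : rat := (a (inord i))%:R / h%:R.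
Local Notation al := bcoord.

Lemma wsumr_gt0 : 0 < h%:R :> rat.
Proof. by rewrite ltr0n wsum_gt0. Qed.

Lemma bcoordE (i : 'I_n.+1) : al i = (a i)%:R / h%:R.
Proof. by rewrite /bcoord inord_val. Qed.

Lemma bcoord_gt0 i : 0 < al i.
Proof. by rewrite divr_gt0 ?wsumr_gt0 // ltr0n a_gt0. Qed.

Lemma bcoord_mon i : (i < n)%N -> al i.+1 <= al i.
Proof.
move=> ilt; rewrite ler_pM2r ?invr_gt0 ?wsumr_gt0 // ler_nat a_sorted //.
by rewrite !inordK // ltnS ltnW.
Qed.

Lemma bcoord_sum : \sum_(i < n.+1) al i = 1.
Proof.
under eq_bigr => i _ do rewrite bcoordE.
by rewrite -mulr_suml -natr_sum divff // gt_eqF ?wsumr_gt0.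
Qed.

Lemma bcoord_prefix_prod j : (j <= n.+1)%N -> \prod_(i < j) al i =
  (\prod_(i < n.+1 | (i < j)%N) a i)%N%:R / (\prod_(i < n.+1 | (i < j)%N) h)%N%:R.
Proof.
move=> jn; rewrite (big_ord_widen_cond _ xpredT al jn) /= natr_prod natr_prod -prodf_div.
by apply: eq_bigr => i _; rewrite bcoordE.
Qed.

Lemma bcoord_prefix_sum j : (j <= n.+1)%N ->
  1 - \sum_(i < j) al i = (\sum_(i < n.+1 | ~~ (i < j)%N) a i)%N%:R / h%:R.
Proof.
move=> jn; rewrite (big_ord_widen_cond _ xpredT al jn) /=.
rewrite -[X in X - _]bcoord_sum (bigID (fun i : 'I_n.+1 => (i < j)%N)) /= addrAC subrr add0r.
by rewrite natr_sum mulr_suml; apply: eq_bigr => i _; rewrite bcoordE.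
Qed.

Lemma bcoord_prod_le j : (j <= n)%N ->
  \prod_(i < j) al i <= 1 - \sum_(i < j) al i.
Proof.
case: j => [|j] jn; first by rewrite !big_ord0 subr0.
rewrite bcoord_prefix_prod ?bcoord_prefix_sum ?ltnS ?(ltnW jn) //.
pose J := [set i : 'I_n.+1 | (i < j.+1)%N]%SET.
have h0 : ord0 \in J by rewrite inE.
have h1 : ord_max \notin J by rewrite inE /= -leqNgt.
have := prod_le_tail a_gt0 nsm h0 h1.
have E1 : (\prod_(i in J) a i = \prod_(i < n.+1 | (i < j.+1)%N) a i)%N.
  by apply: eq_bigl => i; rewrite inE.
have E2 : (\sum_(i | i \notin J) a i = \sum_(i < n.+1 | ~~ (i < j.+1)%N) a i)%N.
  by apply: eq_bigl => i; rewrite inE.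
have E3 : (\prod_(i in J | i != ord0) h =
    \prod_(i < n.+1 | (i < j.+1)%N && (i != ord0)) h)%N.
  by apply: eq_bigl => i; rewrite inE.
rewrite {}E1 {}E2 {}E3.
move=> le; rewrite [X in _ / X%:R](bigD1 ord0) //=.
set Q := (\prod_(i | _ && _) h)%N in le *.
have Q0 : 0 < Q%:R :> rat by rewrite ltr0n prodn_cond_gt0 // => i _; exact: wsum_gt0.
rewrite natrM ler_pdivrMr ?mulr_gt0 ?wsumr_gt0 // mulrA divfK ?gt_eqF ?wsumr_gt0 //.
by rewrite -natrM ler_nat.
Qed.

Lemma bcoord_last_prod : h%:R * \prod_(i < n) al i <= 1.
Proof.
rewrite bcoord_prefix_prod //.
have ltE (i : 'I_n.+1) : (i < n)%N = (i != ord_max).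
  by rewrite ltn_neqAle -val_eqE /= -ltnS ltn_ord andbT.
rewrite !(eq_bigl _ _ ltE) mulrA ler_pdivrMr ?mul1r.
  rewrite -natrM ler_nat; apply: leq_trans (prod_le_pow a_gt0 nsm hbz ord_max) _.
  by rewrite prod_nat_const cardC1 card_ord.
by rewrite ltr0n prodn_cond_gt0 // => i _; exact: wsum_gt0.
Qed.

Lemma bcoord_last_prod2 : a (inord n.-1) = a ord_max ->
  h%:R * \prod_(i < n.-1) al i <= 2%:R.
Proof.
move=> aE; have nn : (n.-1 < n.+1)%N by lia.
rewrite bcoord_prefix_prod ?(ltnW nn) //.
have ne : inord n.-1 != ord_max :> 'I_n.+1.
  by rewrite -val_eqE /= inordK //; lia.
have ltE (i : 'I_n.+1) : (i < n.-1)%N = (i != ord_max) && (i != inord n.-1).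
  rewrite -!val_eqE /= inordK //; have := ltn_ord i; lia.
rewrite !(eq_bigl _ _ ltE) mulrA ler_pdivrMr.
  by rewrite -!natrM ler_nat (prod_le_pow2 a_gt0 nsm hbz ne).
by rewrite ltr0n prodn_cond_gt0 // => i _; exact: wsum_gt0.
Qed.

(** Distinct last weights differ by at least 1, so adding [1 / h] to the mass of the last two
    coordinates keeps it at most [2 * al n.-1]. *)
Let eps : rat := if (a ord_max < a (inord n.-1))%N then h%:R^-1 else 0.

Let eps_ge0 : 0 <= eps.
Proof. by rewrite /eps; case: ifP => // _; rewrite invr_ge0 ltW ?wsumr_gt0. Qed.

Lemma bcoord_max : al n = (a ord_max)%:R / h%:R.
Proof. by rewrite -bcoordE. Qed.

Lemma tail_sum_last : tail_sum al eps n.-1 = al n.-1 + al n + eps.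
Proof.
have nE : n.-1.+1 = n by lia.
have sE : \sum_(i < n.-1.+2) al i = \sum_(i < n.-1) al i + al n.-1 + al n.-1.+1.
  by rewrite !big_ord_recr.
rewrite nE bcoord_sum in sE; rewrite /tail_sum sE.
by move: (\sum_(i < n.-1) al i) => s; ring.
Qed.

Let last_le : tail_sum al eps n.-1 <= al n.-1 *+ 2.
Proof.
rewrite tail_sum_last mulr2n -addrA lerD2l bcoord_max /bcoord /eps.
case: ltnP => [lt|_].
  rewrite -[X in _ + X]mul1r -mulrDl ler_pM2r ?invr_gt0 ?wsumr_gt0 //.
  by rewrite natr1 ler_nat.
rewrite addr0 ler_pM2r ?invr_gt0 ?wsumr_gt0 // ler_nat a_sorted //.
by rewrite inordK //=; lia.
Qed.

Let prod_last : h%:R * \prod_(i < n.-1) al i * (tail_sum al eps n.-1 / 2%:R) <= 1.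
Proof.
apply: le_trans bcoord_last_prod; have nE : n.-1.+1 = n by lia.
have pE : \prod_(i < n.-1.+1) al i = \prod_(i < n.-1) al i * al n.-1.
  by rewrite big_ord_recr.
rewrite nE in pE; rewrite pE mulrA; apply: ler_wpM2l.
  rewrite mulr_ge0 ?ltW ?wsumr_gt0 //; apply: prodr_gt0 => i _; exact: bcoord_gt0.
by rewrite ler_pdivrMr // mulr_natr.
Qed.

Let al_gt0 i : (i <= n)%N -> 0 < al i. Proof. by move=> _; exact: bcoord_gt0. Qed.

(** The case where the comparison reaches the last index. For [eps = 1 / h] it reads
    [Y^-1 * (Y^-1 + 1 / h) <= 2 / h], which is the claim. For equal last weights,
    [bcoord_last_prod2] and [al n <= 1 / 4], where [3 <= n] enters, give [h <= Y ^ 2]. *)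
Lemma sorted_weights_late :
  (0 < n.-1)%N -> tail_sum al eps n.-1 <= al n.-2 -> (3 <= n)%N \/ 0 < eps ->
  (h + Y n.-1 <= 2 * Y n.-1 ^ 2)%N.
Proof.
move=> n1 hl cs.
have : (Y n.-1)%:R^-1 * ((Y n.-1)%:R^-1 + eps) <=
    \prod_(i < n.-1) al i * tail_sum al eps n.-1.
  apply: (@prefix_tail_bound rat al n) => //; first exact: bcoord_mon.
  exact: bcoord_prod_le.
have := prod_last; set P := \prod_(i < _) _; set tau := tail_sum _ _ _ => hP.
have y0 := sylvester_prodr_gt0 rat n.-1; have h0 := wsumr_gt0.
have y1 : 1 <= (Y n.-1)%:R :> rat by rewrite ler1n sylvester_prod_gt0.
rewrite -(ler_nat rat) natrD natrM natrX.
move: cs; rewrite /eps; case: ifP => [_ _|lt [n3|]]; last by rewrite ltxx.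
  move=> b; have : h%:R * ((Y n.-1)%:R^-1 * ((Y n.-1)%:R^-1 + h%:R^-1)) <= 2%:R :> rat.
    apply: le_trans (ler_wpM2l (ltW h0) b) _; move: hP; lra.
  move: (h%:R : rat) ((Y n.-1)%:R : rat) h0 y0 => x y x0 y0.
  rewrite (_ : x * _ = (x + y) / y ^+ 2); last by field; rewrite !gt_eqF.
  by rewrite ler_pdivrMr ?exprn_gt0.
rewrite addr0 => b.
have aE : a (inord n.-1) = a ord_max.
  apply/eqP; rewrite eqn_leq leqNgt lt /=; apply: a_sorted.
  by rewrite inordK ?leq_pred // ltnS leq_pred.
have hP2 := bcoord_last_prod2 aE.
have tE : tau = 2%:R * al n.
  rewrite /tau tail_sum_last /eps lt addr0 bcoord_max /bcoord aE; ring.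
have n4 : 4%:R * al n <= 1.
  rewrite -[X in _ <= X]bcoord_sum; apply: le_trans (_ : n.+1%:R * al n <= _).
    apply: ler_wpM2r; first exact: ltW (bcoord_gt0 n).
    by rewrite (ler_nat rat 4).
  rewrite mulr_natl -[n.+1 in X in X <= _]card_ord -sumr_const.
  apply: ler_sum => i _; rewrite bcoord_max bcoordE ler_pM2r ?invr_gt0 ?wsumr_gt0 //.
  by rewrite ler_nat a_sorted // -ltnS.
have : h%:R * ((Y n.-1)%:R^-1 * (Y n.-1)%:R^-1) <= 1 :> rat.
  apply: le_trans (ler_wpM2l (ltW h0) b) _; rewrite mulrA.
  have P0 : 0 <= h%:R * P.
    by rewrite mulr_ge0 ?ltW // /P; apply: prodr_gt0 => i _; exact: bcoord_gt0.
  apply: le_trans (_ : 2%:R * (1 / 2%:R) <= _); last by rewrite mul1r mulfV.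
  have a0 := bcoord_gt0 n; rewrite -/P in hP2.
  apply: ler_pM => //; first by rewrite tE; lra.
  by rewrite tE; lra.
rewrite -invfM ler_pdivrMr ?mulr_gt0 // mul1r => hy.
move: (h%:R : rat) ((Y n.-1)%:R : rat) hy y1 => x y hy y1; nra.
Qed.

Lemma eps_cases : (eps = 0 /\ a (inord n.-1) = a ord_max) \/ eps = h%:R^-1.
Proof.
rewrite /eps; case: ifP => lt; [by right|left; split=> //].
apply/eqP; rewrite eqn_leq leqNgt lt /=; apply: a_sorted.
by rewrite inordK ?leq_pred // ltnS leq_pred.
Qed.

Lemma bcoord_half : al 0 *+ 2 <= 1.
Proof.
have := bcoord_prod_le (ltnW n_ge2); rewrite !big_ord1 /= mulr2n; lra.
Qed.

Lemma bcoord_sum3 : n = 2%N -> al 0 + al 1 + al 2 = 1.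
Proof.
move=> nE; rewrite -bcoord_sum.
suff H : forall m, m = 3%N -> \sum_(i < m) al i = al 0 + al 1 + al 2.
  exact: esym (H _ (congr1 S nE)).
by move=> m ->; rewrite !big_ord_recr big_ord0 /= add0r.
Qed.

(** Here [h * al 0 <= 2], and the largest coordinate is at least [1 / 3]. *)
Lemma sorted_weights_bound2_eq : n = 2%N -> a (inord n.-1) = a ord_max -> (h <= 6)%N.
Proof.
move=> nE aE; have h0 := wsumr_gt0; have s := bcoord_sum3 nE.
have m1 : al 1 <= al 0 by apply: bcoord_mon; lia.
have m2 : al 2 <= al 1 by apply: bcoord_mon; lia.
rewrite -(ler_nat rat); have := bcoord_last_prod2 aE.
have -> : \prod_(i < n.-1) al i = al 0 by rewrite nE big_ord1.
move: (h%:R : rat) h0 (al 0) (al 1) (al 2) s m1 m2 => x x0 b0 b1 b2 s m1 m2; nra.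
Qed.

(** For [eps = 1 / h] the tail bound becomes [(h + 1) ^ 2 <= 9 h], which excludes integers above
    [6 = y_2 (2 y_2 - 1)]. *)
Lemma sorted_weights_bound2 : n = 2%N ->
  (forall i, (0 < i <= n.-1)%N -> al i.-1 < tail_sum al eps i) -> (h <= 6)%N.
Proof.
move=> nE hr; have h0 := wsumr_gt0.
case: eps_cases => [[_ /(sorted_weights_bound2_eq nE)//]|eE].
have jd : (0 + 1)%N = n.-1 by rewrite nE.
have := early_split_bound n_ge2 eps_ge0 al_gt0 bcoord_mon last_le h0 prod_last jd hr.
rewrite big_ord0 mul1r /tail_sum big_ord0 subr0 eE.
have -> : h%:R * (1 + h%:R^-1) ^+ 2 = (h%:R + 1) ^+ 2 / h%:R :> rat.
  by move: (h%:R : rat) h0 => x x0; field; rewrite gt_eqF.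
rewrite ler_pdivrMr // natr1 -natrX -natrM ler_nat.
move: h => x; rewrite [tail_const 1]/=; nia.
Qed.

(** Equal last weights give [al 0 * al 1 >= 1 / 16], so [h <= 32]. Otherwise the tail bound at index
    1 is the cubic inequality of [threefold_bound] for the largest weight. *)
Lemma sorted_weights_bound3 : n = 3%N ->
  (forall i, (1 < i <= n.-1)%N -> al i.-1 < tail_sum al eps i) -> (h <= 66)%N.
Proof.
move=> nE hr; have h0 := wsumr_gt0.
have sum4 m : m = 4%N -> \sum_(i < m) al i = al 0 + al 1 + al 2 + al 3.
  by move=> ->; rewrite !big_ord_recr big_ord0 /= add0r.
have s := bcoord_sum; rewrite (sum4 _ (congr1 S nE)) in s.
have m1 : al 1 <= al 0 by apply: bcoord_mon; lia.
have m2 : al 2 <= al 1 by apply: bcoord_mon; lia.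
have m3 : al 3 <= al 2 by apply: bcoord_mon; lia.
have half := bcoord_half.
case: eps_cases => [[_ aE]|eE].
  rewrite -(ler_nat rat); have := bcoord_last_prod2 aE.
  have prod2 m : m = 2%N -> \prod_(i < m) al i = al 0 * al 1.
    by move=> ->; rewrite !big_ord_recr big_ord0 /= mul1r.
  have n1E : n.-1 = 2%N by rewrite nE.
  rewrite (prod2 _ n1E) => hP0.
  have hP : (h%:R : rat) * (al 0 * al 1) <= 2%:R by exact: hP0.
  have q1 : 1 / 4%:R * (3%:R / 4%:R) <= al 0 * (1 - al 0).
    by move: (al 0) (al 1) (al 2) (al 3) s m1 m2 m3 half => x y z t s m1 m2 m3 half; nra.
  have q2 : al 0 * (1 - al 0) <= 3%:R * (al 0 * al 1).
    have := bcoord_gt0 0; move: (al 0) (al 1) (al 2) (al 3) s m1 m2 m3 => x y z t s m1 m2 m3 x0.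
    by rewrite mulrCA ler_pM2l //; lra.
  move: hP h0; move: (h%:R : rat) => z hP z0.
  move: (al 0 * (1 - al 0)) (al 0 * al 1) q1 q2 hP => x y q1 q2 hP.
  have y16 : 16%:R^-1 <= y by lra.
  have : z * 16%:R^-1 <= z * y by rewrite ler_pM2l.
  lra.
have jd : (1 + 1)%N = n.-1 by rewrite nE.
have jd0 : (0 + 2)%N = n.-1 by rewrite nE.
have a0E : al 0 = (a ord0)%:R / h%:R by rewrite -bcoordE.
have := tail_sum_le n_ge2 eps_ge0 bcoord_mon last_le jd0.
have := early_split_bound n_ge2 eps_ge0 al_gt0 bcoord_mon last_le h0 prod_last jd hr.
rewrite /tail_sum big_ord0 !big_ord1 subr0 eE; move: half; rewrite /= a0E.
have h0' : h%:R != 0 :> rat by rewrite gt_eqF.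
have -> : (a ord0)%:R / h%:R *+ 2 = (2 * a ord0)%:R / h%:R :> rat.
  by rewrite natrM mulr2n; ring.
rewrite ler_pdivrMr // mul1r ler_nat => half h1.
have -> : 1 + h%:R^-1 = h.+1%:R / h%:R :> rat by rewrite -natr1; field.
rewrite mulrA -natrM ler_pM2r ?invr_gt0 // ler_nat => h2.
apply: (threefold_bound half h2); move: h1.
have -> : h%:R * ((a ord0)%:R / h%:R * (1 - (a ord0)%:R / h%:R + h%:R^-1) ^+ 2) =
    (a ord0 * (h.+1 - a ord0) ^ 2)%:R / (h ^ 2)%:R :> rat.
  rewrite natrM !natrX natrB -?natr1; first by field.
  by move: half; move: (a ord0) h => x y; lia.
by rewrite ler_pdivrMr ?ltr0n ?expn_gt0 ?wsum_gt0 // -natrM ler_nat.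
Qed.

Theorem sorted_weights_bound : (h + Y n.-1 <= 2 * Y n.-1 ^ 2)%N.
Proof.
have [j [jn hj hr]] := last_split al n eps.
have [jE|jlt] : j = n.-1 \/ (j < n.-1)%N by lia.
  have n1 : (0 < n.-1)%N by lia.
  have hl : tail_sum al eps n.-1 <= al n.-2 by move: hj; rewrite jE => /(_ n1).
  case: (leqP 3 n) => n3; first by apply: sorted_weights_late => //; left.
  case: eps_cases => [[eE aE]|eE].
    have nE : n = 2%N by lia.
    have -> : Y n.-1 = 2%N by rewrite nE.
    by have := sorted_weights_bound2_eq nE aE; move: h => x; lia.
  by apply: sorted_weights_late => //; right; rewrite eE invr_gt0 wsumr_gt0.
have hr1 m : (j < m)%N -> forall i, (m.-1 < i <= n.-1)%N -> al i.-1 < tail_sum al eps i.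
  by move=> jm i im; apply: hr; lia.
have [nE|[nE|n4]] : n = 2%N \/ n = 3%N \/ (3 < n)%N by lia.
- have j1 : (j < 1)%N by lia.
  have -> : Y n.-1 = 2%N by rewrite nE.
  by have := sorted_weights_bound2 nE (hr1 1%N j1); move: h => x; lia.
- have j1 : (j < 2)%N by lia.
  have -> : Y n.-1 = 6%N by rewrite nE.
  by have := sorted_weights_bound3 nE (hr1 2%N j1); move: h => x; lia.
have jd : (j + (n.-1 - j).-1.+1)%N = n.-1 by lia.
have := early_split_bound_ge4 n_ge2 eps_ge0 al_gt0 bcoord_mon bcoord_prod_le last_le
  wsumr_gt0 prod_last n4 jd hj hr.
by rewrite -natrD -natrX -natrM ler_nat.
Qed.

End SortedWeights.

Lemma nonincreasing_reindex n (a : 'I_n.+1 -> nat) :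
  exists2 s : 'I_n.+1 -> 'I_n.+1, injective s & forall i j : 'I_n.+1, (i <= j)%N -> (a (s j) <= a (s i))%N.
Proof.
pose t := [tuple a i | i < n.+1].
have [s s_inj sE] : exists2 s : 'I_n.+1 -> 'I_n.+1, injective s &
    sort geq t = [seq tnth t (s i) | i <- enum 'I_n.+1].
  have /perm.tuple_permP[s sE] : perm_eq [tuple of sort geq t] t by rewrite perm_sort.
  by exists (perm.fun_of_perm s); [exact: perm.perm_inj | rewrite [LHS]sE].
exists s => // i j ij.
have st : sorted geq [seq tnth t (s i) | i <- enum 'I_n.+1].
  by rewrite -sE; apply: sort_sorted => x y; exact: leq_total.
have nthE l : nth 0%N [seq tnth t (s i) | i <- enum 'I_n.+1] (nat_of_ord l) = a (s l).
  by rewrite (nth_map l) ?size_enum_ord // nth_ord_enum tnth_mktuple.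
have tr : transitive geq by move=> x y z /= h1 h2; exact: leq_trans h2 h1.
have := sorted_leq_nth tr (fun x => leqnn x) 0%N st.
move=> /(_ i j); rewrite !nthE !inE size_map size_enum_ord; exact.
Qed.

Section Reindex.
Variables (n : nat) (a : 'I_n.+1 -> nat) (s : 'I_n.+1 -> 'I_n.+1).
Hypothesis s_inj : injective s.

Lemma wsum_reindex : wsum (a \o s) = wsum a.
Proof. by rewrite /wsum [RHS](reindex_inj s_inj). Qed.

Lemma no_small_multiple_reindex : no_small_multiple a -> no_small_multiple (a \o s).
Proof.
move=> nsm c x hx sx xa i; rewrite wsum_reindex in hx.
have := nsm c (x \o invF s_inj); rewrite /= => H.
rewrite -(invF_f s_inj i); apply: H => [j||j].
- by have := hx (invF s_inj j); rewrite /= f_invF.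
- by rewrite (reindex_inj s_inj) -[RHS]sx; apply: eq_bigr => j _; rewrite invF_f.
- by have := xa (invF s_inj j); rewrite /= f_invF.
Qed.

Lemma bezout_reindex b : dot (aw a) b = 1 -> dot (aw (a \o s)) (b \o s) = 1.
Proof. by rewrite /dot => <-; rewrite [RHS](reindex_inj s_inj). Qed.

End Reindex.

Theorem weights_bound n (a : 'I_n.+1 -> nat) (b : 'I_n.+1 -> int) : (2 <= n)%N ->
  (forall i, 0 < a i)%N -> no_small_multiple a -> dot (aw a) b = 1 ->
  (wsum a + sylvester_prod n.-1 <= 2 * sylvester_prod n.-1 ^ 2)%N.
Proof.
move=> n2 a0 nsm ab; have [s s_inj hs] := nonincreasing_reindex a.
rewrite -(wsum_reindex a s_inj).
have a0s i : (0 < (a \o s) i)%N by exact: a0.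
have nsm_s := no_small_multiple_reindex s_inj nsm.
exact: (@sorted_weights_bound n (a \o s) n2 a0s hs nsm_s _ (bezout_reindex s_inj ab)).
Qed.

(** * The function field of the weighted projective space and the conclusion *)

Section FunctionField.
Variables (k : closedFieldType) (n : nat) (a : 'I_n.+1 -> nat).

Definition wps_emb : {rmorphism @wps_field k n a -> {fraction {mpoly k[n.+1]}}} :=
  (\val : @wps_field k n a -> {fraction {mpoly k[n.+1]}}).

Lemma wps_degree0 : degree0_field a (@wps_const k n a) wps_emb.
Proof.
split=> [//|d p q q0 hp hq|f p q d q0 fE qd].
  by exists (Subfield (gm_inv_frac hp hq q0)).
exact: wps_repr q0 fE qd.
Qed.

Lemma wps_points_model : @wps k n a = points_model wps_emb.
Proof. by []. Qed.

End FunctionField.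
Theorem theorem1p2 (k : closedFieldType) (n : nat) (a : 'I_n.+1 -> nat) :
  [pchar k]%R =i pred0 ->
  (2 <= n)%N ->
  (forall i, (0 < a i)%N) ->
  well_formed a ->
  canonical_singularities (@wps_const k n a) n (@wps k n a) ->
  forall q : nat,
    is_fano_index (@wps_const k n a) n (@wps k n a) q ->
    (q <= sylvester_y n * (2 * sylvester_y n - 1))%N.
Proof.
move=> char0 n2 a0 wf can q [q0 qd _].
have n0 : (0 < n)%N := ltnW n2; have dK := wps_degree0 k a.
rewrite wps_points_model in can qd.
have nsm := no_interior_small_multiple a0 (canonical_no_interior_point char0 dK n0 a0 wf can).
have [b _ hb] := well_formed_bezout n0 a0 wf ord0.
have qh := dvdn_leq (wsum_gt0 a0) (fano_index_dvd char0 dK n0 a0 wf q0 qd).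
(* [sylvester_prod n.-1] is [y_n] because [sylvester_prod m] is the product of the first [m]
   terms. *)
have := weights_bound n2 a0 nsm hb; rewrite -[sylvester_prod _]/(sylvester_y n).
move: (wsum a) (sylvester_y n) qh => h y qh.
rewrite mulnBr muln1 mulnCA => hy; apply: leq_trans qh _.
by rewrite leq_subRL ?(leq_trans _ hy) ?leq_addl // addnC.
Qed.
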